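(* Let $\Re(w)=P(z,\zeta,\overline z,\overline\zeta)+Q(z,\zeta,\overline z,\overline\zeta,\Im(w))$ be a real analytic uniformly $2$-nondegenerate CR hypersurface in $\mathbb C^{n+1}$ with rank $s$ Levi form, where all terms of $Q$ have weighted degree higher than $2$ and $$P(z,\zeta,\overline z,\overline\zeta)=z^TH(\zeta,\overline\zeta)\overline z+\Re(\overline z^TS(\zeta,\overline\zeta)\overline z),$$ $H$ Hermitian, $S$ symmetric $s\times s$ matrix valued, $H(0,0)$ nondegenerate. Then this hypersurface and the $2$-nondegenerate model $\Re(w)=P(z,\zeta,\overline z,\overline\zeta)$ have the same modified symbol at $0$ with respect to any normalization conditions.
   Context: Weights: $\mathrm{wt}(w)=2$, $\mathrm{wt}(z_j)=1$, $\mathrm{wt}(\zeta_\alpha)=0$, for coordinates $(w,z,\zeta)\in\mathbb C\oplus\mathbb C^s\oplus\mathbb C^{n-s}$. ALGEBRA. $\mathbb{C}\mathfrak g_-=\mathfrak g_{-2,0}\oplus\mathfrak g_{-1,-1}\oplus\mathfrak g_{-1,1}$ is the complex Heisenberg algebra of dimension $2s+1$, and $\mathfrak{csp}(\mathbb{C}\mathfrak g_{-1})=\mathfrak{csp}_{0,-2}\oplus\mathfrak{csp}_{0,0}\oplus\mathfrak{csp}_{0,2}$ its algebra of first-grading preserving derivations, bigraded so that $\mathfrak{csp}_{0,0}$ preserves the bigrading and $\mathfrak{csp}_{0,\pm2}$ maps $\mathfrak g_{-1,\mp1}$ to $\mathfrak g_{-1,\pm1}$ and kills $\mathfrak g_{-1,\pm1}$.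 SYMBOLS. Let $(M,\mathcal H)$ be a CR hypersurface of dimension $2n+1$ with $\mathcal K_2\subset\mathcal H$ the kernel of the Levi form $\frac1{2i}[X,\overline Y]\bmod\mathcal H\oplus\overline{\mathcal H}$, of constant rank $n-s$. The bigraded Lie algebra $\mathbb C\mathfrak g_-(p)$ has components $\mathfrak g_{-2,0}(p)=\mathbb CT_pM/(\mathcal H_p\oplus\overline{\mathcal H}_p)$, $\mathfrak g_{-1,1}(p)=\mathcal H_p/(\mathcal K_2)_p$, $\mathfrak g_{-1,-1}(p)=\overline{\mathcal H}_p/(\overline{\mathcal K_2})_p$ and bracket induced by Lie brackets of vector fields. $\iota:(\mathcal K_2)_p\to\mathfrak{csp}(\mathbb C\mathfrak g_{-1}(p))_{0,2}$ is given by $\iota(v)(w)=0$ for $w\in\mathfrak g_{-1,1}(p)$ and $\iota(v)(w)=[V,W]_p\bmod(\mathcal K_2\oplus\overline{\mathcal H})$ for $w\in\mathfrak g_{-1,-1}(p)$ ($V,W$ sections of $\mathcal K_2,\overline{\mathcal H}$ extending $v,w$), extended by $\iota(\overline v)=\overline{\iota(v)}$. $M$ is uniformly $2$-nondegenerate if $\mathcal K_2\neq0$ has constant rank and $\iota$ is injective on $\mathcal K_2$ at every point. Put $\mathfrak g_{0,2}(p)=\iota(\mathcal K_2)_p$, $\mathfrak g_{0,-2}(p)=\iota(\overline{\mathcal K_2})_p$, and let $\mathfrak g_{0,0}(p)$ be the set of bigrading preserving elements of $\mathfrak{csp}(\mathbb C\mathfrak g_{-1}(p))$ normalizing $\mathfrak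 g_{0,\pm2}(p)$. $\mathcal F_p$ is the set of bigraded Lie algebra isomorphisms $\tilde\phi:\mathbb C\mathfrak g_-(p)\to\mathbb C\mathfrak g_-$ (extended to derivations by conjugation); it defines the involution $\sigma_{\tilde\phi}$ induced by complex conjugation. MODIFIED SYMBOL ALONG A SECTION. Let $\pi:M\to N$ be the local quotient by the foliation of $TM\cap(\mathcal K_2\oplus\overline{\mathcal K_2})$ and $M_{\pi(p)}$ the leaf through $p$. For a local section $\tilde\phi:M_{\pi(p)}\to\mathcal F$ put $\mathscr I(\tilde\phi)=(\pi_*\circ\tilde\phi^{-1})^{-1}$ and let $\iota_{\tilde\phi}:(\mathcal K_2)_p\oplus(\overline{\mathcal K_2})_p\to\mathfrak{csp}(\mathbb C\mathfrak g_{-1})$ be the complex linear extension of $\dot p(0)\mapsto\frac{d}{dt}|_{t=0}\mathscr I(\tilde\phi(p))\circ\mathscr I(\tilde\phi(p(t)))^{-1}$ for curves $p(t)$ in $M_{\pi(p)}$, $p(0)=p$. The modified symbol at $p$ along $\tilde\phi$ is $\mathfrak g_{\le0}^{\mathrm{mod}}(\tilde\phi;p)=\mathbb C\mathfrak g_-\oplus(\iota_{\tilde\phi}(\mathcal K_2(p)\oplus\overline{\mathcal K_2}(p))+\tilde\phi(\mathfrak g_{0,0}(p)))$. NORMALIZATION. For a local frame $e_\alpha$ of $\mathcal K_2$ put $S^{0,2}_\alpha(\tilde\phi)=\tilde\phi(\iota(e_\alpha))$, $S^{0,-2}_\alpha(\tilde\phi)=\tilde\phi(\iota(\overline{e_\alpha}))$,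 and define bilinear maps $O_{0,\pm2}(\tilde\phi)(p):(\mathcal K_2)_p\otimes\tilde\phi(\mathfrak g_{0,\pm2}(p))\to\mathfrak{csp}_{0,\pm2}/\tilde\phi(\mathfrak g_{0,\pm2}(p))$ by $(X,S^{0,\pm2}_\alpha)\mapsto X(S^{0,\pm2}_\alpha(\tilde\phi))(p)$. A normalization condition is a choice, depending only on $\tilde\phi(\mathfrak g_{0,\pm2}(p))$ and the class itself, of one pair $(O^N_{0,-2}(\tilde\phi(p)),O^N_{0,2}(\tilde\phi(p)))$ in each class $\{(O_{0,-2}(\tilde\phi')(p),O_{0,2}(\tilde\phi')(p)):\tilde\phi'(p)=\tilde\phi(p)\}$ (with $(0,0)$ chosen when it belongs to the class). A section $\tilde\phi$ is normalized at $p$ if $O_{0,\pm2}(\tilde\phi)(p)=O^N_{0,\pm2}(\tilde\phi(p))$, and then $\mathfrak g_{\le0}^{\mathrm{mod}}(\tilde\phi(p)):=\mathfrak g_{\le0}^{\mathrm{mod}}(\tilde\phi;p)$ is the modified symbol at $\tilde\phi(p)$ with respect to the normalization condition. Two hypersurfaces have the same modified symbol at $0$ if there are $\tilde\phi(0)$ for one and $\tilde\phi'(0)$ for the other at which their modified symbols and the induced involutions $\sigma_{\tilde\phi(0)}$, $\sigma_{\tilde\phi'(0)}$ coincide. *)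

(* Defs.v *)
From mathcomp Require Export all_boot all_order all_algebra complex.
From mathcomp Require Export all_classical all_reals all_analysis.

Set Implicit Arguments.
Unset Strict Implicit.
Unset Printing Implicit Defensive.

Import Order.TTheory GRing.Theory Num.Theory numFieldNormedType.Exports.

Local Open Scope classical_set_scope.
Local Open Scope ring_scope.
Local Open Scope complex_scope.

Definition sumset (V : nmodType) (A B : set V) : set V :=
  [set v | exists a b, [/\ A a, B b & v = a + b]].

Definition conjv (R : realType) (k : nat) (v : 'rV[R[i]]_k) : 'rV[R[i]]_k :=
  map_mx (@conjc R) v.

Definition conjset (R : realType) (k : nat) (A : set 'rV[R[i]]_k) :
  set 'rV[R[i]]_k := [set v | A (conjv v)].

Definition complexify (R : realType) (k : nat) (v : 'rV[R]_k) : 'rV[R[i]]_k :=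
  map_mx (fun a : R => a%:C) v.

Definition has_dim (R : realType) (d : nat) (A : set 'rV[R[i]]_d) (k : nat) :=
  exists B : 'M[R[i]]_(k, d), row_free B /\ forall v, A v <-> (v <= B)%MS.

(* In a chart R^d, tangent vectors are real row vectors and complexified
   tangent vectors are elements of 'rV[R[i]]_d acting as complex derivations. *)

Definition pd (R : realType) (d : nat) (j : 'I_d) (f : 'rV[R]_d -> R)
  (x : 'rV[R]_d) : R := 'D_(delta_mx 0 j : 'rV[R]_d) f x.

Fixpoint iter_pd (R : realType) (d : nat) (l : seq 'I_d) (f : 'rV[R]_d -> R) :
  'rV[R]_d -> R :=
  if l is j :: l' then pd j (iter_pd l' f) else f.

Definition smooth_near (R : realType) (d : nat) (p : 'rV[R]_d)
  (f : 'rV[R]_d -> R) :=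
  \forall q \near p, forall l : seq 'I_d, differentiable (iter_pd l f) q.

Definition csmooth_near (R : realType) (d a b : nat) (p : 'rV[R]_d)
  (f : 'rV[R]_d -> 'M[R[i]]_(a, b)) :=
  forall i j, smooth_near p (fun q => complex.Re (f q i j)) /\
              smooth_near p (fun q => complex.Im (f q i j)).

Definition dfun (R : realType) (d : nat) (f : 'rV[R]_d -> R[i]) (x : 'rV[R]_d)
  (X : 'rV[R[i]]_d) : R[i] :=
  \sum_(j < d) X 0 j * (pd j (fun y => complex.Re (f y)) x
                        +i* pd j (fun y => complex.Im (f y)) x).

Definition dmap (R : realType) (d k : nat) (f : 'rV[R]_d -> 'rV[R]_k)
  (x : 'rV[R]_d) (X : 'rV[R[i]]_d) : 'rV[R[i]]_k :=
  \row_j dfun (fun y => (f y 0 j)%:C) x X.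

Definition vfield (R : realType) (d : nat) := 'rV[R]_d -> 'rV[R[i]]_d.

Definition lie (R : realType) (d : nat) (X Y : vfield R d) : vfield R d :=
  fun x => \row_j (dfun (fun y => Y y 0 j) x (X x)
                   - dfun (fun y => X y 0 j) x (Y x)).

Definition distribution (R : realType) (d : nat) :=
  'rV[R]_d -> set 'rV[R[i]]_d.

Definition bar (R : realType) (d : nat) (D : distribution R d) :
  distribution R d := fun q => conjset (D q).

Definition oplus (R : realType) (d : nat) (D E : distribution R d) :
  distribution R d := fun q => sumset (D q) (E q).

Definition section (R : realType) (d : nat) (D : distribution R d)
  (p : 'rV[R]_d) (X : vfield R d) :=
  csmooth_near p X /\ \forall q \near p, D q (X q).

(* Below, H is the bundle of (1,0)-vectors of a CR structure near p.
   [levi H p x y t]: t represents (1/2i)[X, conj Y] at p, modulo H + conj H. *)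
Definition levi (R : realType) (d : nat) (H : distribution R d) (p : 'rV[R]_d)
  (x y t : 'rV[R[i]]_d) :=
  exists X Y : vfield R d,
    [/\ section H p X, section H p Y, X p = x, Y p = y &
        oplus H (bar H) p
          (t - (2%:R * (0 +i* 1))^-1 *: lie X (fun q => conjv (Y q)) p)].

Definition K2 (R : realType) (d : nat) (H : distribution R d) :
  distribution R d :=
  fun p => [set v | H p v /\ forall w, H p w -> levi H p v w 0].

(* [iota2 H p v w u]: u in H_p represents iota(v)(w) modulo K2, where v is in
   (K2)_p and w in (conj H)_p. *)
Definition iota2 (R : realType) (d : nat) (H : distribution R d) (p : 'rV[R]_d)
  (v w u : 'rV[R[i]]_d) :=
  H p u /\ exists V W : vfield R d,
    [/\ section (K2 H) p V, section (bar H) p W, V p = v, W p = w &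
        oplus (K2 H) (bar H) p (lie V W p - u)].

Definition uniformly_2nondegenerate (R : realType) (d : nat)
  (H : distribution R d) (m : nat) (p : 'rV[R]_d) :=
  (0 < m)%N /\
  \forall q \near p,
    has_dim (K2 H q) m /\
    forall v, K2 H q v -> (forall w, bar H q w -> iota2 H q v w 0) -> v = 0.

(* The elements of C g_- = g_{-2,0} + g_{-1,1} + g_{-1,-1} are the row vectors
   [hvec a b c]; its endomorphisms are matrices acting on the right. *)

Notation heis_dim s := (1 + (s + s))%N.

Definition hvec (R : realType) (s : nat) (a : 'rV[R[i]]_1) (b c : 'rV[R[i]]_s) :
  'rV[R[i]]_(heis_dim s) := row_mx a (row_mx b c).

Definition hpart1 (R : realType) (s : nat) (x : 'rV[R[i]]_(heis_dim s)) :
  'rV[R[i]]_s := lsubmx (rsubmx x).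

Definition hpartm1 (R : realType) (s : nat) (x : 'rV[R[i]]_(heis_dim s)) :
  'rV[R[i]]_s := rsubmx (rsubmx x).

Definition hbracket (R : realType) (s : nat) (x y : 'rV[R[i]]_(heis_dim s)) :
  'rV[R[i]]_(heis_dim s) :=
  hvec (hpart1 x *m (hpartm1 y)^T - hpart1 y *m (hpartm1 x)^T) 0 0.

Definition csp (R : realType) (s : nat) : set 'M[R[i]]_(heis_dim s) :=
  [set D | [/\ forall a, exists a', hvec a 0 0 *m D = hvec a' 0 0,
               forall b c, exists b' c', hvec 0 b c *m D = hvec 0 b' c' &
               forall x y, hbracket x y *m D
                           = hbracket (x *m D) y + hbracket x (y *m D)]].

Definition csp_0 (R : realType) (s : nat) : set 'M[R[i]]_(heis_dim s) :=
  [set D | [/\ csp D,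
               forall b, exists b', hvec 0 b 0 *m D = hvec 0 b' 0 &
               forall c, exists c', hvec 0 0 c *m D = hvec 0 0 c']].

Definition csp_2 (R : realType) (s : nat) : set 'M[R[i]]_(heis_dim s) :=
  [set D | [/\ csp D,
               forall b, hvec 0 b 0 *m D = 0 &
               forall c, exists b, hvec 0 0 c *m D = hvec 0 b 0]].

Definition csp_m2 (R : realType) (s : nat) : set 'M[R[i]]_(heis_dim s) :=
  [set D | [/\ csp D,
               forall c, hvec 0 0 c *m D = 0 &
               forall b, exists c, hvec 0 b 0 *m D = hvec 0 0 c]].

(* A bigraded isomorphism C g_-(p) -> C g_- is given by three linear maps on
   representatives: [gr_m2] on C T_p M, [gr_1] on H_p and [gr_m1] on
   (conj H)_p; the values of the matrices [gr_1], [gr_m1] outside these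
   subspaces are irrelevant. *)

Record gr_map (R : realType) (d s : nat) := GrMap {
  gr_m2 : 'M[R[i]]_(d, 1);
  gr_1 : 'M[R[i]]_(d, s);
  gr_m1 : 'M[R[i]]_(d, s) }.

Definition gr_eq (R : realType) (d s : nat) (H : distribution R d)
  (p : 'rV[R]_d) (f g : gr_map R d s) :=
  [/\ gr_m2 f = gr_m2 g,
      forall X, H p X -> X *m gr_1 f = X *m gr_1 g &
      forall X, bar H p X -> X *m gr_m1 f = X *m gr_m1 g].

(* The remaining brackets vanish on both sides, so only
   g_{-1,1} x g_{-1,-1} -> g_{-2,0} has to be preserved. *)
Definition isF (R : realType) (d s : nat) (H : distribution R d)
  (p : 'rV[R]_d) (f : gr_map R d s) :=
  [/\ (forall X, X *m gr_m2 f = 0 <-> oplus H (bar H) p X) /\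
        (forall a, exists X : 'rV_d, X *m gr_m2 f = a),
      (forall X, H p X -> (X *m gr_1 f = 0 <-> K2 H p X)) /\
        (forall b, exists X, H p X /\ X *m gr_1 f = b),
      (forall X, bar H p X -> (X *m gr_m1 f = 0 <-> bar (K2 H) p X)) /\
        (forall c, exists X, bar H p X /\ X *m gr_m1 f = c) &
      forall X Y, section H p X -> section (bar H) p Y ->
        hvec (lie X Y p *m gr_m2 f) 0 0
        = hbracket (hvec 0 (X p *m gr_1 f) 0) (hvec 0 0 (Y p *m gr_m1 f))].

(* The graph of the antilinear involution of C g_- induced by f from complex
   conjugation on C g_-(p). *)
Definition involution (R : realType) (d s : nat) (H : distribution R d)
  (p : 'rV[R]_d) (f : gr_map R d s) :
  set ('rV[R[i]]_(heis_dim s) * 'rV[R[i]]_(heis_dim s)) :=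
  [set xy | exists X Y Z, [/\ H p Y, bar H p Z,
     xy.1 = hvec (X *m gr_m2 f) (Y *m gr_1 f) (Z *m gr_m1 f) &
     xy.2 = hvec (conjv X *m gr_m2 f) (conjv Z *m gr_1 f)
                 (conjv Y *m gr_m1 f)]].

(* f(iota(v)) = f o iota(v) o f^-1 for v in (K2)_p, as an element of
   csp_{0,2}. *)
Definition push2 (R : realType) (d s : nat) (H : distribution R d)
  (p : 'rV[R]_d) (f : gr_map R d s) (v : 'rV[R[i]]_d) :
  'M[R[i]]_(heis_dim s) :=
  xget 0 [set D | csp_2 D /\ forall w u, bar H p w -> iota2 H p v w u ->
                    hvec 0 0 (w *m gr_m1 f) *m D = hvec 0 (u *m gr_1 f) 0].

(* f(iota(conj v)) for v in (K2)_p, where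
   iota(conj v)(w) = conj (iota(v)(conj w)). *)
Definition pushm2 (R : realType) (d s : nat) (H : distribution R d)
  (p : 'rV[R]_d) (f : gr_map R d s) (v : 'rV[R[i]]_d) :
  'M[R[i]]_(heis_dim s) :=
  xget 0 [set D | csp_m2 D /\ forall w u, H p w -> iota2 H p v (conjv w) u ->
                    hvec 0 (w *m gr_1 f) 0 *m D
                    = hvec 0 0 (conjv u *m gr_m1 f)].

Definition fg_2 (R : realType) (d s : nat) (H : distribution R d)
  (p : 'rV[R]_d) (f : gr_map R d s) : set 'M[R[i]]_(heis_dim s) :=
  [set push2 H p f v | v in K2 H p].

Definition fg_m2 (R : realType) (d s : nat) (H : distribution R d)
  (p : 'rV[R]_d) (f : gr_map R d s) : set 'M[R[i]]_(heis_dim s) :=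
  [set pushm2 H p f v | v in K2 H p].

(* As f is an isomorphism of bigraded Lie algebras, f(g_{0,0}(p)) is the
   normalizer of f(g_{0,2}(p)) and f(g_{0,-2}(p)) in csp_{0,0}. *)
Definition fg_0 (R : realType) (d s : nat) (H : distribution R d)
  (p : 'rV[R]_d) (f : gr_map R d s) : set 'M[R[i]]_(heis_dim s) :=
  [set D | [/\ csp_0 D,
      forall E, fg_2 H p f E -> fg_2 H p f (D *m E - E *m D) &
      forall E, fg_m2 H p f E -> fg_m2 H p f (D *m E - E *m D)]].

(* [quo] is a submersion near p whose fibres are the leaves of the foliation
   TM cap (K2 + conj K2). *)
Definition local_quotient (R : realType) (d k : nat) (H : distribution R d)
  (p : 'rV[R]_d) (quo : 'rV[R]_d -> 'rV[R]_k) :=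
  (forall j, smooth_near p (fun q => quo q 0 j)) /\
  \forall q \near p,
    (forall Y, exists X, dmap quo q X = Y) /\
    (forall X : 'rV[R]_d, dmap quo q (complexify X) = 0 <->
       oplus (K2 H) (bar (K2 H)) q (complexify X)).

(* c is a smooth curve in the leaf through p with c(0) = p, c'(0) = X. *)
Definition leaf_curve (R : realType) (d k : nat) (quo : 'rV[R]_d -> 'rV[R]_k)
  (p : 'rV[R]_d) (c : R -> 'rV[R]_d) (X : 'rV[R]_d) :=
  [/\ c 0 = p,
      \forall t \near (0 : R), quo (c t) = quo p,
      \forall t \near (0 : R), forall (j : 'I_d) (n : nat),
        derivable (derive1n n (fun r => c r 0 j)) t 1 &
      is_derive (0 : R) 1 c X].

Definition is_cderive0 (R : realType) (a b : nat) (g : R -> 'M[R[i]]_(a, b))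
  (D : 'M[R[i]]_(a, b)) :=
  forall i j,
    is_derive (0 : R) 1 (fun t => complex.Re (g t i j)) (complex.Re (D i j)) /\
    is_derive (0 : R) 1 (fun t => complex.Im (g t i j)) (complex.Im (D i j)).

(* D is the derivative at p, along X in (K2 + conj K2)_p, of a function F
   defined on the leaf through p: the complex linear extension of
   c'(0) |-> d/dt F(c(t)) at t = 0. *)
Definition leaf_derive (R : realType) (d k a b : nat)
  (quo : 'rV[R]_d -> 'rV[R]_k) (p : 'rV[R]_d)
  (F : 'rV[R]_d -> 'M[R[i]]_(a, b)) (X : 'rV[R[i]]_d) (D : 'M[R[i]]_(a, b)) :=
  exists c1 c2 D1 D2,
    [/\ leaf_curve quo p c1 (map_mx (@complex.Re R) X) /\
          leaf_curve quo p c2 (map_mx (@complex.Im R) X),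
        is_cderive0 (fun t => F (c1 t)) D1,
        is_cderive0 (fun t => F (c2 t)) D2 &
        D = D1 + (0 +i* 1) *: D2].

(* A smooth section of F over the leaf through p, near p; only its values on
   that leaf matter. *)
Definition leaf_section (R : realType) (d k s : nat) (H : distribution R d)
  (quo : 'rV[R]_d -> 'rV[R]_k) (p : 'rV[R]_d) (f : 'rV[R]_d -> gr_map R d s) :=
  [/\ csmooth_near p (fun q => gr_m2 (f q)),
      csmooth_near p (fun q => gr_1 (f q)),
      csmooth_near p (fun q => gr_m1 (f q)) &
      \forall q \near p, quo q = quo p -> isF H q (f q)].

(* The graph of quo_* o f(q)^-1 from C g_- to gr(C T N) at quo(q): Y represents
   the component in C T N / D and Z is the component in D, where
   D = quo_*(H + conj H) is the contact distribution. *)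
Definition quo_frame (R : realType) (d k s : nat) (H : distribution R d)
  (quo : 'rV[R]_d -> 'rV[R]_k) (f : 'rV[R]_d -> gr_map R d s) (q : 'rV[R]_d)
  (x : 'rV[R[i]]_(heis_dim s)) (Y Z : 'rV[R[i]]_k) :=
  exists X X1 X2,
    [/\ H q X1, bar H q X2,
        x = hvec (X *m gr_m2 (f q)) (X1 *m gr_1 (f q)) (X2 *m gr_m1 (f q)),
        Y = dmap quo q X & Z = dmap quo q (X1 + X2)].

(* I(f(p)) o I(f(q))^-1 for q in the leaf through p, where
   I(f) = (quo_* o f^-1)^-1. *)
Definition transition (R : realType) (d k s : nat) (H : distribution R d)
  (quo : 'rV[R]_d -> 'rV[R]_k) (f : 'rV[R]_d -> gr_map R d s) (p q : 'rV[R]_d) :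
  'M[R[i]]_(heis_dim s) :=
  xget 0 [set A | forall x x' Y Y' Z,
    quo_frame H quo f q x Y Z -> quo_frame H quo f p x' Y' Z ->
    (exists X, oplus H (bar H) p X /\ Y - Y' = dmap quo p X) ->
    x *m A = x'].

(* The image of iota_f on (K2 + conj K2)_p. *)
Definition iota_image (R : realType) (d k s : nat) (H : distribution R d)
  (quo : 'rV[R]_d -> 'rV[R]_k) (p : 'rV[R]_d) (f : 'rV[R]_d -> gr_map R d s) :
  set 'M[R[i]]_(heis_dim s) :=
  [set D | exists X, oplus (K2 H) (bar (K2 H)) p X /\
                     leaf_derive quo p (transition H quo f p) X D].

(* A subspace of C g_- + csp, elements of the direct sum being pairs. *)
Definition modified_symbol_along (R : realType) (d k s : nat)
  (H : distribution R d) (quo : 'rV[R]_d -> 'rV[R]_k) (p : 'rV[R]_d)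
  (f : 'rV[R]_d -> gr_map R d s) :
  set ('rV[R[i]]_(heis_dim s) * 'M[R[i]]_(heis_dim s)) :=
  [set xD | sumset (iota_image H quo p f) (fg_0 H p (f p)) xD.2].

Definition K2_frame (R : realType) (d m : nat) (H : distribution R d)
  (p : 'rV[R]_d) (e : 'I_m -> vfield R d) :=
  (forall al, section (K2 H) p (e al)) /\
  \forall q \near p,
    row_free (\matrix_al e al q) /\
    forall v, K2 H q v <-> (v <= \matrix_al e al q)%MS.

(* Bilinear maps K (x) G -> csp_{0,+-2} / G, with cosets of G as values; the
   value is empty outside the domain K x G. *)
Definition omap (R : realType) (d s : nat) :=
  'rV[R[i]]_d -> 'M[R[i]]_(heis_dim s) -> set 'M[R[i]]_(heis_dim s).

Definition omap0 (R : realType) (d s : nat) (K : set 'rV[R[i]]_d)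
  (G : set 'M[R[i]]_(heis_dim s)) : omap R d s :=
  fun X E => [set D | [/\ K X, G E & G D]].

(* The map (X, E_al(p)) |-> X(E_al)(p) mod G, extended linearly in the second
   argument, where E_al(q) = S q (e_al(q)). *)
Definition omap_of (R : realType) (d k s : nat) (m : nat)
  (H : distribution R d) (quo : 'rV[R]_d -> 'rV[R]_k) (p : 'rV[R]_d)
  (S : 'rV[R]_d -> 'rV[R[i]]_d -> 'M[R[i]]_(heis_dim s))
  (G : set 'M[R[i]]_(heis_dim s)) : omap R d s :=
  fun X E => [set D | K2 H p X /\
    exists (e : 'I_m -> vfield R d) (c : 'I_m -> R[i])
           (D' : 'I_m -> 'M[R[i]]_(heis_dim s)),
      [/\ K2_frame H p e,
          E = \sum_al c al *: S p (e al p),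
          forall al, leaf_derive quo p (fun q => S q (e al q)) X (D' al) &
          G (D - \sum_al c al *: D' al)]].

(* The pair (O_{0,-2}(f)(p), O_{0,2}(f)(p)). *)
Definition opair (R : realType) (d k s : nat) (m : nat) (H : distribution R d)
  (quo : 'rV[R]_d -> 'rV[R]_k) (p : 'rV[R]_d) (f : 'rV[R]_d -> gr_map R d s) :
  omap R d s * omap R d s :=
  (omap_of m H quo p (fun q => pushm2 H q (f q)) (fg_m2 H p (f p)),
   omap_of m H quo p (fun q => push2 H q (f q)) (fg_2 H p (f p))).

Definition opair_class (R : realType) (d k s : nat) (m : nat)
  (H : distribution R d) (quo : 'rV[R]_d -> 'rV[R]_k) (p : 'rV[R]_d)
  (f0 : gr_map R d s) : set (omap R d s * omap R d s) :=
  [set opair m H quo p f | f in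
     [set f | leaf_section H quo p f /\ gr_eq H p (f p) f0]].

(* Arguments: (K2)_p, f(g_{0,-2}(p)), f(g_{0,2}(p)) and the class. The first is
   the domain of the elements of the class, so it carries no information beyond
   the class; it only serves to name the zero pair. *)
Definition choice_rule (R : realType) (d s : nat) :=
  set 'rV[R[i]]_d -> set 'M[R[i]]_(heis_dim s) -> set 'M[R[i]]_(heis_dim s) ->
  set (omap R d s * omap R d s) -> omap R d s * omap R d s.

(* A choice on the classes that actually occur extends to all nonempty sets of
   pairs, so quantifying over all of them is no restriction. *)
Definition normalization_condition (R : realType) (d s : nat)
  (nu : choice_rule R d s) :=
  forall K Gm2 G2 cls, cls !=set0 ->
    cls (nu K Gm2 G2 cls) /\
    (cls (omap0 K Gm2, omap0 K G2) ->
     nu K Gm2 G2 cls = (omap0 K Gm2, omap0 K G2)).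

Definition normalized (R : realType) (d k s : nat) (m : nat)
  (nu : choice_rule R d s) (H : distribution R d)
  (quo : 'rV[R]_d -> 'rV[R]_k) (p : 'rV[R]_d) (f : 'rV[R]_d -> gr_map R d s) :=
  opair m H quo p f
  = nu (K2 H p) (fg_m2 H p (f p)) (fg_2 H p (f p))
       (opair_class m H quo p (f p)).

(* All values of the modified symbol on sections through f0 in F_p that are
   normalized at p; no uniqueness of the value is presupposed. *)
Definition modified_symbol (R : realType) (d k s : nat) (m : nat)
  (nu : choice_rule R d s) (H : distribution R d)
  (quo : 'rV[R]_d -> 'rV[R]_k) (p : 'rV[R]_d) (f0 : gr_map R d s) :
  set (set ('rV[R[i]]_(heis_dim s) * 'M[R[i]]_(heis_dim s))) :=
  [set modified_symbol_along H quo p f | f in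
     [set f | [/\ leaf_section H quo p f, gr_eq H p (f p) f0 &
                  normalized m nu H quo p f]]].

Definition same_modified_symbol (R : realType) (d k s : nat) (m : nat)
  (nu : choice_rule R d s) (p : 'rV[R]_d)
  (H : distribution R d) (quo : 'rV[R]_d -> 'rV[R]_k)
  (H' : distribution R d) (quo' : 'rV[R]_d -> 'rV[R]_k) :=
  exists f f' : gr_map R d s,
    [/\ isF H p f, isF H' p f',
        involution H p f = involution H' p f',
        modified_symbol m nu H quo p f !=set0 &
        modified_symbol m nu H quo p f = modified_symbol m nu H' quo' p f'].

Definition ffun_of_box (k N : nat) (a : {ffun 'I_k -> 'I_N}) :
  {ffun 'I_k -> nat} := [ffun i => nat_of_ord (a i)].

Definition psum (R : realType) (k : nat) (c : {ffun 'I_k -> nat} -> R)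
  (x : 'rV[R]_k) (N : nat) : R :=
  \sum_(a : {ffun 'I_k -> 'I_N})
    c (ffun_of_box a) * \prod_i x 0 i ^+ a i.

(* f is the sum, on a polydisc around 0, of an absolutely convergent power
   series with coefficients c. *)
Definition expansion (R : realType) (k : nat) (f : 'rV[R]_k -> R)
  (c : {ffun 'I_k -> nat} -> R) :=
  exists2 r : R, 0 < r &
    (exists B : R, forall N, psum (fun a => `|c a|) (const_mx r) N <= B) /\
    forall x : 'rV[R]_k, (forall i, `|x 0 i| < r) ->
      psum c x N @[N --> \oo] --> f x.

Definition analytic0 (R : realType) (k : nat) (f : 'rV[R]_k -> R) :=
  exists c, expansion f c.

(* The hypersurface Re w = F(z, zeta, Im w) in C^(s + m + 1) is parametrized by
   x = (Re z, Im z, Re zeta, Im zeta, Im w). *)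

Notation chart_dim s m := ((s + s) + ((m + m) + 1))%N.

Definition cplx (R : realType) (k : nat) (e : 'rV[R]_(k + k)) : 'rV[R[i]]_k :=
  \row_j (lsubmx e 0 j +i* rsubmx e 0 j).

Definition zco (R : realType) (s m : nat) (x : 'rV[R]_(chart_dim s m)) :
  'rV[R[i]]_s := cplx (lsubmx x).

Definition zetaco (R : realType) (s m : nat) (x : 'rV[R]_(chart_dim s m)) :
  'rV[R[i]]_m := cplx (lsubmx (rsubmx x)).

Definition vco (R : realType) (s m : nat) (x : 'rV[R]_(chart_dim s m)) : R :=
  rsubmx (rsubmx x) 0 0.

(* The (1,0)-vectors of the hypersurface: complexified tangent vectors that
   annihilate the conjugates of the coordinates z, zeta and w = F + i v. *)
Definition graph_CR (R : realType) (s m : nat)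
  (F : 'rV[R]_(chart_dim s m) -> R) : distribution R (chart_dim s m) :=
  fun x => [set X | [/\ forall j, dfun (fun y => (zco y 0 j)^*) x X = 0,
                        forall al, dfun (fun y => (zetaco y 0 al)^*) x X = 0 &
                        dfun (fun y => (F y +i* vco y)^*) x X = 0]].

Definition model (R : realType) (s m : nat) (H S : 'rV[R[i]]_m -> 'M[R[i]]_s)
  (x : 'rV[R]_(chart_dim s m)) : R :=
  let z := zco x in let zb := conjv z in
  complex.Re ((z *m H (zetaco x) *m zb^T) 0 0)
  + complex.Re ((zb *m S (zetaco x) *m zb^T) 0 0).

(* Real and imaginary parts of z_j are linear in z and its conjugate, so the
   weight of a term can be read off the expansion in real coordinates. *)
Definition coord_wt (s m : nat) (i : 'I_(chart_dim s m)) : nat :=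
  match fintype.split i with
  | inl _ => 1%N
  | inr k => match fintype.split k with inl _ => 0%N | inr _ => 2%N end
  end.

Definition term_wt (s m : nat) (a : {ffun 'I_(chart_dim s m) -> nat}) : nat :=
  (\sum_i coord_wt i * a i)%N.

Definition analytic_mx (R : realType) (s m : nat)
  (A : 'rV[R[i]]_m -> 'M[R[i]]_s) :=
  forall i j,
    analytic0 (fun e : 'rV[R]_(m + m) => complex.Re (A (cplx e) i j)) /\
    analytic0 (fun e : 'rV[R]_(m + m) => complex.Im (A (cplx e) i j)).

(* Main.v *)
From HB Require Import structures.
From mathcomp Require Import ring lra.
Require Import Defs.

(** The proof shows that the two hypersurfaces F = P + Q and F0 = P have, for
    every section, literally the same modified symbol, normalization classes and
    involution at 0, because all the data entering these objects agree along the
    leaf z = 0, v = 0 (v = Im w).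

    Weights. In the coordinates z, zeta, v a function has weighted order k when
    it is O(t^k) along the dilations with weights 1, 0, 2, and so do its
    derivatives with k lowered by their weights ([W]); a function of positive
    order vanishes on the leaf, which is the fixed point set of the dilations.
    The fields L_A = d_A + mu_A d_v, with A running over z and zeta, form a frame
    of the (1,0)-vectors, and the Levi matrix is [lev]. The slope mu_A has order
    2 - wA and [lev] A B has order 2 - wA - wB; since Q has order 3, each of these
    quantities differs by one order more between F and F0 ([cW_mu_sub],
    [cW_lev_sub]). Hence on the leaf the CR bundle, the Levi matrix, the kernel K2
    and the tensor iota coincide; iota involves only zeta-rows of first
    derivatives of [lev], whose differences still have positive order
    ([near_agree]).

    The model. The zz-block of [lev] for F0 at the origin is 2i H(0), which is
    invertible, so the rank of the Levi form is s exactly when the Schur complement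
    vanishes. This complement is homogeneous of degree 2 for F0 and differs by
    order 3 from that of F, which is zero; so it vanishes ([model_good]).
    Injectivity of iota at 0 is inherited from F and is an open condition
    ([model_nondegenerate]).

    Quotients. A quotient by the foliation is only given abstractly, and the maps
    I(f(p)) o I(f(q))^-1 depend on the values of its differential at different
    points of the leaf. Its fibre through 0 is the leaf ([fibre_leaf]), and along
    rays in the leaf its transverse derivatives satisfy a linear differential
    equation, obtained by differentiating the relation that a real frame of
    K2 + conj K2 annihilates it. The coefficients are the weight 1 derivatives of
    the weight 1 components of the frame, and they agree for F and F0
    ([Vfr_agree]); uniqueness of solutions ([killed_unique]) shows that both
    quotients induce the same identification of normal spaces along the leaf
    ([frame_transport], [contact_transport]), hence the same transition maps.

    Thus sections, classes of normalization maps, normalized sections and modified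
    symbols are the same for F and F0 ([modified_symbol_leafwise]). It remains to
    see that there are normalized sections: an explicit section of the frame bundle
    is [coord_section], and the choice made by a normalization condition in its
    class comes from a section which is then normalized
    ([modified_symbol_nonempty]). *)

Set Implicit Arguments.
Unset Strict Implicit.
Unset Printing Implicit Defensive.
Import Order.TTheory GRing.Theory Num.Theory numFieldNormedType.Exports.
Local Open Scope classical_set_scope.
Local Open Scope ring_scope.
Local Open Scope complex_scope.

(** * Differential calculus in several real variables *)

Definition linform (R : realType) (d : nat) (G : 'I_d -> R) (h : 'rV[R]_d) : R :=
  \sum_j h 0 j * G j.

Lemma linform_is_linear (R : realType) (d : nat) (G : 'I_d -> R) :
  linear (linform G).
Proof.
move=> a u v; rewrite /linform scaler_sumr -big_split/=.
apply: eq_bigr => j _; rewrite !mxE mulrDl; congr (_ + _).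
by rewrite -mulrA.
Qed.

HB.instance Definition _ (R : realType) (d : nat) (G : 'I_d -> R) :=
  GRing.isLinear.Build R 'rV[R]_d R _ (linform G) (linform_is_linear G).

Lemma linform_differentiable (R : realType) (d : nat) (G : 'I_d -> R) x :
  differentiable (linform G) x.
Proof.
have -> : linform G = \sum_j (fun h : 'rV[R]_d => h 0 j * G j).
  by apply/funext => h; rewrite fct_sumE.
apply: differentiable_sum => j; apply: differentiableM => //.
exact: differentiable_coord.
Qed.

(** The little-o in the definition of the differential, read as an explicit
    estimate; limits of functions are differentiated through such estimates. *)
Lemma differentiable_intro (R : realType) (d : nat) (f : 'rV[R]_d -> R)
    (df : {linear 'rV[R]_d -> R}) (x : 'rV[R]_d) : continuous df ->
  (forall e, 0 < e -> \forall h \near (0 : 'rV[R]_d),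
    `|f (h + x) - f x - df h| <= e * `|h|) ->
  differentiable f x /\ forall h, 'd f x h = df h.
Proof.
move=> lc fG.
have fo : f \o shift x = cst (f x) + df +o_ (0 : 'rV[R]_d) id.
  apply/eqaddoP => e e0; near=> h.
  rewrite /= -[(_ - _) _]/(f (h + x) - (f x + df h)) opprD addrA.
  near: h; exact: fG.
have dE := diff_unique lc fo.
split; last by move=> h; rewrite dE.
by apply/diff_locallyP; rewrite dE.
Unshelve. all: by end_near. Qed.

Lemma differentiable_elim (R : realType) (d : nat) (f : 'rV[R]_d -> R)
    (x : 'rV[R]_d) : differentiable f x ->
  (forall e, 0 < e -> \forall h \near (0 : 'rV[R]_d),
    `|f (h + x) - f x - 'd f x h| <= e * `|h|).
Proof.
move=> /diff_locally/eqaddoP fo e e0; have := fo e e0.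
apply: filterS => h.
by rewrite /= -[(_ - _) _]/(f (h + x) - (f x + 'd f x h)) opprD addrA.
Qed.

Lemma near_shift0 (R : realType) (d : nat) (x : 'rV[R]_d) (A : set 'rV[R]_d) :
  (\forall y \near x, A y) -> \forall h \near (0 : 'rV[R]_d), A (h + x).
Proof.
move=> nA.
by move: nA; rewrite (near_shift 0) /= subr0.
Qed.

Lemma differentiable_near_eq (R : realType) (d : nat)
    (f g : 'rV[R]_d -> R) (x : 'rV[R]_d) :
  (\forall y \near x, f y = g y) -> differentiable f x -> differentiable g x.
Proof.
move=> fg df; have fgx : f x = g x by exact: nbhs_singleton fg.
have [dfc _] := (diff_locallyP x f).1 df.
have [] // := @differentiable_intro _ _ g ('d f x) x dfc.
move=> e e0; have := differentiable_elim df e0; apply: filterS2 (near_shift0 fg).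
by move=> h -> ; rewrite fgx.
Qed.

Lemma diffE_pd (R : realType) (d : nat) (f : 'rV[R]_d -> R) (x h : 'rV[R]_d) :
  differentiable f x -> 'd f x h = \sum_j h 0 j * pd j f x.
Proof.
move=> df; rewrite [in LHS](row_sum_delta h) linear_sum.
by apply: eq_bigr => j _; rewrite linearZ/= /pd deriveE.
Qed.

Section pd.
Variables (R : realType) (d : nat).
Implicit Types (f g : 'rV[R]_d -> R) (x : 'rV[R]_d) (j : 'I_d).

Lemma pd_near f g j x : (\forall y \near x, f y = g y) -> pd j f x = pd j g x.
Proof. exact: near_eq_derive. Qed.

Lemma pdD f g j x : differentiable f x -> differentiable g x ->
  pd j (fun y => f y + g y) x = pd j f x + pd j g x.
Proof. by move=> df dg; rewrite /pd deriveD//; exact: diff_derivable. Qed.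

Lemma pdN f j x : differentiable f x ->
  pd j (fun y => - f y) x = - pd j f x.
Proof. by move=> df; rewrite /pd deriveN//; exact: diff_derivable. Qed.

Lemma pdB f g j x : differentiable f x -> differentiable g x ->
  pd j (fun y => f y - g y) x = pd j f x - pd j g x.
Proof. by move=> df dg; rewrite /pd deriveB//; exact: diff_derivable. Qed.

Lemma pdM f g j x : differentiable f x -> differentiable g x ->
  pd j (fun y => f y * g y) x = f x * pd j g x + g x * pd j f x.
Proof. by move=> df dg; rewrite /pd deriveM//; exact: diff_derivable. Qed.

Lemma pdV f j x : differentiable f x -> f x != 0 ->
  pd j (fun y => (f y)^-1) x = - (f x) ^- 2 * pd j f x.
Proof. by move=> df fx; rewrite /pd deriveV//; exact: diff_derivable. Qed.

Lemma pd_cst (c : R) j x : pd j (fun=> c) x = 0.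
Proof. exact: derive_cst. Qed.

Lemma pd_coord (i j : 'I_d) x : pd j (fun y => y 0 i) x = (i == j)%:R.
Proof.
rewrite /pd deriveE; last exact: differentiable_coord.
have -> : (fun y : 'rV[R]_d => y 0 i) = linform (fun k => (k == i)%:R).
  apply/funext => y; rewrite /linform (bigD1 i)//= eqxx mulr1 big1 ?addr0//.
  by move=> k /negbTE ->; rewrite mulr0.
rewrite diff_lin /=; last first.
  by move=> y; apply: differentiable_continuous; exact: linform_differentiable.
rewrite /linform (bigD1 j)//= mxE !eqxx mul1r big1 ?addr0 1?eq_sym//.
by move=> k kj; rewrite mxE (negbTE kj) andbF mul0r.
Qed.

Lemma derive_line f (x v : 'rV[R]_d) (t : R) : differentiable f (x + t *: v) ->
  is_derive t 1 (fun r : R => f (x + r *: v))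
    (\sum_j v 0 j * pd j f (x + t *: v)).
Proof.
move=> df; rewrite -diffE_pd// -deriveE//.
have E : (fun h : R => h^-1 *: (f ((h *: v) + (x + t *: v)) - f (x + t *: v)))
  = (fun h => h^-1 *: (f (x + (h *: 1 + t) *: v) - f (x + t *: v))).
  by apply/funext => h; rewrite addrCA -scalerDl [h *: 1]mulr1.
have := @diff_derivable _ _ _ f _ v df; rewrite /derivable => dv.
apply: DeriveDef; rewrite /derivable /derive /= E// in dv *.
Qed.

End pd.

Section smooth_on.
Variables (R : realType) (d : nat).
Implicit Types (f g : 'rV[R]_d -> R) (U : set 'rV[R]_d).

(** All iterated partial derivatives of order at most n are differentiable on
    U. Counting orders makes stability under products and inverses an induction
    on n, each derivative of the result being built from functions of order n. *)
Fixpoint Cn (n : nat) U f : Prop :=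
  (forall x, U x -> differentiable f x) /\
  if n is n'.+1 then forall j, Cn n' U (pd j f) else True.

Lemma Cn_diff n U f x : Cn n U f -> U x -> differentiable f x.
Proof. by case: n => [|n] [+ _] => /[apply]. Qed.

Lemma Cn_pd n U f j : Cn n.+1 U f -> Cn n U (pd j f).
Proof. by case=> _ /(_ j). Qed.

Lemma CnW n U f : Cn n.+1 U f -> Cn n U f.
Proof.
elim: n f => [|n IH] f [df pf]; first by split.
by split => // j; apply: IH; exact: pf.
Qed.

Lemma Cn_sub n U V f : V `<=` U -> Cn n U f -> Cn n V f.
Proof.
move=> VU; elim: n f => [|n IH] f [df pf]; split => //; try by move=> x /VU/df.
by move=> j; apply: IH; exact: pf.
Qed.

Lemma Cn_ext n U f g : open U -> (forall x, U x -> f x = g x) ->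
  Cn n U f -> Cn n U g.
Proof.
move=> oU; elim: n f g => [|n IH] f g fg [df pf].
  split => // x Ux; apply: differentiable_near_eq (df x Ux).
  by apply: filterS (open_nbhs_nbhs (conj oU Ux)) => y /fg.
have nfg x : U x -> \forall y \near x, f y = g y.
  by move=> Ux; apply: filterS (open_nbhs_nbhs (conj oU Ux)) => y /fg.
split=> [x Ux|j].
  by apply: differentiable_near_eq (df x Ux); exact: nfg.
by apply: IH (pf j) => x /nfg /pd_near ->.
Qed.

Lemma Cn_cst n U c : Cn n U (fun=> c).
Proof.
elim: n c => [|n IH] c; split=> // j.
have -> : pd j (fun=> c) = (fun=> 0) :> ('rV[R]_d -> R).
  by apply/funext => x; exact: pd_cst.
exact: IH.
Qed.

Lemma Cn_coord n U i : Cn n U (fun x => x 0 i).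
Proof.
case: n => [|n]; split => //; try by move=> *; exact: differentiable_coord.
move=> j; have -> : pd j (fun x : 'rV[R]_d => x 0 i) = (fun=> (i == j)%:R).
  by apply/funext => x; exact: pd_coord.
exact: Cn_cst.
Qed.

Lemma Cn_add n U f g : open U -> Cn n U f -> Cn n U g ->
  Cn n U (fun x => f x + g x).
Proof.
move=> oU; elim: n f g => [|n IH] f g [df pf] [dg pg]; split => //.
- by move=> x Ux; apply: differentiableD; [exact: df|exact: dg].
- by move=> x Ux; apply: differentiableD; [exact: df|exact: dg].
- move=> j; apply: (@Cn_ext _ _ (fun x => pd j f x + pd j g x)) => //.
    by move=> x Ux; rewrite pdD//; [exact: df|exact: dg].
  by apply: IH; [exact: pf|exact: pg].
Qed.

Lemma Cn_mul n U f g : open U -> Cn n U f -> Cn n U g ->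
  Cn n U (fun x => f x * g x).
Proof.
move=> oU; elim: n f g => [|n IH] f g Cf Cg.
  by split=> // x Ux; apply: differentiableM; apply: Cn_diff Ux; eassumption.
have dfg x : U x -> differentiable f x /\ differentiable g x.
  by move=> Ux; split; apply: Cn_diff Ux; eassumption.
split=> [x /dfg[? ?]|j]; first exact: differentiableM.
apply: (@Cn_ext _ _ (fun x => f x * pd j g x + g x * pd j f x)) => //.
  by move=> x /dfg[? ?]; rewrite pdM.
by apply: Cn_add => //; apply: IH; try exact: CnW; exact: Cn_pd.
Qed.

Lemma Cn_opp n U f : open U -> Cn n U f -> Cn n U (fun x => - f x).
Proof.
move=> oU Cf; apply: (@Cn_ext _ _ (fun x => -1 * f x)) => //.
  by move=> x _; rewrite mulN1r.
by apply: Cn_mul => //; exact: Cn_cst.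
Qed.

Lemma Cn_inv n U f : open U -> (forall x, U x -> f x != 0) -> Cn n U f ->
  Cn n U (fun x => (f x)^-1).
Proof.
move=> oU f0; elim: n => [|n IH] Cf.
  by split=> // x Ux; apply: differentiableV (f0 x Ux); apply: Cn_diff Ux; eassumption.
have df x : U x -> differentiable f x by move=> Ux; apply: Cn_diff Ux; eassumption.
split=> [x Ux|j]; first by apply: differentiableV (f0 x Ux); exact: df.
have Ci := IH (CnW Cf).
apply: (@Cn_ext _ _ (fun x => - ((f x)^-1 * (f x)^-1) * pd j f x)) => //.
  by move=> x Ux; rewrite pdV ?f0//; [rewrite expr2 invfM|exact: df].
apply: Cn_mul => //; last exact: Cn_pd.
by apply: Cn_opp => //; exact: Cn_mul.
Qed.

Definition smooth_on U f := forall n, Cn n U f.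

Lemma iter_pd_rcons l j f : iter_pd (rcons l j) f = iter_pd l (pd j f).
Proof. by elim: l => //= i l ->. Qed.

Lemma smooth_onP U f :
  smooth_on U f <-> forall x, U x -> forall l, differentiable (iter_pd l f) x.
Proof.
split=> [sf x Ux l|df n].
  elim/last_ind: l f sf => [|l j IH] f sf; first exact: (Cn_diff (sf 0) Ux).
  by rewrite iter_pd_rcons; apply: IH => n; exact: Cn_pd (sf n.+1).
elim: n f df => [|n IH] f df; split=> //; try by move=> x /df/(_ [::]).
by move=> j; apply: IH => x Ux l; rewrite -iter_pd_rcons; exact: df.
Qed.

Lemma smooth_nearP p f :
  smooth_near p f <-> exists U, [/\ open U, U p & smooth_on U f].
Proof.
split.
  rewrite /smooth_near -nbhs_nearE nbhsE => -[U [oU Up] UA]; exists U; split=> //.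
  by apply/smooth_onP => x /UA.
move=> [U [oU Up /smooth_onP sf]].
by apply: filterS (open_nbhs_nbhs (conj oU Up)) => x /sf.
Qed.
End smooth_on.

Lemma norm_delta_le (R : realType) (d : nat) (j : 'I_d) :
  `|delta_mx 0 j : 'rV[R]_d| <= 1.
Proof.
rewrite /Num.Def.normr/= mx_normrE; apply: bigmax_le => // -[a b] _ /=.
by rewrite mxE; case: (_ && _); rewrite ?normr1 ?normr0.
Qed.

Lemma norm_coord_le (R : realType) (d : nat) (x : 'rV[R]_d) (j : 'I_d) :
  `|x 0 j| <= `|x|.
Proof.
rewrite [leRHS]/Num.Def.normr/= mx_normrE.
exact: (le_bigmax _ (fun p : 'I_1 * 'I_d => `|x p.1 p.2|) (0, j)).
Qed.

Lemma norm_row_le (R : realType) (d : nat) (x : 'rV[R]_d) (e : R) : 0 <= e ->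
  (forall j, `|x 0 j| <= e) -> `|x| <= e.
Proof.
move=> e0 xe; rewrite [leLHS]/Num.Def.normr/= mx_normrE.
by apply: bigmax_le => // -[a b] _ /=; rewrite ord1.
Qed.

Lemma derivable_within01 (R : realType) (f df : R -> R) (a b : R) :
  (forall t : R, t \in `[a, b]%R -> is_derive t 1 f (df t)) ->
  {within `[a, b], continuous f}.
Proof.
by move=> fd; apply: derivable_within_continuous => t /fd dt; exact: ex_derive.
Qed.

Lemma MVT_closed (R : realType) (f df : R -> R) (a b : R) : a <= b ->
  (forall t : R, t \in `[a, b]%R -> is_derive t 1 f (df t)) ->
  exists2 t : R, t \in `[a, b]%R & f b - f a = df t * (b - a).
Proof.
move=> ab fd.
have h (x : R) : x \in `]a, b[%R -> is_derive x 1 f (df x).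
  by rewrite in_itv/= => /andP[t0 t1]; apply: fd; rewrite in_itv/= !ltW.
have M := MVT_segment ab h; apply: M; exact: (derivable_within01 fd).
Qed.

Lemma pd_shift (R : realType) (d : nat) (f : 'rV[R]_d -> R) (w x : 'rV[R]_d) i :
  pd i (fun y => f (y + w)) x = pd i f (x + w).
Proof.
rewrite /pd /derive; set g1 := (fun h : R => _); set g2 := (fun h : R => _).
suff -> : g1 = g2 by [].
by apply/funext => h; rewrite /g1 /g2 /= addrA.
Qed.

Lemma MVT_line (R : realType) (d : nat) (f : 'rV[R]_d -> R) (x v : 'rV[R]_d) :
  (forall t : R, t \in `[0, 1]%R -> differentiable f (x + t *: v)) ->
  exists2 t : R, t \in `[0, 1]%R &
    f (x + v) - f x = \sum_j v 0 j * pd j f (x + t *: v).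
Proof.
move=> df.
have fd (t : R) : t \in `[0, 1]%R -> is_derive t 1 (fun r : R => f (x + r *: v))
    (\sum_j v 0 j * pd j f (x + t *: v)) by move=> /df /derive_line.
have [t t01] := MVT_closed ler01 fd.
rewrite scale1r scale0r addr0 subr0 mulr1 => E; by exists t.
Qed.

Lemma sum_delta_mul (R : realType) (d : nat) (i : 'I_d) (h : R) (G : 'I_d -> R) :
  \sum_k (h *: delta_mx 0 i : 'rV[R]_d) 0 k * G k = h * G i.
Proof.
rewrite (bigD1 i)//= !mxE !eqxx mulr1 big1 ?addr0// => k ki.
by rewrite !mxE (negbTE ki) andbF mulr0 mul0r.
Qed.

Lemma differentiable_shift (R : realType) (d : nat) (f : 'rV[R]_d -> R)
    (w x : 'rV[R]_d) : differentiable f (x + w) ->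
  differentiable (fun y => f (y + w)) x.
Proof.
by move=> df; apply: (@differentiable_comp _ _ _ _ (fun y => y + w) f).
Qed.

Lemma pd_increment (R : realType) (d : nat) (f : 'rV[R]_d -> R)
    (w x : 'rV[R]_d) i : differentiable f (x + w) -> differentiable f x ->
  differentiable (fun y => f (y + w) - f y) x /\
  pd i (fun y => f (y + w) - f y) x = pd i f (x + w) - pd i f x.
Proof.
move=> dw d0; have ds := differentiable_shift dw.
have := differentiableB ds d0; split => //.
by have := pdB i ds d0; rewrite pd_shift.
Qed.

(** The mean value theorem in the direction i reduces the second difference to
    an increment of the derivative in that direction, which the differential of
    this derivative at q approximates. *)
Lemma second_difference (R : realType) (d : nat) (f : 'rV[R]_d -> R)
    (U : set 'rV[R]_d) (q : 'rV[R]_d) (i j : 'I_d) (e : R) :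
  open U -> U q -> Cn 1 U f -> 0 < e ->
  \forall h \near 0^'+,
    `|f (q + h *: delta_mx 0 j + h *: delta_mx 0 i) - f (q + h *: delta_mx 0 j)
      - f (q + h *: delta_mx 0 i) + f q - h ^+ 2 * pd j (pd i f) q|
    <= e * h ^+ 2.
Proof.
move=> oU Uq Cf e0; have Cg := Cn_pd i Cf; have dg := Cn_diff Cg Uq.
(* The increments below have norm at most 2 h and two of them are compared, so
   an error rate of e / 4 adds up to e h. *)
have e4 : 0 < e / 4 by rewrite divr_gt0.
have /nbhs_ballP[r1 /= r10 gr] := differentiable_elim dg e4.
have /nbhs_ballP[r2 /= r20 Ur] := open_nbhs_nbhs (conj oU Uq).
near=> h.
have h0 : 0 < h by near: h; exact: nbhs_right_gt.
have h1 : 2 * h < r1.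
  by rewrite mulrC -ltr_pdivlMr//; near: h; apply: nbhs_right_lt; rewrite divr_gt0.
have h2 : 2 * h < r2.
  by rewrite mulrC -ltr_pdivlMr//; near: h; apply: nbhs_right_lt; rewrite divr_gt0.
have nb (t t' : R) : t \in `[0, 1]%R -> t' \in `[0, 1]%R ->
    `|(t * h) *: delta_mx 0 i + (t' * h) *: delta_mx 0 j : 'rV[R]_d| <= 2 * h.
  rewrite !in_itv/= => /andP[t0 t1] /andP[t'0 t'1].
  rewrite (le_trans (ler_normD _ _))// !normrZ mulrDl mul1r lerD//.
    rewrite (gtr0_norm h0) ger0_norm// -[leRHS]mulr1.
    by rewrite ler_pM ?mulr_ge0 ?(ltW h0) ?norm_delta_le// ler_piMl ?(ltW h0).
  rewrite (gtr0_norm h0) ger0_norm// -[leRHS]mulr1.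
  by rewrite ler_pM ?mulr_ge0 ?(ltW h0) ?norm_delta_le// ler_piMl ?(ltW h0).
have i0 : (0 : R) \in `[0, 1]%R by rewrite in_itv/= lexx ler01.
have i1 : (1 : R) \in `[0, 1]%R by rewrite in_itv/= lexx ler01.
have Un (t t' : R) : t \in `[0, 1]%R -> t' \in `[0, 1]%R ->
    U ((t * h) *: delta_mx 0 i + (t' * h) *: delta_mx 0 j + q).
  move=> t01 t'01; apply: Ur; rewrite -ball_normE/= opprD addrCA subrr addr0 normrN.
  exact: le_lt_trans (nb _ _ t01 t'01) h2.
pose phi y := f (y + h *: delta_mx 0 j) - f y.
have dphi (t : R) : t \in `[0, 1]%R ->
    differentiable f (q + t *: (h *: delta_mx 0 i) + h *: delta_mx 0 j) /\
    differentiable f (q + t *: (h *: delta_mx 0 i)).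
  move=> t01; split; apply: (Cn_diff Cf).
    have := Un t 1 t01 i1; rewrite mul1r scalerA.
    by rewrite addrAC [X in U (X + _)]addrC.
  by have := Un t 0 t01 i0; rewrite mul0r scale0r addr0 scalerA addrC.
have dphi' (t : R) : t \in `[0, 1]%R -> differentiable phi (q + t *: (h *: delta_mx 0 i)).
  by move=> /dphi[d1 d2]; exact: (pd_increment i d1 d2).1.
have [t t01 phiE] := MVT_line dphi'.
have [d1 d2] := dphi t t01.
rewrite sum_delta_mul in phiE.
rewrite (pd_increment i d1 d2).2 /phi in phiE.
have Un' (t1 t2 : R) : t1 \in `[0, 1]%R -> t2 \in `[0, 1]%R ->
    `|pd i f (q + t1 *: (h *: delta_mx 0 i) + t2 *: (h *: delta_mx 0 j)) - pd i f q
      - 'd (pd i f) q ((t1 * h) *: delta_mx 0 i + (t2 * h) *: delta_mx 0 j)|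
     <= e / 2 * h.
  move=> t10 t20; have nbt := nb _ _ t10 t20.
  have := gr ((t1 * h) *: delta_mx 0 i + (t2 * h) *: delta_mx 0 j).
  rewrite -ball_normE/= sub0r normrN => /(_ (le_lt_trans nbt h1)).
  rewrite [_ + q]addrC addrA !scalerA => /le_trans; apply.
  apply: (le_trans (ler_wpM2l (ltW e4) nbt)).
  by rewrite (_ : e / 4 * (2 * h) = e / 2 * h)//; field.
have N1 := Un' t 1 t01 i1; have N0 := Un' t 0 t01 i0.
rewrite scale0r addr0 mul0r scale0r addr0 in N0.
rewrite scale1r mul1r linearD [X in _ - (_ + X)]linearZ/= in N1.
have aE : 'd (pd i f) q (delta_mx 0 j) = pd j (pd i f) q by rewrite /pd deriveE.
rewrite aE in N1.
set A1 := pd i f (q + _ + _) in phiE N1; set A0 := pd i f (q + _) in phiE N0.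
set g := pd i f q in N1 N0; set D := 'd _ _ _ in N1 N0.
rewrite (_ : _ - _ - _ + _ - _ = h * ((A1 - g - (D + h * pd j (pd i f) q))
   - (A0 - g - D))); last first.
  rewrite (_ : h * _ = h * (A1 - A0) - h ^+ 2 * pd j (pd i f) q); last by ring.
  by rewrite -phiE [q + _ + _]addrAC; ring.
rewrite normrM (gtr0_norm h0) expr2 [leRHS](_ : _ = h * (e / 2 * h + e / 2 * h)).
  by rewrite ler_wpM2l ?(ltW h0)// (le_trans (ler_normB _ _))// lerD.
by field.
Unshelve. all: by end_near. Qed.

(** The second difference is symmetric in i and j. *)
Lemma schwarz_pd (R : realType) (d : nat) (f : 'rV[R]_d -> R)
    (U : set 'rV[R]_d) (q : 'rV[R]_d) (i j : 'I_d) :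
  open U -> U q -> Cn 1 U f -> pd j (pd i f) q = pd i (pd j f) q.
Proof.
move=> oU Uq Cf; apply/eqP; rewrite -subr_eq0 -normr_le0; apply/ler_addgt0Pr => e' e0; pose e : R := e'.
rewrite add0r -/e; have e2 : 0 < e / 2 by rewrite divr_gt0.
have S1 := second_difference i j oU Uq Cf e2.
have S2 := second_difference j i oU Uq Cf e2.
have FF : ProperFilter (nbhs (0 : R)^'+) := at_right_proper_filter 0.
have S3 := @filterI _ _ FF _ _ (nbhs_right_gt (0 : R)) S1.
have S4 := @filterI _ _ FF _ _ S3 S2.
have [h [[h0 E1] E2]] := filter_ex S4.
rewrite [q + _ + _]addrAC in E2.
have h2 : 0 < h ^+ 2 by rewrite exprn_gt0.
rewrite -(ler_pM2r h2) -[X in _ * X <= _]gtr0_norm// -normrM.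
have := le_trans (ler_normB _ _) (lerD E2 E1).
rewrite -mulrDl -splitr; apply: le_trans; rewrite le_eqVlt; apply/orP; left; apply/eqP.
move: (pd j (pd i f) q) (pd i (pd j f) q) (f q) (f (q + h *: delta_mx 0 j))
  (f (q + h *: delta_mx 0 i)) (f (q + h *: delta_mx 0 j + h *: delta_mx 0 i)).
by move=> a b c1 c2 c3 c4; congr (`| _ |); ring.
Qed.

(** Where the largest of the |u_i| is attained, the mean value theorem on an
    interval of length at most 1 starting at a zero of u bounds this maximum by
    half of itself. *)
Lemma lin_ode_unique (R : realType) (I : finType) (u : I -> R -> R)
    (C : I -> I -> R -> R) :
  (forall i (t : R), t \in `[0, 1]%R ->
    is_derive t 1 (u i) (\sum_j C i j t * u j t)) ->
  (forall i (t : R), t \in `[0, 1]%R -> \sum_j `|C i j t| <= 2^-1) ->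
  (forall i, u i 0 = 0) ->
  forall i (t : R), t \in `[0, 1]%R -> u i t = 0.
Proof.
move=> du Cs u0 i.
have /choice[c cP] : forall k, exists c : R, c \in `[0, 1]%R /\
    forall t : R, t \in `[0, 1]%R -> `|u k t| <= `|u k c|.
  move=> k; have [|c c01 cm] := @EVT_max R (fun t => `|u k t|) 0 1 ler01.
    have cu := derivable_within01 (du k).
    move=> x; exact: (continuous_comp (cu x) (@norm_continuous _ _ _)).
  by exists c.
pose K k := `|u k (c k)|.
have [k _ kmax] := @arg_maxP _ _ I i predT K erefl.
suff K0 : K k <= 0.
  move=> t t01; apply/eqP; rewrite -normr_le0 (le_trans ((cP i).2 t t01))//.
  exact: (le_trans (kmax i isT) K0).
have [ck01 ckm] := cP k.
have := ck01; rewrite in_itv/= => /andP[ck0 ck1].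
have sub (t : R) : t \in `[0, (c k)]%R -> t \in `[0, 1]%R.
  by rewrite !in_itv/= => /andP[-> /le_trans->].
have [t t0 uE] := MVT_closed ck0 (fun t t0 => du k t (sub t t0)).
rewrite u0 !subr0 in uE.
have : K k <= 2^-1 * K k.
  rewrite {1}/K uE normrM; apply: (le_trans (ler_piMr _ _)) => //.
    by rewrite ger0_norm.
  rewrite (le_trans (ler_norm_sum _ _ _))//.
  apply: (@le_trans _ _ (\sum_j `|C k j t| * K k)).
    apply: ler_sum => j _; rewrite normrM ler_wpM2l//.
    exact: (le_trans ((cP j).2 t (sub _ t0)) (kmax j isT)).
  rewrite -mulr_suml; apply: ler_wpM2r; first by rewrite /K.
  exact: (Cs k t (sub t t0)).
by rewrite -subr_le0 -[X in X - _]mul1r -mulrBl; lra.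
Qed.

(** * Sums of power series *)

Lemma limit_norm_le (R : realType) (u : nat -> R) (l K : R) :
  u n @[n --> \oo] --> l -> (forall n, `|u n| <= K) -> `|l| <= K.
Proof.
move=> ul uK; apply: (cvgr_to_le (cvg_norm ul)).
by near=> n; exact: uK.
Unshelve. all: by end_near. Qed.

Lemma cvg_sumR (R : realType) (I : Type) (r : seq I) (u : I -> nat -> R) (l : I -> R) :
  (forall i, u i n @[n --> \oo] --> l i) ->
  (\sum_(i <- r) u i n) @[n --> \oo] --> \sum_(i <- r) l i.
Proof.
move=> ul; elim: r => [|i r IH].
  rewrite big_nil (_ : (fun n => _) = (fun=> 0)); first exact: cvg_cst.
  by apply/funext => n; rewrite big_nil.
rewrite big_cons (_ : (fun n => _) = (fun n => u i n + \sum_(k <- r) u k n)).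
  by apply: cvgD.
by apply/funext => n; rewrite big_cons.
Qed.

Section termwise.
Variables (R : realType) (d : nat).
Implicit Types (f g : 'rV[R]_d -> R).

(** The constant depends on f only through the bound on its second derivatives,
    so the estimate is uniform over the partial sums of a series. *)
Lemma taylor2 f (r K : R) (x h : 'rV[R]_d) :
  (forall y : 'rV[R]_d, `|y| < r -> differentiable f y /\
     forall j, differentiable (pd j f) y) ->
  (forall (y : 'rV[R]_d) i j, `|y| < r -> `|pd i (pd j f) y| <= K) ->
  `|x| + `|h| < r ->
  `|f (h + x) - f x - \sum_j h 0 j * pd j f x| <= K * d%:R ^+ 2 * `|h| ^+ 2.
Proof.
move=> df bf xh.
have inb (s : R) : s \in `[0, 1]%R -> `|x + s *: h| < r.
  rewrite in_itv/= => /andP[s0 s1]; apply: le_lt_trans xh.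
  by rewrite (le_trans (ler_normD _ _))// lerD2l normrZ ger0_norm// ler_piMl.
have K0 (j : 'I_d) : 0 <= K.
  by rewrite (le_trans _ (bf x j j _))// (le_lt_trans _ xh)// lerDl.
have [t t01 E] := MVT_line (fun t t01 => (df _ (inb t t01)).1).
rewrite [h + x]addrC E -sumrB (le_trans (ler_norm_sum _ _ _))//.
apply: (@le_trans _ _ (\sum_(j < d) (`|h| * (K * d%:R * `|h|)))); last first.
  have -> // : \sum_(j < d) (`|h| * (K * d%:R * `|h|)) = K * d%:R ^+ 2 * `|h| ^+ 2.
  by rewrite sumr_const card_ord -[LHS]mulr_natr; ring.
apply: ler_sum => j _; rewrite -mulrBr normrM ler_pM//; first exact: norm_coord_le.
have := t01; rewrite in_itv/= => /andP[t0 t1].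
have inb' (s : R) : s \in `[0, 1]%R -> `|x + s *: (t *: h)| < r.
  rewrite in_itv/= => /andP[s0 s1]; rewrite scalerA; apply: inb.
  by rewrite in_itv/= mulr_ge0//= mulr_ile1.
have [s s01 ->] := MVT_line (fun s s01 => (df _ (inb' s s01)).2 j).
rewrite (le_trans (ler_norm_sum _ _ _))//.
apply: (@le_trans _ _ (\sum_(j < d) (`|h| * K))); last first.
  have -> // : \sum_(j < d) (`|h| * K) = K * d%:R * `|h|.
  by rewrite sumr_const card_ord -[LHS]mulr_natr; ring.
apply: ler_sum => i _; rewrite normrM ler_pM//; last exact/bf/inb'.
rewrite mxE normrM ger0_norm// (le_trans (ler_piMl _ t1))//.
exact: norm_coord_le.
Qed.

Lemma linform_continuous (G : 'I_d -> R) : continuous (linform G).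
Proof.
by move=> y; apply: differentiable_continuous; exact: linform_differentiable.
Qed.

(** The quadratic Taylor estimate has the same constant for all F_N and passes
    to the limit, where it says that the limit is differentiable. *)
Lemma termwise_diff (F : nat -> 'rV[R]_d -> R) f (g : 'I_d -> 'rV[R]_d -> R)
    (r K : R) :
  (forall N, Cn 1 setT (F N)) ->
  (forall x : 'rV[R]_d, `|x| < r -> F N x @[N --> \oo] --> f x) ->
  (forall (x : 'rV[R]_d) j, `|x| < r -> pd j (F N) x @[N --> \oo] --> g j x) ->
  (forall N (y : 'rV[R]_d) i j, `|y| < r -> `|pd i (pd j (F N)) y| <= K) ->
  forall x : 'rV[R]_d, `|x| < r -> differentiable f x /\ forall j, pd j f x = g j x.
Proof.
move=> CF cf cg bF x xr.
have quad (h : 'rV[R]_d) : `|x| + `|h| < r ->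
    `|f (h + x) - f x - linform (fun j => g j x) h| <= K * d%:R ^+ 2 * `|h| ^+ 2.
  move=> xh; apply: limit_norm_le; last first.
    move=> N; apply: (@taylor2 (F N) r K x h) => //.
      move=> y _; split; first exact: (Cn_diff (CF N)).
      by move=> j; apply: (Cn_diff (Cn_pd j (CF N))).
    exact: bF.
  apply: cvgB; first apply: cvgB.
  - by apply: cf; rewrite (le_lt_trans (ler_normD _ _))// addrC.
  - exact: cf.
  - apply: cvg_sumR => j; apply: cvgM; [exact: cvg_cst|exact: cg].
pose L := linform (fun j => g j x).
have [||df dE] := @differentiable_intro _ _ f L x.
- exact: linform_continuous.
- move=> e e0; pose M := `|K * d%:R ^+ 2| + 1.
  have M0 : 0 < M by rewrite ltr_pwDr.
  near=> h.
  have hM : `|h| <= e / M.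
    by rewrite -[h]subr0 distrC; near: h; apply: cvgr_dist_le; [exact: cvg_id|rewrite divr_gt0].
  apply: (le_trans (quad h _)).
    rewrite addrC -ltrBrDr.
    by rewrite -[h]subr0 distrC; near: h; apply: cvgr_dist_lt; [exact: cvg_id|rewrite subr_gt0].
  rewrite [`|h| ^+ 2]expr2 mulrA; apply: ler_wpM2r => //.
  have KM : K * d%:R ^+ 2 <= M by rewrite /M (le_trans (ler_norm _))// lerDl.
  by rewrite (le_trans (ler_wpM2r _ KM))// mulrC -ler_pdivlMr.
- split => // j; rewrite /pd deriveE// dE /L /= /linform.
  rewrite (bigD1 j)//= mxE !eqxx mul1r big1 ?addr0// => k kj.
  by rewrite mxE (negbTE kj) andbF mul0r.
Unshelve. all: by end_near. Qed.

Lemma smooth_on_iter_pd l U f : smooth_on U f -> smooth_on U (iter_pd l f).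
Proof.
move=> sf; elim: l => //= j l IH n; exact: (Cn_pd j (IH n.+1)).
Qed.

Lemma termwise_smooth (F : nat -> 'rV[R]_d -> R) f (r : R) :
  (forall N, smooth_on setT (F N)) ->
  (forall x : 'rV[R]_d, `|x| < r -> F N x @[N --> \oo] --> f x) ->
  (forall l (x : 'rV[R]_d), `|x| < r -> cvgn (fun N => iter_pd l (F N) x)) ->
  (forall l, exists K : R, forall N (y : 'rV[R]_d), `|y| < r -> `|iter_pd l (F N) y| <= K) ->
  forall l (x : 'rV[R]_d), `|x| < r -> iter_pd l (F N) x @[N --> \oo] --> iter_pd l f x
    /\ differentiable (iter_pd l f) x.
Proof.
move=> sF cf cF bF.
have bF2 l : exists K : R, forall N (y : 'rV[R]_d) i j, `|y| < r ->
    `|pd i (pd j (iter_pd l (F N))) y| <= K.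
  have /choice[K KP] : forall ij : 'I_d * 'I_d, exists K : R, forall N (y : 'rV[R]_d),
      `|y| < r -> `|pd ij.1 (pd ij.2 (iter_pd l (F N))) y| <= K.
    by move=> [i j]; exact: (bF [:: i, j & l]).
  exists (\sum_ij `|K ij|) => N y i j yr.
  apply: (le_trans (KP (i, j) N y yr)); rewrite (bigD1 (i, j))//=.
  by rewrite (le_trans (ler_norm _))// lerDl sumr_ge0.
pose conv l := forall x : 'rV[R]_d, `|x| < r ->
  iter_pd l (F N) x @[N --> \oo] --> iter_pd l f x.
have step l : conv l -> forall x : 'rV[R]_d, `|x| < r ->
    differentiable (iter_pd l f) x /\
    forall j, pd j (iter_pd l f) x = limn (fun N => iter_pd (j :: l) (F N) x).
  move=> cl; have [K bK] := bF2 l.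
  apply: (termwise_diff (fun N => smooth_on_iter_pd l (sF N) 1%N) cl _ bK).
  by move=> x j xr; exact: cF.
have convA l : conv l.
  elim: l => [//|j l IH] x xr; rewrite /= (step l IH x xr).2; exact: cF.
by move=> l x xr; split; [exact: convA|exact: (step l (convA l) x xr).1].
Qed.
End termwise.

Section power_series.
Variables (R : realType) (k : nat).
Implicit Types (x : 'rV[R]_k) (l : seq 'I_k).

Lemma pd_invariant (f : 'rV[R]_k -> R) j x :
  (forall (h : R) y, f (h *: delta_mx 0 j + y) = f y) -> pd j f x = 0.
Proof.
move=> fh; rewrite /pd /derive.
rewrite (_ : (fun h : R => _) = (fun=> 0)); first exact: lim_cst.
by apply/funext => h /=; rewrite fh subrr scaler0.
Qed.

(** The derivative of order b of the monomial with exponents a. The falling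
    factorial vanishes when b is not below a, where the exponent is truncated. *)
Definition dmono (b a : 'I_k -> nat) (x : 'rV[R]_k) : R :=
  \prod_i ((a i ^_ b i)%:R * x 0 i ^+ (a i - b i)).

Definition mult (l : seq 'I_k) (i : 'I_k) : nat := count_mem i l.

Lemma smooth_on_prod (U : set 'rV[R]_k) (I : Type) (r : seq I)
    (f : I -> 'rV[R]_k -> R) : open U -> (forall i, smooth_on U (f i)) ->
  smooth_on U (fun x => \prod_(i <- r) f i x).
Proof.
move=> oU sf n; elim: r => [|i r IH].
  rewrite (_ : (fun x => _) = (fun=> 1)); first exact: Cn_cst.
  by apply/funext => x; rewrite big_nil.
rewrite (_ : (fun x => _) = (fun x => f i x * \prod_(k <- r) f k x)).
  by apply: Cn_mul => //; exact: sf.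
by apply/funext => x; rewrite big_cons.
Qed.

Lemma smooth_on_sum (U : set 'rV[R]_k) (I : Type) (r : seq I)
    (f : I -> 'rV[R]_k -> R) : open U -> (forall i, smooth_on U (f i)) ->
  smooth_on U (fun x => \sum_(i <- r) f i x).
Proof.
move=> oU sf n; elim: r => [|i r IH].
  rewrite (_ : (fun x => _) = (fun=> 0)); first exact: Cn_cst.
  by apply/funext => x; rewrite big_nil.
rewrite (_ : (fun x => _) = (fun x => f i x + \sum_(k <- r) f k x)).
  by apply: Cn_add => //; exact: sf.
by apply/funext => x; rewrite big_cons.
Qed.

Lemma smooth_on_exp (U : set 'rV[R]_k) (f : 'rV[R]_k -> R) n :
  open U -> smooth_on U f -> smooth_on U (fun x => f x ^+ n).
Proof.
move=> oU sf N; elim: n => [|n IH].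
  rewrite (_ : (fun x => _) = (fun=> 1)); first exact: Cn_cst.
  by apply/funext => x; rewrite expr0.
rewrite (_ : (fun x => _) = (fun x => f x * f x ^+ n)).
  by apply: Cn_mul => //; exact: sf.
by apply/funext => x; rewrite exprS.
Qed.

Lemma smooth_dmono (b a : 'I_k -> nat) : smooth_on setT (dmono b a).
Proof.
apply: smooth_on_prod; first exact: openT.
move=> i n; apply: Cn_mul; [exact: openT|exact: Cn_cst|].
by apply: smooth_on_exp; [exact: openT|move=> m; exact: Cn_coord].
Qed.

Lemma pd_coordX j n x :
  pd j (fun y : 'rV[R]_k => y 0 j ^+ n) x = n%:R * x 0 j ^+ n.-1.
Proof.
elim: n => [|n IH] /=.
  rewrite mul0r (_ : (fun y => _) = (fun=> 1)); first exact: pd_cst.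
  by apply/funext => y; rewrite expr0.
rewrite (_ : (fun y => _) = (fun y : 'rV[R]_k => y 0 j * y 0 j ^+ n)); last first.
  by apply/funext => y; rewrite exprS.
have sj : smooth_on setT (fun y : 'rV[R]_k => y 0 j) by move=> m; exact: Cn_coord.
rewrite pdM; [|exact: differentiable_coord|]; last first.
  exact: (Cn_diff (smooth_on_exp n openT sj 0%N)).
rewrite IH pd_coord eqxx mulr1 mulrCA -exprS.
case: n {IH} => [|n] /=; first by rewrite mul0r add0r expr0 mul1r.
by rewrite [in RHS]mulrS mulrDl mul1r addrC.
Qed.

Lemma pd_dmono j (b a : 'I_k -> nat) x :
  pd j (dmono b a) x = dmono (fun i => (b i + (i == j))%N) a x.
Proof.
pose G (y : 'rV[R]_k) : R := \prod_(i | i != j) ((a i ^_ b i)%:R * y 0 i ^+ (a i - b i)).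
have sG : smooth_on setT G.
  rewrite (_ : G = fun y => \prod_i (if i != j then
      (a i ^_ b i)%:R * y 0 i ^+ (a i - b i) else 1)); last first.
    by apply/funext => y; rewrite /G big_mkcond.
  apply: smooth_on_prod; first exact: openT.
  move=> i n; case: (i != j); last exact: Cn_cst.
  apply: Cn_mul; [exact: openT|exact: Cn_cst|].
  by apply: smooth_on_exp; [exact: openT|move=> m; exact: Cn_coord].
have sj : smooth_on setT (fun y : 'rV[R]_k => y 0 j ^+ (a j - b j)).
  by apply: smooth_on_exp; [exact: openT|move=> m; exact: Cn_coord].
rewrite (_ : dmono b a = fun y => ((a j ^_ b j)%:R * G y) * y 0 j ^+ (a j - b j)); last first.
  by apply/funext => y; rewrite /dmono (bigD1 j)//= mulrAC.
have sc : smooth_on setT (fun y => (a j ^_ b j)%:R * G y).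
  move=> n; apply: Cn_mul; [exact: openT|exact: Cn_cst|exact: sG].
rewrite pdM; [|exact: (Cn_diff (sc 0%N))|exact: (Cn_diff (sj 0%N))].
rewrite pd_coordX [X in _ + _ * X]pd_invariant ?mulr0 ?addr0; last first.
  move=> h y; congr (_ * _); apply: eq_bigr => i ij.
  by rewrite !mxE (negbTE ij) andbF mulr0 add0r.
rewrite /dmono (bigD1 j)//= eqxx addn1 ffactnSr natrM subnS.
rewrite [X in _ = _ * X](_ : _ = G x); last first.
  by apply: eq_bigr => i ij; rewrite (negbTE ij) addn0.
by move: (G x) (x 0 j ^+ _) => u v; ring.
Qed.

Lemma iter_pd_dmono l (b a : 'I_k -> nat) :
  iter_pd l (dmono b a) = dmono (fun i => (b i + mult l i)%N) a.
Proof.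
elim: l => [|j l IH].
  by apply/funext => x; apply: eq_bigr => i _; rewrite /mult /= addn0.
rewrite /= IH; apply/funext => x; rewrite pd_dmono.
by apply: eq_bigr => i _; rewrite /mult /= [j == i]eq_sym addnAC addnA.
Qed.

Lemma iter_pd_lin l (I : Type) (r : seq I) (c : I -> R)
    (f : I -> 'rV[R]_k -> R) : (forall i, smooth_on setT (f i)) ->
  iter_pd l (fun x => \sum_(i <- r) c i * f i x)
  = fun x => \sum_(i <- r) c i * iter_pd l (f i) x.
Proof.
move=> sf; elim: l => [//|j l IH]; rewrite /= IH; apply/funext => x.
elim: r {IH} => [|i r IH].
  rewrite big_nil (_ : (fun y => _) = (fun=> 0)); first exact: pd_cst.
  by apply/funext => y; rewrite big_nil.
have sl i' := smooth_on_iter_pd l (sf i').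
have sc i' : smooth_on setT (fun y => c i' * iter_pd l (f i') y).
  by move=> n; apply: Cn_mul; [exact: openT|exact: Cn_cst|exact: sl].
rewrite big_cons -IH.
rewrite (_ : (fun y => _) = (fun y => c i * iter_pd l (f i) y +
    \sum_(k <- r) c k * iter_pd l (f k) y)); last first.
  by apply/funext => y; rewrite big_cons.
rewrite pdD; [|exact: (Cn_diff (sc i 0%N))|]; last first.
  exact: (Cn_diff (smooth_on_sum r openT sc 0%N)).
congr (_ + _); rewrite pdM; [|exact: (Cn_diff (Cn_cst 0 setT (c i)))|].
  by rewrite pd_cst mulr0 addr0.
exact: (Cn_diff (sl i 0%N)).
Qed.

(** A Cauchy estimate: shrinking the radius by delta pays for a derivative. *)
Lemma ffact_bound (n b : nat) (rho delta : R) : 0 <= rho -> 0 < delta ->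
  (n ^_ b)%:R * rho ^+ (n - b) <= b`!%:R * delta ^- b * (rho + delta) ^+ n.
Proof.
move=> r0 d0; rewrite mulrAC ler_pdivlMr ?exprn_gt0//.
have [nb|bn] := ltnP n b.
  by rewrite ffact_small// !mul0r mulr_ge0// exprn_ge0// addr_ge0// ltW.
rewrite -bin_ffact natrM [_ * b`!%:R]mulrC -!mulrA ler_wpM2l//.
rewrite exprDn (bigD1 (Ordinal (bn : (b < n.+1)%N)))//= -[X in X + _]mulr_natl.
by rewrite lerDl sumr_ge0// => i _; rewrite mulrn_wge0// mulr_ge0// exprn_ge0// ltW.
Qed.

Lemma box_le_cat (N M : nat) (G : {ffun 'I_k -> nat} -> R) :
  (N <= M)%N -> (forall a, 0 <= G a) ->
  \sum_(a : {ffun 'I_k -> 'I_N}) G (ffun_of_box a)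
  <= \sum_(a : {ffun 'I_k -> 'I_M}) G (ffun_of_box a).
Proof.
move=> NM G0; pose w (a : {ffun 'I_k -> 'I_N}) : {ffun 'I_k -> 'I_M} :=
  [ffun i => widen_ord NM (a i)].
have wi : injective w.
  move=> a b ab; apply/ffunP => i; apply/val_inj.
  by have /ffunP/(_ i) := ab; rewrite !ffunE => /(congr1 val).
have bw a : ffun_of_box (w a) = ffun_of_box a by apply/ffunP => i; rewrite !ffunE.
rewrite [leRHS](bigID (fun b => b \in w @: [set: {ffun 'I_k -> 'I_N}]%SET))/=.
rewrite (big_imset _ (in2W wi))/=.
under [X in _ <= X + _]eq_bigr do rewrite bw.
rewrite [leLHS](_ : _ = \sum_(i in [set: {ffun 'I_k -> 'I_N}]%SET) G (ffun_of_box i)).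
  by rewrite lerDl sumr_ge0.
by apply: eq_bigl => a; rewrite inE.
Qed.

Lemma cvg_box_nneg (G : {ffun 'I_k -> nat} -> R) (B : R) :
  (forall a, 0 <= G a) ->
  (forall N, \sum_(a : {ffun 'I_k -> 'I_N}) G (ffun_of_box a) <= B) ->
  cvgn (fun N => \sum_(a : {ffun 'I_k -> 'I_N}) G (ffun_of_box a)).
Proof.
move=> G0 GB; apply: nondecreasing_is_cvgn => [N M NM|]; first exact: box_le_cat.
by exists B => _ [N _ <-].
Qed.

Lemma cvg_box (G T : {ffun 'I_k -> nat} -> R) (B : R) :
  (forall a, `|G a| <= T a) ->
  (forall N, \sum_(a : {ffun 'I_k -> 'I_N}) T (ffun_of_box a) <= B) ->
  cvgn (fun N => \sum_(a : {ffun 'I_k -> 'I_N}) G (ffun_of_box a)).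
Proof.
move=> GT TB.
have T0 a : 0 <= T a by exact: le_trans (GT a).
have cT := cvg_box_nneg T0 TB.
have GT0 a : 0 <= G a + T a.
  by rewrite addrC -lerBlDr sub0r (le_trans _ (GT a))// -normrN ler_norm.
have GTB N : \sum_(a : {ffun 'I_k -> 'I_N}) (fun a => G a + T a) (ffun_of_box a) <= B + B.
  rewrite big_split/= lerD// (le_trans _ (TB N))// ler_sum// => a _.
  exact: le_trans (ler_norm _) (GT _).
have cGT := cvg_box_nneg GT0 GTB.
rewrite (_ : (fun N => _) = (fun N => \sum_(a : {ffun 'I_k -> 'I_N})
   (fun a => G a + T a) (ffun_of_box a) - \sum_(a : {ffun 'I_k -> 'I_N}) T (ffun_of_box a))).
  by apply: is_cvgB.
by apply/funext => N; rewrite big_split/= addrK.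
Qed.

Definition scale (w : 'I_k -> nat) (t : R) (y : 'rV[R]_k) : 'rV[R]_k :=
  \row_i (t ^+ w i * y 0 i).

Lemma norm_scale_le w (t : R) (y : 'rV[R]_k) : 0 <= t <= 1 ->
  `|scale w t y| <= `|y|.
Proof.
move=> /andP[t0 t1]; apply: norm_row_le => // j; rewrite mxE normrM.
rewrite normrX ger0_norm//; apply: le_trans (norm_coord_le y j).
by rewrite ler_piMl// exprn_ile1.
Qed.

Lemma dmono_bound (w : 'I_k -> nat) (b a : 'I_k -> nat) (y : 'rV[R]_k)
    (t rho delta : R) (k0 : nat) : 0 < delta -> 0 <= t <= 1 -> `|y| <= rho ->
  (k0 <= \sum_i w i * a i)%N ->
  `|dmono b a (scale w t y)| <= t ^+ (k0 - \sum_i w i * b i)%N *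
     (\prod_i ((b i)`!%:R * delta ^- b i) * \prod_i (rho + delta) ^+ a i).
Proof.
move=> d0 t01 yr ka; have /andP[t0 t1] := t01.
have r0 : 0 <= rho by exact: le_trans yr.
have [ba|/existsP[i ai]] := boolP [forall i, (b i <= a i)%N]; last first.
  rewrite /dmono (bigD1 i)//= ffact_small ?mul0r ?normr0; last by rewrite ltnNge.
  rewrite mulr_ge0 ?exprn_ge0// mulr_ge0// prodr_ge0// => j _.
    by rewrite mulr_ge0// invr_ge0 exprn_ge0// ltW.
  by rewrite exprn_ge0// addr_ge0// ltW.
have -> : dmono b a (scale w t y) = t ^+ (\sum_i w i * (a i - b i))%N * dmono b a y.
  rewrite expr_sum /dmono -big_split/=; apply: eq_bigr => i _.
  by rewrite mxE exprMn exprM mulrCA.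
rewrite normrM normrX (ger0_norm t0) ler_pM ?exprn_ge0//.
  rewrite ler_wiXn2l// leq_subLR -big_split/= (leq_trans ka)// leq_sum// => i _.
  by rewrite -mulnDr subnKC//; move/forallP: ba.
rewrite /dmono normr_prod -big_split/= ler_prod// => i _; rewrite normr_ge0/=.
apply: le_trans (ffact_bound _ _ r0 d0); rewrite normrM ger0_norm// ler_wpM2l//.
by rewrite normrX lerXn2r ?nnegrE// (le_trans (norm_coord_le _ _)).
Qed.

Lemma psumE (c : {ffun 'I_k -> nat} -> R) x N :
  psum c x N = \sum_(a : {ffun 'I_k -> 'I_N}) c (ffun_of_box a) * dmono (fun=> 0%N) (ffun_of_box a) x.
Proof.
apply: eq_bigr => a _; congr (_ * _); apply: eq_bigr => i _.
by rewrite ffactn0 mul1r subn0 ffunE.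
Qed.

Lemma iter_pd_psum l (c : {ffun 'I_k -> nat} -> R) N :
  iter_pd l (psum c ^~ N) = fun x => \sum_(a : {ffun 'I_k -> 'I_N})
     c (ffun_of_box a) * dmono (mult l) (ffun_of_box a) x.
Proof.
rewrite (_ : psum c ^~ N = fun x => \sum_(a : {ffun 'I_k -> 'I_N})
   c (ffun_of_box a) * dmono (fun=> 0%N) (ffun_of_box a) x); last first.
  by apply/funext => x; exact: psumE.
rewrite iter_pd_lin; last by move=> a; exact: smooth_dmono.
by apply/funext => x; apply: eq_bigr => a _; rewrite iter_pd_dmono.
Qed.

(** Cauchy estimates on half the polydisc dominate the derivatives of all terms
    by the series itself, which gives smoothness; under a dilation by t
    a term of weight at least k0, differentiated along l, picks up a power of t with
    exponent at least k0 minus the weight of l. *)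
Lemma expansion_smooth_weight (f : 'rV[R]_k -> R) c : expansion f c ->
  smooth_near 0 f /\
  forall (w : 'I_k -> nat) (k0 : nat),
    (forall a, c a != 0 -> (k0 <= \sum_i w i * a i)%N) ->
  forall l, exists C : R, \forall y \near (0 : 'rV[R]_k), forall t : R, 0 <= t <= 1 ->
    `|iter_pd l f (scale w t y)| <= C * t ^+ (k0 - \sum_i w i * mult l i)%N.
Proof.
move=> [r r0 [[B PB] cf]].
pose rho := r / 2; have rho0 : 0 < rho by rewrite divr_gt0.
have rr : rho + rho = r by rewrite -splitr.
pose K l : R := \prod_i ((mult l i)`!%:R * rho ^- mult l i).
pose T (a : {ffun 'I_k -> nat}) : R := `|c a| * \prod_i r ^+ a i.
have TB N : \sum_(a : {ffun 'I_k -> 'I_N}) T (ffun_of_box a) <= B.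
  rewrite (le_trans _ (PB N))// le_eqVlt; apply/orP; left; apply/eqP.
  apply: eq_bigr => a _; congr (_ * _); apply: eq_bigr => i _.
  by rewrite mxE ffunE.
have K0 l : 0 <= K l.
  by apply: prodr_ge0 => i _; rewrite mulr_ge0// invr_ge0 exprn_ge0// ltW.
have bnd w k0 l (y : 'rV[R]_k) (t : R) (a : {ffun 'I_k -> nat}) : 0 <= t <= 1 -> `|y| < rho ->
    (c a != 0 -> (k0 <= \sum_i w i * a i)%N) ->
    `|c a * dmono (mult l) a (scale w t y)|
      <= t ^+ (k0 - \sum_i w i * mult l i)%N * K l * T a.
  move=> t01 yr; rewrite normrM; have [c0 _|c0 /(_ isT) ka] := eqVneq (c a) 0.
    rewrite c0 normr0 mul0r mulr_ge0//; last first.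
      by rewrite /T mulr_ge0// prodr_ge0// => i _; rewrite exprn_ge0// ltW.
    by rewrite mulr_ge0// exprn_ge0//; case/andP: t01.
  have := @dmono_bound w (mult l) a y t rho rho k0 rho0 t01 (ltW yr) ka.
  rewrite rr -/(K l) => /(ler_wpM2l (normr_ge0 (c a)))/le_trans; apply.
  by rewrite /T le_eqVlt; apply/orP; left; apply/eqP; ring.
have scale1 (y : 'rV[R]_k) : scale (fun=> 0%N) 1 y = y.
  by apply/rowP => i; rewrite mxE expr0 mul1r.
have t01 : 0 <= (1 : R) <= 1 by rewrite ler01 lexx.
have bnd1 l (y : 'rV[R]_k) (a : {ffun 'I_k -> nat}) : `|y| < rho ->
    `|c a * dmono (mult l) a y| <= K l * T a.
  move=> yr; have := @bnd (fun=> 0%N) 0%N l y 1 a t01 yr (fun=> isT).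
  by rewrite scale1 expr1n mul1r.
have sumB N (D : R) (G : {ffun 'I_k -> nat} -> R) : 0 <= D -> (forall a, `|G a| <= D * T a) ->
    `|\sum_(a : {ffun 'I_k -> 'I_N}) G (ffun_of_box a)| <= D * B.
  move=> D0 GD; rewrite (le_trans (ler_norm_sum _ _ _))//.
  rewrite (le_trans (ler_sum _ (fun a _ => GD (ffun_of_box a))))//.
  by rewrite -mulr_sumr; apply: ler_wpM2l => //; exact: TB.
have TS : forall l (x : 'rV[R]_k), `|x| < rho ->
    iter_pd l (psum c ^~ N) x @[N --> \oo] --> iter_pd l f x
    /\ differentiable (iter_pd l f) x.
apply: (@termwise_smooth R k (fun N x => psum c x N)).
- move=> N n; rewrite (_ : (fun x => _) = fun x => \sum_(a : {ffun 'I_k -> 'I_N})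
     c (ffun_of_box a) * dmono (fun=> 0%N) (ffun_of_box a) x); last first.
    by apply/funext => x; exact: psumE.
  apply: (smooth_on_sum _ openT) => a m.
  by apply: Cn_mul; [exact: openT|exact: Cn_cst|exact: smooth_dmono].
- move=> x xr; apply: cf => i; rewrite (le_lt_trans (norm_coord_le _ _))//.
  by rewrite (lt_trans xr)// -rr ltrDl.
- move=> l x xr; rewrite (_ : (fun N => _) = (fun N => \sum_(a : {ffun 'I_k -> 'I_N})
     (fun a : {ffun 'I_k -> nat} => c a * dmono (mult l) a x) (ffun_of_box a))); last first.
    by apply/funext => N; rewrite iter_pd_psum.
  have := @cvg_box (fun a : {ffun 'I_k -> nat} => c a * dmono (mult l) a x)
    (fun a => K l * T a) (K l * B) (fun a => bnd1 l x a xr).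
  apply=> N.
  by rewrite -mulr_sumr; apply: ler_wpM2l => //; exact: TB.
- move=> l; exists (K l * B) => N y yr; rewrite iter_pd_psum.
  by apply: (sumB N _ (fun a : {ffun 'I_k -> nat} => c a * dmono (mult l) a y)) => // a; exact: bnd1.
have nr : \forall y \near (0 : 'rV[R]_k), `|y| < rho.
  exact: nbhs0_lt.
split.
  by apply: filterS nr => x xr l; exact: (TS l x xr).2.
move=> w k0 ck l; exists (K l * B); apply: filterS nr => y yr t t0.
have syr : `|scale w t y| < rho by exact: le_lt_trans (norm_scale_le _ _ t0) yr.
apply: (limit_norm_le (TS l _ syr).1) => N; rewrite iter_pd_psum.
rewrite [K l * B * _]mulrC mulrA.
apply: (sumB N _ (fun a : {ffun 'I_k -> nat} => c a * dmono (mult l) a (scale w t y))).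
  by rewrite mulr_ge0// exprn_ge0//; case/andP: t0.
by move=> a; apply: bnd => //; exact: ck.
Qed.

End power_series.

(** * Smooth complex functions and weighted orders of vanishing *)

Notation reC := complex.Re.
Notation imC := complex.Im.

Lemma near_interior (T : topologicalType) (p : T) (A : set T) :
  (\forall x \near p, A x) -> \forall x \near p, \forall y \near x, A y.
Proof.
rewrite -nbhs_nearE nbhsE => -[U [oU Up] UA].
by apply: filterS (open_nbhs_nbhs (conj oU Up)) => x Ux;
  apply: filterS (open_nbhs_nbhs (conj oU Ux)).
Qed.

Section smooth_near.
Variables (R : realType) (d : nat).
Implicit Types (f g : 'rV[R]_d -> R) (p : 'rV[R]_d).

Lemma smooth_near_ext p f g : (\forall x \near p, f x = g x) ->
  smooth_near p f -> smooth_near p g.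
Proof.
move=> fg /smooth_nearP[U [oU Up sf]]; apply/smooth_nearP.
move: fg; rewrite -nbhs_nearE nbhsE => -[V [oV Vp] VA].
exists (U `&` V); split; [exact: openI|by []|].
move=> n; apply: (@Cn_ext _ _ _ _ f); [exact: openI|by move=> x [_ /VA]|].
by apply: (Cn_sub _ (sf n)) => x [].
Qed.

Lemma smooth_near_bin p f g (op : R -> R -> R) :
  (forall n U, open U -> Cn n U f -> Cn n U g -> Cn n U (fun x => op (f x) (g x))) ->
  smooth_near p f -> smooth_near p g -> smooth_near p (fun x => op (f x) (g x)).
Proof.
move=> H /smooth_nearP[U [oU Up sf]] /smooth_nearP[V [oV Vp sg]].
apply/smooth_nearP; exists (U `&` V); split; [exact: openI|by []|].
move=> n; apply: H; first exact: openI.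
  by apply: (Cn_sub _ (sf n)) => x [].
by apply: (Cn_sub _ (sg n)) => x [].
Qed.

Lemma smooth_near_add p f g : smooth_near p f -> smooth_near p g ->
  smooth_near p (fun x => f x + g x).
Proof. by apply: smooth_near_bin => n U; exact: Cn_add. Qed.

Lemma smooth_near_mul p f g : smooth_near p f -> smooth_near p g ->
  smooth_near p (fun x => f x * g x).
Proof. by apply: smooth_near_bin => n U; exact: Cn_mul. Qed.

Lemma smooth_near_cst p (c : R) : smooth_near p (fun=> c).
Proof.
by apply/smooth_nearP; exists setT; split; [exact: openT|by []|move=> n; exact: Cn_cst].
Qed.

Lemma smooth_near_coord p i : smooth_near p (fun x => x 0 i).
Proof.
by apply/smooth_nearP; exists setT; split; [exact: openT|by []|move=> n; exact: Cn_coord].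
Qed.

Lemma smooth_near_opp p f : smooth_near p f -> smooth_near p (fun x => - f x).
Proof.
move=> sf; apply: (@smooth_near_ext _ (fun x => -1 * f x)).
  by apply: filterE => x; rewrite mulN1r.
by apply: smooth_near_mul => //; exact: smooth_near_cst.
Qed.

Lemma smooth_near_sub p f g : smooth_near p f -> smooth_near p g ->
  smooth_near p (fun x => f x - g x).
Proof. by move=> sf sg; apply: smooth_near_add => //; exact: smooth_near_opp. Qed.

Lemma smooth_near_diff p f : smooth_near p f ->
  \forall x \near p, differentiable f x.
Proof. by apply: filterS => x /(_ [::]). Qed.

Lemma smooth_near_diff1 p f : smooth_near p f -> differentiable f p.
Proof. by move=> /smooth_near_diff/nbhs_singleton. Qed.

Lemma smooth_near_cont p f : smooth_near p f -> {for p, continuous f}.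
Proof. by move=> /smooth_near_diff1; exact: differentiable_continuous. Qed.

Lemma smooth_near_near p f : smooth_near p f -> \forall x \near p, smooth_near x f.
Proof. by apply: near_interior. Qed.

Lemma smooth_near_inv p f : smooth_near p f -> f p != 0 ->
  smooth_near p (fun x => (f x)^-1).
Proof.
move=> sf fp; have := sf => /smooth_nearP[U [oU Up sU]].
have : \forall x \near p, f x != 0.
  exact: (cvgr_neq0 (f p) (smooth_near_cont sf) fp).
rewrite -nbhs_nearE nbhsE => -[V [oV Vp] VA].
apply/smooth_nearP; exists (U `&` V); split; [exact: openI|by []|].
move=> n; apply: Cn_inv; [exact: openI|by move=> x [_ /VA]|].
by apply: (Cn_sub _ (sU n)) => x [].
Qed.

Lemma smooth_near_iter p l f : smooth_near p f -> smooth_near p (iter_pd l f).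
Proof.
move=> /smooth_nearP[U [oU Up sf]]; apply/smooth_nearP; exists U; split=> //.
exact: smooth_on_iter_pd.
Qed.

Lemma smooth_near_pd p j f : smooth_near p f -> smooth_near p (pd j f).
Proof. exact: (@smooth_near_iter p [:: j]). Qed.
End smooth_near.

Section complex_calculus.
Variables (R : realType) (d : nat).
Local Notation C := R[i].
Implicit Types (f g : 'rV[R]_d -> C) (p x : 'rV[R]_d).

Definition cpd j f x : C :=
  pd j (fun y => reC (f y)) x +i* pd j (fun y => imC (f y)) x.

Definition cdiff f x :=
  differentiable (fun y => reC (f y)) x /\ differentiable (fun y => imC (f y)) x.

Definition csm p f :=
  smooth_near p (fun y => reC (f y)) /\ smooth_near p (fun y => imC (f y)).

Lemma dfunE f x X : dfun f x X = \sum_j X 0 j * cpd j f x.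
Proof. by []. Qed.

Lemma cpd_near f g j x : (\forall y \near x, f y = g y) -> cpd j f x = cpd j g x.
Proof.
move=> fg; congr (_ +i* _); apply: pd_near; apply: filterS fg => y -> //.
Qed.

Lemma cpd_cst (c : C) j x : cpd j (fun=> c) x = 0.
Proof. by rewrite /cpd !pd_cst. Qed.

Lemma cpdD f g j x : cdiff f x -> cdiff g x ->
  cpd j (fun y => f y + g y) x = cpd j f x + cpd j g x.
Proof.
move=> [fr fi] [gr gi]; rewrite /cpd.
have -> : (fun y => reC (f y + g y)) = (fun y => reC (f y) + reC (g y)).
  by apply/funext => y; case: (f y) (g y) => [? ?] [].
have -> : (fun y => imC (f y + g y)) = (fun y => imC (f y) + imC (g y)).
  by apply/funext => y; case: (f y) (g y) => [? ?] [].
by rewrite !pdD.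
Qed.

Lemma cpdM f g j x : cdiff f x -> cdiff g x ->
  cpd j (fun y => f y * g y) x = f x * cpd j g x + g x * cpd j f x.
Proof.
move=> [fr fi] [gr gi]; rewrite /cpd.
have -> : (fun y => reC (f y * g y)) =
    (fun y => reC (f y) * reC (g y) - imC (f y) * imC (g y)).
  by apply/funext => y; case: (f y) (g y) => [? ?] [].
have -> : (fun y => imC (f y * g y)) =
    (fun y => reC (f y) * imC (g y) + imC (f y) * reC (g y)).
  by apply/funext => y; case: (f y) (g y) => [? ?] [].
rewrite pdB ?pdD ?pdM//; try exact: differentiableM.
by case: (f x) (g x) => [a b] [c e]; apply/eqP; rewrite eq_complex /=; apply/andP; split; apply/eqP; ring.
Qed.

Lemma cdiffD f g x : cdiff f x -> cdiff g x -> cdiff (fun y => f y + g y) x.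
Proof.
move=> [fr fi] [gr gi]; rewrite /cdiff.
have -> : (fun y => reC (f y + g y)) = (fun y => reC (f y) + reC (g y)).
  by apply/funext => y; case: (f y) (g y) => [? ?] [].
have -> : (fun y => imC (f y + g y)) = (fun y => imC (f y) + imC (g y)).
  by apply/funext => y; case: (f y) (g y) => [? ?] [].
by split; exact: differentiableD.
Qed.

Lemma cdiffM f g x : cdiff f x -> cdiff g x -> cdiff (fun y => f y * g y) x.
Proof.
move=> [fr fi] [gr gi]; rewrite /cdiff.
have -> : (fun y => reC (f y * g y)) =
    (fun y => reC (f y) * reC (g y) - imC (f y) * imC (g y)).
  by apply/funext => y; case: (f y) (g y) => [? ?] [].
have -> : (fun y => imC (f y * g y)) =
    (fun y => reC (f y) * imC (g y) + imC (f y) * reC (g y)).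
  by apply/funext => y; case: (f y) (g y) => [? ?] [].
by split; [apply: differentiableB|apply: differentiableD]; exact: differentiableM.
Qed.

Lemma cdiff_cst (c : C) x : cdiff (fun=> c) x.
Proof. by split; exact: differentiable_cst. Qed.

Lemma csm_ext p f g : (\forall x \near p, f x = g x) -> csm p f -> csm p g.
Proof.
move=> fg [sr si]; split.
  by apply: smooth_near_ext sr; apply: filterS fg => x ->.
by apply: smooth_near_ext si; apply: filterS fg => x ->.
Qed.

Lemma csm_near p f : csm p f -> \forall x \near p, csm x f.
Proof.
move=> [/smooth_near_near sr /smooth_near_near si].
by apply: filterS2 sr si => x; split.
Qed.

Lemma csm_diff p f : csm p f -> cdiff f p.
Proof. by move=> [/smooth_near_diff1 ? /smooth_near_diff1 ?]. Qed.

Lemma csm_cst p (c : C) : csm p (fun=> c).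
Proof. by split; exact: smooth_near_cst. Qed.

Lemma csm_add p f g : csm p f -> csm p g -> csm p (fun x => f x + g x).
Proof.
move=> [fr fi] [gr gi]; split.
  apply: smooth_near_ext (smooth_near_add fr gr).
  by apply: filterE => y; case: (f y) (g y) => [? ?] [].
apply: smooth_near_ext (smooth_near_add fi gi).
by apply: filterE => y; case: (f y) (g y) => [? ?] [].
Qed.

Lemma csm_mul p f g : csm p f -> csm p g -> csm p (fun x => f x * g x).
Proof.
move=> [fr fi] [gr gi]; split.
  apply: smooth_near_ext (smooth_near_sub (smooth_near_mul fr gr) (smooth_near_mul fi gi)).
  by apply: filterE => y; case: (f y) (g y) => [? ?] [].
apply: smooth_near_ext (smooth_near_add (smooth_near_mul fr gi) (smooth_near_mul fi gr)).
by apply: filterE => y; case: (f y) (g y) => [? ?] [].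
Qed.

Lemma csm_opp p f : csm p f -> csm p (fun x => - f x).
Proof.
move=> sf; apply: (@csm_ext _ (fun x => -1 * f x)).
  by apply: filterE => x; rewrite mulN1r.
by apply: csm_mul => //; exact: csm_cst.
Qed.

Lemma csm_sub p f g : csm p f -> csm p g -> csm p (fun x => f x - g x).
Proof. by move=> sf sg; apply: csm_add => //; exact: csm_opp. Qed.

Lemma csm_conj p f : csm p f -> csm p (fun x => (f x)^*).
Proof.
move=> [fr fi]; split.
  by apply: smooth_near_ext fr; apply: filterE => y; case: (f y).
by apply: smooth_near_ext (smooth_near_opp fi); apply: filterE => y; case: (f y).
Qed.

Lemma csm_real p (f : 'rV[R]_d -> R) : smooth_near p f -> csm p (fun x => (f x)%:C).
Proof. by move=> sf; split => //=; exact: smooth_near_cst. Qed.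

Lemma csm_inv p f : csm p f -> f p != 0 -> csm p (fun x => (f x)^-1).
Proof.
move=> sf fp; have [fr fi] := sf.
pose n x := reC (f x) * reC (f x) + imC (f x) * imC (f x).
have sn : smooth_near p n.
  by apply: smooth_near_add; exact: smooth_near_mul.
have n0 : n p != 0.
  apply: contra fp; rewrite /n -!expr2 paddr_eq0 ?sqr_ge0// !sqrf_eq0.
  by rewrite eq_complex.
have sin := smooth_near_inv sn n0.
apply: csm_ext (csm_mul (csm_conj sf) (csm_real sin)).
apply: filterE => x; rewrite /n; case: (f x) => a b /=.
by apply/eqP; rewrite eq_complex /= -!expr2; apply/andP; split; apply/eqP; ring.
Qed.

Lemma csm_cpd p j f : csm p f -> csm p (cpd j f).
Proof. by move=> [fr fi]; split; apply: smooth_near_pd. Qed.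

Lemma csm_sum p (I : Type) (r : seq I) (P : pred I) (f : I -> 'rV[R]_d -> C) :
  (forall i, csm p (f i)) -> csm p (fun x => \sum_(i <- r | P i) f i x).
Proof.
move=> sf; elim: r => [|i r IH].
  rewrite (_ : (fun x => _) = (fun=> 0)); first exact: csm_cst.
  by apply/funext => x; rewrite big_nil.
rewrite (_ : (fun x => _) = (fun x => (if P i then f i x else 0)
   + \sum_(k <- r | P k) f k x)).
  by apply: csm_add => //; case: (P i) => //; exact: csm_cst.
by apply/funext => x; rewrite big_cons; case: (P i); rewrite ?add0r.
Qed.

Lemma csm_prod p (I : Type) (r : seq I) (f : I -> 'rV[R]_d -> C) :
  (forall i, csm p (f i)) -> csm p (fun x => \prod_(i <- r) f i x).
Proof.
move=> sf; elim: r => [|i r IH].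
  rewrite (_ : (fun x => _) = (fun=> 1)); first exact: csm_cst.
  by apply/funext => x; rewrite big_nil.
rewrite (_ : (fun x => _) = (fun x => f i x * \prod_(k <- r) f k x)).
  exact: csm_mul.
by apply/funext => x; rewrite big_cons.
Qed.

Lemma csm_det p n (A : 'rV[R]_d -> 'M[C]_n) : csmooth_near p A ->
  csm p (fun x => \det (A x)).
Proof.
move=> sA; apply: csm_sum => s; apply: csm_mul; first exact: csm_cst.
by apply: csm_prod => i.
Qed.

Lemma csm_cofactor p n (A : 'rV[R]_d -> 'M[C]_n) i j :
  csmooth_near p A -> csm p (fun x => cofactor (A x) i j).
Proof.
move=> sA; apply: csm_mul; first exact: csm_cst.
apply: csm_det => a b; apply: csm_ext (sA (lift i a) (lift j b)).
by apply: filterE => x; rewrite !mxE.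
Qed.

Lemma near_unitmx p n (A : 'rV[R]_d -> 'M[C]_n) :
  csmooth_near p A -> A p \in unitmx ->
  \forall x \near p, A x \in unitmx.
Proof.
move=> sA; rewrite unitmxE unitfE => Ap.
have [dr di] := csm_det sA.
have n0 : reC (\det (A p)) * reC (\det (A p)) + imC (\det (A p)) * imC (\det (A p)) != 0.
  apply: contra Ap; rewrite -!expr2 paddr_eq0 ?sqr_ge0// !sqrf_eq0.
  by rewrite eq_complex.
have sn := smooth_near_add (smooth_near_mul dr dr) (smooth_near_mul di di).
apply: filterS (cvgr_neq0 _ (smooth_near_cont sn) n0) => x nx.
rewrite unitmxE unitfE; apply: contra nx => /eqP ->; by rewrite /= !mulr0 addr0.
Qed.

Lemma csm_invmx p n (A : 'rV[R]_d -> 'M[C]_n) i j :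
  csmooth_near p A -> A p \in unitmx ->
  csm p (fun x => invmx (A x) i j).
Proof.
move=> sA Ap; have nA := near_unitmx sA Ap.
have dp : \det (A p) != 0 by rewrite -unitfE -unitmxE.
apply: csm_ext (csm_mul (csm_inv (csm_det sA) dp) (csm_cofactor j i sA)).
by apply: filterS nA => x Ax; rewrite /invmx Ax !mxE.
Qed.

Lemma csm_mulmx p m n l (A : 'rV[R]_d -> 'M[C]_(m, n)) (B : 'rV[R]_d -> 'M[C]_(n, l)) i j :
  csmooth_near p A -> csmooth_near p B ->
  csm p (fun x => (A x *m B x) i j).
Proof.
move=> sA sB; apply: (@csm_ext _ (fun x => \sum_k A x i k * B x k j)).
  by apply: filterE => x; rewrite mxE.
by apply: csm_sum => k; exact: csm_mul.
Qed.

Lemma cpd_sum j x (I : Type) (r : seq I) (f : I -> 'rV[R]_d -> C) :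
  (forall i, cdiff (f i) x) ->
  cpd j (fun y => \sum_(i <- r) f i y) x = \sum_(i <- r) cpd j (f i) x /\
  cdiff (fun y => \sum_(i <- r) f i y) x.
Proof.
move=> df; elim: r => [|i r [IH IH2]].
  rewrite (_ : (fun x => _) = (fun=> 0)); last by apply/funext => y; rewrite big_nil.
  by rewrite big_nil cpd_cst; split => //; exact: cdiff_cst.
rewrite (_ : (fun x => _) = (fun x => f i x + \sum_(k <- r) f k x)); last first.
  by apply/funext => y; rewrite big_cons.
by rewrite big_cons cpdD// IH; split => //; exact: cdiffD.
Qed.

Lemma cpd_conj j f x : cdiff f x -> cpd j (fun y => (f y)^*) x = (cpd j f x)^*.
Proof.
move=> [fr fi]; rewrite /cpd.
have -> : (fun y => reC ((f y)^*)) = (fun y => reC (f y)).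
  by apply/funext => y; case: (f y).
have -> : (fun y => imC ((f y)^*)) = (fun y => - imC (f y)).
  by apply/funext => y; case: (f y).
by rewrite pdN.
Qed.

Lemma cdiff_conj f x : cdiff f x -> cdiff (fun y => (f y)^*) x.
Proof.
move=> [fr fi]; split.
  by rewrite (_ : (fun y => _) = (fun y => reC (f y)))//; apply/funext => y; case: (f y).
rewrite (_ : (fun y => _) = (fun y => - imC (f y))); first exact: differentiableN.
by apply/funext => y; case: (f y).
Qed.

Lemma dfunD f g x X : cdiff f x -> cdiff g x ->
  dfun (fun y => f y + g y) x X = dfun f x X + dfun g x X.
Proof.
move=> df dg; rewrite !dfunE -big_split; apply: eq_bigr => j _.
by rewrite cpdD// mulrDr.
Qed.

Lemma dfunM f g x X : cdiff f x -> cdiff g x ->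
  dfun (fun y => f y * g y) x X = f x * dfun g x X + g x * dfun f x X.
Proof.
move=> df dg; rewrite !dfunE !mulr_sumr -big_split; apply: eq_bigr => j _.
by rewrite cpdM// mulrDr !(mulrCA _ (X 0 j)).
Qed.

Lemma dfun_near f g x X : (\forall y \near x, f y = g y) -> dfun f x X = dfun g x X.
Proof.
by move=> fg; rewrite !dfunE; apply: eq_bigr => j _; rewrite (cpd_near _ fg).
Qed.

Lemma dfun_cst (c : C) x X : dfun (fun=> c) x X = 0.
Proof. by rewrite dfunE big1// => j _; rewrite cpd_cst mulr0. Qed.

Lemma dfun_sum x X (I : Type) (r : seq I) (f : I -> 'rV[R]_d -> C) :
  (forall i, cdiff (f i) x) ->
  dfun (fun y => \sum_(i <- r) f i y) x X = \sum_(i <- r) dfun (f i) x X.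
Proof.
move=> df; rewrite dfunE; under eq_bigr do rewrite (cpd_sum _ _ df).1 mulr_sumr.
by rewrite exchange_big.
Qed.

Lemma dfun_linear f x a (X Y : 'rV[C]_d) :
  dfun f x (a *: X + Y) = a * dfun f x X + dfun f x Y.
Proof.
rewrite !dfunE mulr_sumr -big_split; apply: eq_bigr => j _.
by rewrite !mxE mulrDl mulrA.
Qed.

Lemma dfun_conj f x X : cdiff f x ->
  dfun (fun y => (f y)^*) x (conjv X) = (dfun f x X)^*.
Proof.
move=> df; rewrite !dfunE rmorph_sum; apply: eq_bigr => j _.
by rewrite cpd_conj// mxE rmorphM.
Qed.

Lemma csm_dfun p f (X : 'rV[R]_d -> 'rV[C]_d) : csm p f ->
  (forall j, csm p (fun x => X x 0 j)) -> csm p (fun x => dfun f x (X x)).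
Proof. by move=> sf sX; apply: csm_sum => j; apply: csm_mul => //; exact: csm_cpd. Qed.

End complex_calculus.

Section linear_composition.
Variables (R : realType) (d k : nat) (M : 'M[R]_(d, k)).
Implicit Types (g : 'rV[R]_k -> R).

Lemma mulmxr_continuous : continuous (fun x : 'rV[R]_d => x *m M).
Proof.
have E : (fun x : 'rV[R]_d => x *m M) = \sum_j (fun x : 'rV[R]_d => x 0 j *: row j M).
  by apply/funext => x; rewrite fct_sumE mulmx_sum_row.
move=> x; apply: differentiable_continuous; rewrite E.
apply: differentiable_sum => j; apply: differentiableZl; exact: differentiable_coord.
Qed.

Lemma differentiable_comp_lin g x : differentiable g (x *m M) ->
  differentiable (fun y => g (y *m M)) x.
Proof.
move=> dg; apply: (@differentiable_comp _ _ _ _ (fun y : 'rV[R]_d => y *m M) g) => //.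
have E : (fun x : 'rV[R]_d => x *m M) = \sum_j (fun x : 'rV[R]_d => x 0 j *: row j M).
  by apply/funext => y; rewrite fct_sumE mulmx_sum_row.
rewrite E; apply: differentiable_sum => j; apply: differentiableZl; exact: differentiable_coord.
Qed.

Lemma pd_comp_lin g j x : differentiable g (x *m M) ->
  pd j (fun y => g (y *m M)) x = \sum_i M j i * pd i g (x *m M).
Proof.
move=> dg; transitivity ('D_(row j M) g (x *m M)).
  rewrite /pd /derive; set g1 := (fun h : R => _); set g2 := (fun h : R => _).
  suff -> : g1 = g2 by [].
  by apply/funext => h; rewrite /g1 /g2 /= mulmxDl -scalemxAl -rowE.
by rewrite deriveE// diffE_pd//; apply: eq_bigr => i _; rewrite mxE.
Qed.

Lemma Cn_comp_lin n U g : open U -> Cn n U g ->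
  Cn n ((fun x => x *m M) @^-1` U) (fun x => g (x *m M)).
Proof.
move=> oU; have oV : open ((fun x => x *m M) @^-1` U).
  by apply: open_comp => // x _; exact: mulmxr_continuous.
elim: n g => [|n IH] g Cg.
  by split=> // x Ux; apply: differentiable_comp_lin; exact: (Cn_diff Cg Ux).
split=> [x Ux|j]; first by apply: differentiable_comp_lin; exact: (Cn_diff Cg Ux).
apply: (@Cn_ext _ _ _ _ (fun x => \sum_(i <- enum 'I_k) M j i * pd i g (x *m M))) => //.
  by move=> x Ux; rewrite pd_comp_lin ?big_enum//; exact: (Cn_diff Cg Ux).
elim: (enum _) => [|i r IHr].
  apply: (@Cn_ext _ _ _ _ (fun=> 0)) => //; last exact: Cn_cst.
  by move=> x _; rewrite big_nil.
apply: (@Cn_ext _ _ _ _ (fun x => M j i * pd i g (x *m M) +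
    \sum_(i <- r) M j i * pd i g (x *m M))) => //.
  by move=> x _; rewrite big_cons.
apply: Cn_add => //; apply: Cn_mul => //; first exact: Cn_cst.
by apply: IH; exact: Cn_pd.
Qed.

Lemma smooth_near_comp_lin p g : smooth_near (p *m M) g ->
  smooth_near p (fun x => g (x *m M)).
Proof.
move=> /smooth_nearP[U [oU Up sg]]; apply/smooth_nearP.
exists ((fun x => x *m M) @^-1` U); split => //.
  by apply: open_comp => // x _; exact: mulmxr_continuous.
by move=> n; exact: Cn_comp_lin.
Qed.
End linear_composition.

Lemma iter_pd_cst0 (R : realType) (d : nat) (l : seq 'I_d) (x : 'rV[R]_d) :
  iter_pd l (fun=> 0) x = 0.
Proof.
rewrite (_ : iter_pd l (fun=> 0) = (fun=> 0)) //.
by elim: l => //= j l ->; apply/funext => y; exact: pd_cst.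
Qed.

Section weights.
Variables (R : realType) (d : nat) (w : 'I_d -> nat).
Local Notation C := R[i].
Implicit Types (g h : 'rV[R]_d -> R) (f : 'rV[R]_d -> C).

Lemma near_scale (A : set 'rV[R]_d) : (\forall x \near (0 : 'rV[R]_d), A x) ->
  \forall y \near (0 : 'rV[R]_d), forall t : R, 0 < t <= 1 -> A (scale w t y).
Proof.
move=> /nbhs_ballP[r /= r0 rA].
have nr : \forall y \near (0 : 'rV[R]_d), `|y| < r by exact: nbhs0_lt.
apply: filterS nr => y yr t /andP[t0 t1]; apply: rA.
rewrite -ball_normE/= sub0r normrN; apply: le_lt_trans yr.
by apply: norm_scale_le; rewrite (ltW t0).
Qed.

(** Vanishing to weighted order k, tested along the orbits of the dilations. *)
Definition wt0 (k : nat) g : Prop := exists B : R,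
  \forall y \near (0 : 'rV[R]_d), forall t : R, 0 < t <= 1 ->
    `|g (scale w t y)| <= B * t ^+ k.

(** A derivative in a direction of weight b lowers the weighted order by b; the
    subtraction is truncated since below order 0 only boundedness remains. *)
Fixpoint wge (n k : nat) g : Prop :=
  wt0 k g /\ if n is n'.+1 then forall j, wge n' (k - w j)%N (pd j g) else True.

Definition W n k g := smooth_near 0 g /\ wge n k g.

Lemma wge0 n k g : wge n k g -> wt0 k g.
Proof. by case: n => [|n] []. Qed.

Lemma W_pd n k g j : W n.+1 k g -> W n (k - w j)%N (pd j g).
Proof. by move=> [sg [_ /(_ j)]]; split => //; exact: smooth_near_pd. Qed.

Lemma wt0_ext k g h : (\forall x \near (0 : 'rV[R]_d), g x = h x) -> wt0 k g -> wt0 k h.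
Proof.
move=> /near_scale gh [B gB]; exists B; apply: filterS2 gh gB => y ghy gBy t t01.
by rewrite -ghy//; exact: gBy.
Qed.

Lemma wge_ext n k g h : (\forall x \near (0 : 'rV[R]_d), g x = h x) -> wge n k g -> wge n k h.
Proof.
elim: n k g h => [|n IH] k g h gh [g0 gn]; (split; first exact: wt0_ext g0) => // j.
apply: IH (gn j); have := near_interior gh.
by apply: filterS => x; exact: pd_near.
Qed.

Lemma W_ext n k g h : (\forall x \near (0 : 'rV[R]_d), g x = h x) -> W n k g -> W n k h.
Proof. by move=> gh [sg Wg]; split; [exact: smooth_near_ext sg|exact: wge_ext Wg]. Qed.

Lemma wt0_le k k' g : (k' <= k)%N -> wt0 k g -> wt0 k' g.
Proof.
move=> kk [B gB]; exists `|B|; apply: filterS gB => y gBy t t01.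
have /andP[t0 t1] := t01.
rewrite (le_trans (gBy t t01))// (le_trans (ler_wpM2r (exprn_ge0 _ (ltW t0)) (ler_norm _)))//.
by rewrite ler_wpM2l// ler_wiXn2l// ltW.
Qed.

Lemma wge_le n k k' g : (k' <= k)%N -> wge n k g -> wge n k' g.
Proof.
elim: n k k' g => [|n IH] k k' g kk [g0 gn]; (split; first exact: wt0_le g0) => // j.
by apply: IH (gn j); exact: leq_sub2r.
Qed.

Lemma W_le n k k' g : (k' <= k)%N -> W n k g -> W n k' g.
Proof. by move=> kk [sg Wg]; split => //; exact: wge_le Wg. Qed.

Lemma wge_dec n k g : wge n.+1 k g -> wge n k g.
Proof.
elim: n k g => [|n IH] k g [g0 gn]; split=> // j; exact: IH.
Qed.

Lemma W_dec n k g : W n.+1 k g -> W n k g.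
Proof. by move=> [sg /wge_dec]. Qed.

Lemma wt0_add k g h : wt0 k g -> wt0 k h -> wt0 k (fun x => g x + h x).
Proof.
move=> [B gB] [D hD]; exists (B + D); apply: filterS2 gB hD => y gBy hDy t t01.
by rewrite (le_trans (ler_normD _ _))// mulrDl lerD// ?gBy ?hDy.
Qed.

Lemma W_add n k g h : W n k g -> W n k h -> W n k (fun x => g x + h x).
Proof.
move=> Wg Wh; split; first by apply: smooth_near_add; [exact: Wg.1|exact: Wh.1].
elim: n k g h Wg Wh => [|n IH] k g h Wg Wh.
  by split=> //; apply: wt0_add; [exact: wge0 Wg.2|exact: wge0 Wh.2].
split=> [|j]; first by apply: wt0_add; [exact: wge0 Wg.2|exact: wge0 Wh.2].
apply: wge_ext (IH _ _ _ (W_pd j Wg) (W_pd j Wh)).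
apply: filterS2 (smooth_near_diff Wg.1) (smooth_near_diff Wh.1) => x dg dh.
by rewrite pdD.
Qed.

Lemma wt0_mul k l g h : wt0 k g -> wt0 l h -> wt0 (k + l) (fun x => g x * h x).
Proof.
move=> [B gB] [D hD]; exists (B * D); apply: filterS2 gB hD => y gBy hDy t t01.
rewrite normrM exprD mulrACA; apply: ler_pM => //; [exact: gBy|exact: hDy].
Qed.

Lemma W_mul n k l g h : W n k g -> W n l h -> W n (k + l) (fun x => g x * h x).
Proof.
move=> Wg Wh; split; first by apply: smooth_near_mul; [exact: Wg.1|exact: Wh.1].
elim: n k l g h Wg Wh => [|n IH] k l g h Wg Wh.
  by split=> //; apply: wt0_mul; [exact: wge0 Wg.2|exact: wge0 Wh.2].
split=> [|j]; first by apply: wt0_mul; [exact: wge0 Wg.2|exact: wge0 Wh.2].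
have sgh := smooth_near_mul Wg.1 (smooth_near_pd j Wh.1).
have shg := smooth_near_mul Wh.1 (smooth_near_pd j Wg.1).
apply: (@wge_ext _ _ (fun x => g x * pd j h x + h x * pd j g x)).
  apply: filterS2 (smooth_near_diff Wg.1) (smooth_near_diff Wh.1) => x dg dh.
  by rewrite pdM.
have leq1 (a b c : nat) : (a + b - c <= a + (b - c))%N.
  by rewrite leq_subLR addnCA leq_add2l -leq_subLR.
suff : W n (k + l - w j) (fun x => g x * pd j h x + h x * pd j g x) by case.
apply: W_add; (split; first by []).
  by apply: wge_le (leq1 _ _ _) _; exact: IH (W_dec Wg) (W_pd j Wh).
by rewrite addnC; apply: wge_le (leq1 _ _ _) _; exact: IH (W_dec Wh) (W_pd j Wg).
Qed.

Lemma smooth_near_bounded g : smooth_near 0 g ->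
  exists B : R, \forall y \near (0 : 'rV[R]_d), `|g y| <= B.
Proof.
move=> /smooth_near_cont cg; exists (`|g 0| + 1).
by apply: (cvgr_norm_le _ cg); rewrite ltrDl.
Qed.

Lemma smooth_wt0 g : smooth_near 0 g -> wt0 0 g.
Proof.
move=> /smooth_near_bounded[B gB]; exists B; apply: filterS (near_scale gB) => y gBy t t01.
by rewrite expr0 mulr1; exact: gBy.
Qed.

Lemma W_smooth n g : smooth_near 0 g -> W n 0 g.
Proof.
move=> sg; split => //; elim: n g sg => [|n IH] g sg; split=> //; try exact: smooth_wt0.
by move=> j; rewrite sub0n; apply: IH; exact: smooth_near_pd.
Qed.

Lemma W_opp n k g : W n k g -> W n k (fun x => - g x).
Proof.
move=> Wg; apply: (@W_ext _ _ (fun x => -1 * g x)).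
  by apply: filterE => x; rewrite mulN1r.
by rewrite -[k]add0n; apply: W_mul => //; apply: W_smooth; exact: smooth_near_cst.
Qed.

Definition wseq (l : seq 'I_d) : nat := (\sum_i w i * mult l i)%N.

Lemma wseq_rcons l j : wseq (rcons l j) = (wseq l + w j)%N.
Proof.
rewrite /wseq [X in (_ + X)%N](_ : _ = \sum_i w i * (i == j))%N; last first.
  rewrite (bigD1 j)//= eqxx muln1 big1 ?addn0// => i /negbTE ->; by rewrite muln0.
rewrite -big_split/=; apply: eq_bigr => i _; rewrite -mulnDr; congr (_ * _)%N.
by rewrite /mult -cats1 count_cat /= addn0 [j == i]eq_sym.
Qed.

Lemma wge_iter n k g : (forall l, wt0 (k - wseq l) (iter_pd l g)) -> wge n k g.
Proof.
elim: n k g => [|n IH] k g H.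
  by have := H [::]; rewrite /wseq big1 ?subn0// => i _; rewrite muln0.
split; first by have := H [::]; rewrite /wseq big1 ?subn0// => i _; rewrite muln0.
move=> j; apply: IH => l; have := H (rcons l j).
by rewrite iter_pd_rcons wseq_rcons addnC subnDA.
Qed.

(** Weights read off the power series are weighted orders of vanishing, also
    for the derivatives. *)
Lemma W_expansion n k g c : expansion g c ->
  (forall a, c a != 0 -> (k <= \sum_i w i * a i)%N) -> W n k g.
Proof.
move=> /expansion_smooth_weight[sg wg] ck; split=> //; apply: wge_iter => l.
have [B gB] := wg w k ck l; exists B; apply: filterS gB => y gBy t /andP[t0 t1].
by apply: gBy; rewrite (ltW t0).
Qed.

(** Homogeneity of degree k - a, with the negative part of the degree kept
    apart so that it is stable under differentiation. *)
Definition homogeneous (a k : nat) g := \forall y \near (0 : 'rV[R]_d),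
  forall t : R, 0 < t <= 1 -> t ^+ a * g (scale w t y) = t ^+ k * g y.

Lemma scaleE (t : R) y : scale w t y = y *m diag_mx (\row_i t ^+ w i).
Proof.
apply/rowP => i; rewrite mxE mul_mx_diag !mxE; exact: mulrC.
Qed.

Lemma pd_scale g j (t : R) y : differentiable g (scale w t y) ->
  pd j (fun y => g (scale w t y)) y = t ^+ w j * pd j g (scale w t y).
Proof.
rewrite scaleE => dg; under eq_fun do rewrite scaleE.
rewrite pd_comp_lin// (bigD1 j)//= !mxE eqxx mulr1n big1 ?addr0// => i ij.
by rewrite mxE eq_sym (negbTE ij) mulr0n mul0r.
Qed.

Lemma homogeneous_pd a k g j : smooth_near 0 g -> homogeneous a k g ->
  homogeneous (a + w j) k (pd j g).
Proof.
move=> sg hg; have dg := near_scale (smooth_near_diff sg).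
have hg' := near_interior hg.
apply: filterS2 (filterI dg (smooth_near_diff sg)) hg' => y [dgy dy] hgy t t01.
have sd : differentiable (fun y => g (scale w t y)) y.
  under eq_fun do rewrite scaleE.
  by apply: differentiable_comp_lin; rewrite -scaleE; exact: dgy.
have c0 (c : R) : differentiable (fun _ : 'rV[R]_d => c) y by exact: differentiable_cst.
have := @pd_near _ _ (fun y => t ^+ a * g (scale w t y)) (fun y => t ^+ k * g y) j y.
rewrite !pdM// !pd_cst !mulr0 !addr0 pd_scale; last exact: dgy.
rewrite exprD -mulrA; apply.
by apply: filterS hgy => z; apply.
Qed.

Lemma homogeneous_iter k g l : smooth_near 0 g -> homogeneous 0 k g ->
  homogeneous (wseq l) k (iter_pd l g).
Proof.
move=> sg hg; elim: l => [|j l IH]; first by rewrite /wseq big1// => i _; rewrite muln0.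
rewrite (_ : wseq (j :: l) = wseq l + w j)%N; last first.
  rewrite -wseq_rcons /wseq; apply: eq_bigr => i _; congr (_ * _)%N.
  by rewrite /mult -cats1 count_cat /= addn0 addnC.
by apply: homogeneous_pd => //; exact: smooth_near_iter.
Qed.

Lemma W_homogeneous n k g : smooth_near 0 g -> homogeneous 0 k g -> W n k g.
Proof.
move=> sg hg; split=> //; apply: wge_iter => l.
have [lk|kl] := leqP (wseq l) k; last first.
  rewrite (_ : (k - wseq l)%N = 0%N); first exact/smooth_wt0/smooth_near_iter.
  by apply/eqP; rewrite subn_eq0 ltnW.
have [B gB] := smooth_near_bounded (smooth_near_iter l sg).
exists B; apply: filterS2 (homogeneous_iter l sg hg) gB => y hy gBy t t01.
have /andP[t0 _] := t01; have := hy t t01.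
rewrite -{1}(subnKC lk) exprD -mulrA => /mulfI -> //; last by rewrite expf_neq0// gt_eqF.
by rewrite normrM ger0_norm ?exprn_ge0 ?(ltW t0)// mulrC ler_wpM2r// exprn_ge0// ltW.
Qed.

(** The points fixed by the dilations. For the weights of the chart this is
    z = 0, v = 0, which is the leaf through the origin. *)
Definition leaf (x : 'rV[R]_d) := forall i, (0 < w i)%N -> x 0 i = 0.

Lemma scale_leaf t x : leaf x -> scale w t x = x.
Proof.
move=> lx; apply/rowP => i; rewrite mxE; case: (posnP (w i)) => [->|/lx ->].
  by rewrite expr0 mul1r.
by rewrite mulr0.
Qed.

(** A point fixed by the dilations satisfies the bound |g x| <= B t^k for every
    small t. *)
Lemma W_leaf n k g : (0 < k)%N -> W n k g ->
  \forall x \near (0 : 'rV[R]_d), leaf x -> g x = 0.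
Proof.
move=> k0 [_ /wge0/(wt0_le k0)[B gB]]; apply: filterS gB => x gBx lx.
apply/eqP; rewrite -normr_le0; apply/ler_addgt0Pr => e e0; rewrite add0r.
pose t : R := Num.min 1 (e / (`|B| + 1)).
have B1 : 0 < `|B| + 1 by rewrite ltr_pwDr.
have t0 : 0 < t by rewrite lt_min ltr01 divr_gt0.
have t1 : t <= 1 by rewrite ge_min lexx.
have := gBx t; rewrite t0 t1 scale_leaf// expr1 => /(_ isT)/le_trans; apply.
rewrite (le_trans (ler_wpM2r (ltW t0) (ler_norm B)))//.
apply: (@le_trans _ _ ((`|B| + 1) * t)); first by rewrite ler_wpM2r ?(ltW t0)// lerDl.
by rewrite mulrC -ler_pdivlMr// ge_min lexx orbT.
Qed.

Definition cW n k f := W n k (fun x => reC (f x)) /\ W n k (fun x => imC (f x)).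

Lemma cW_csm n k f : cW n k f -> csm 0 f.
Proof. by move=> [[? _] [? _]]. Qed.

Lemma cW_ext n k f (g : 'rV[R]_d -> C) : (\forall x \near (0 : 'rV[R]_d), f x = g x) ->
  cW n k f -> cW n k g.
Proof.
move=> fg [fr fi]; split.
  by apply: W_ext fr; apply: filterS fg => x ->.
by apply: W_ext fi; apply: filterS fg => x ->.
Qed.

Lemma cW_cpd n k f j : cW n.+1 k f -> cW n (k - w j) (cpd j f).
Proof. by move=> [/(W_pd j) ? /(W_pd j) ?]. Qed.

Lemma cW_le n k k' f : (k' <= k)%N -> cW n k f -> cW n k' f.
Proof. by move=> kk [/(W_le kk) ? /(W_le kk) ?]. Qed.

Lemma cW_dec n k f : cW n.+1 k f -> cW n k f.
Proof. by move=> [/W_dec ? /W_dec ?]. Qed.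

Lemma cW_add n k f (g : 'rV[R]_d -> C) : cW n k f -> cW n k g -> cW n k (fun x => f x + g x).
Proof.
move=> [fr fi] [gr gi]; split.
  apply: W_ext (W_add fr gr).
  by apply: filterE => y; case: (f y) (g y) => [? ?] [].
apply: W_ext (W_add fi gi).
by apply: filterE => y; case: (f y) (g y) => [? ?] [].
Qed.

Lemma cW_mul n k l f (g : 'rV[R]_d -> C) : cW n k f -> cW n l g ->
  cW n (k + l) (fun x => f x * g x).
Proof.
move=> [fr fi] [gr gi]; split.
  apply: W_ext (W_add (W_mul fr gr) (W_opp (W_mul fi gi))).
  by apply: filterE => y; case: (f y) (g y) => [? ?] [].
apply: W_ext (W_add (W_mul fr gi) (W_mul fi gr)).
by apply: filterE => y; case: (f y) (g y) => [? ?] [].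
Qed.

Lemma cW_smooth n f : csm 0 f -> cW n 0 f.
Proof. by move=> [sr si]; split; exact: W_smooth. Qed.

Lemma cW_opp n k f : cW n k f -> cW n k (fun x => - f x).
Proof.
move=> Wf; apply: (@cW_ext _ _ (fun x => -1 * f x)).
  by apply: filterE => x; rewrite mulN1r.
by rewrite -[k]add0n; apply: cW_mul => //; apply: cW_smooth; exact: csm_cst.
Qed.

Lemma cW_scal n k f (c : C) : cW n k f -> cW n k (fun x => c * f x).
Proof.
by move=> Wf; rewrite -[k]add0n; apply: cW_mul => //; apply: cW_smooth; exact: csm_cst.
Qed.

Lemma cW_conj n k f : cW n k f -> cW n k (fun x => (f x)^*).
Proof.
move=> [fr fi]; split.
  by apply: W_ext fr; apply: filterE => y; case: (f y).
by apply: W_ext (W_opp fi); apply: filterE => y; case: (f y).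
Qed.

Lemma cW_real n k g : W n k g -> cW n k (fun x => (g x)%:C).
Proof.
move=> Wg; split => //=; split; first exact: smooth_near_cst.
by apply: wge_iter => l; apply: (@wt0_le k); [exact: leq_subr|exists 0; apply: filterE => y t _;
  rewrite iter_pd_cst0 normr0 mul0r].
Qed.

Lemma cW_sum n k (I : Type) (r : seq I) (f : I -> 'rV[R]_d -> C) : 
  (forall i, cW n k (f i)) -> cW n k (fun x => \sum_(i <- r) f i x).
Proof.
move=> sf; elim: r => [|i r IH].
  rewrite (_ : (fun x => _) = (fun=> (0 : R)%:C)); last by apply/funext => x; rewrite big_nil.
  apply: cW_real; split; first exact: smooth_near_cst.
  by apply: wge_iter => l; exists 0; apply: filterE => y t _; rewrite iter_pd_cst0 normr0 mul0r.
rewrite (_ : (fun x => _) = (fun x => f i x + \sum_(k <- r) f k x)).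
  exact: cW_add.
by apply/funext => x; rewrite big_cons.
Qed.

Lemma cW_leaf n k f : (0 < k)%N -> cW n k f ->
  \forall x \near (0 : 'rV[R]_d), leaf x -> f x = 0.
Proof.
move=> k0 [/(W_leaf k0) fr /(W_leaf k0) fi]; apply: filterS2 fr fi => x fr fi lx.
by apply/eqP; rewrite eq_complex fr// fi// eqxx.
Qed.

End weights.

(** * The CR structure of a graph and its Levi matrix *)

(** Locked, so that simplification does not turn products with the imaginary
    unit into pairs. *)
Definition iC (R : realType) : R[i] := locked (0 +i* 1).

Lemma iCE (R : realType) : iC R = 0 +i* 1. Proof. by rewrite /iC -lock. Qed.

Section chart.
Variables (R : realType) (s m : nat).
Local Notation C := R[i].
Local Notation d := (chart_dim s m).
Local Notation n := (s + m)%N.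
Local Notation ii := (iC R).

(** The indices A in [s + m] run over z, then zeta; [reI], [imI] and [vI] are
    the positions of the real and imaginary parts and of v in the chart. *)
Definition reI (A : 'I_n) : 'I_d :=
  match fintype.split A with
  | inl j => lshift _ (lshift s j)
  | inr al => rshift (s + s) (lshift 1 (lshift m al))
  end.

Definition imI (A : 'I_n) : 'I_d :=
  match fintype.split A with
  | inl j => lshift _ (rshift s j)
  | inr al => rshift (s + s) (lshift 1 (rshift m al))
  end.

Definition vI : 'I_d := rshift (s + s) (rshift (m + m) ord0).

Lemma split_l (a b : nat) (j : 'I_a) : fintype.split (lshift b j) = inl j.
Proof. exact: (unsplitK (inl j)). Qed.

Lemma split_r (a b : nat) (j : 'I_b) : fintype.split (rshift a j) = inr j.
Proof. exact: (unsplitK (inr j)). Qed.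

Lemma reI_z j : reI (lshift m j) = lshift _ (lshift s j).
Proof. by rewrite /reI split_l. Qed.
Lemma reI_zeta al : reI (rshift s al) = rshift (s + s) (lshift 1 (lshift m al)).
Proof. by rewrite /reI split_r. Qed.
Lemma imI_z j : imI (lshift m j) = lshift _ (rshift s j).
Proof. by rewrite /imI split_l. Qed.
Lemma imI_zeta al : imI (rshift s al) = rshift (s + s) (lshift 1 (rshift m al)).
Proof. by rewrite /imI split_r. Qed.

Lemma chart_split (A : 'I_n) (P : 'I_n -> Prop) :
  (forall j, P (lshift m j)) -> (forall al, P (rshift s al)) -> P A.
Proof. by move=> Pl Pr; rewrite -(splitK A); case: (fintype.split A). Qed.

Lemma eq_reI A B : (reI A == reI B) = (A == B).
Proof.
elim/chart_split: A => a; elim/chart_split: B => b;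
  by rewrite ?reI_z ?reI_zeta ?eq_shift.
Qed.
Lemma eq_imI A B : (imI A == imI B) = (A == B).
Proof.
elim/chart_split: A => a; elim/chart_split: B => b;
  by rewrite ?imI_z ?imI_zeta ?eq_shift.
Qed.
Lemma eq_reI_imI A B : (reI A == imI B) = false.
Proof.
elim/chart_split: A => a; elim/chart_split: B => b;
  by rewrite ?reI_z ?reI_zeta ?imI_z ?imI_zeta ?eq_shift.
Qed.
Lemma eq_imI_reI A B : (imI A == reI B) = false.
Proof. by rewrite eq_sym eq_reI_imI. Qed.
Lemma eq_reI_vI A : (reI A == vI) = false.
Proof. by elim/chart_split: A => a; rewrite ?reI_z ?reI_zeta /vI ?eq_shift. Qed.
Lemma eq_imI_vI A : (imI A == vI) = false.
Proof. by elim/chart_split: A => a; rewrite ?imI_z ?imI_zeta /vI ?eq_shift. Qed.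

Lemma chart_ind (P : 'I_d -> Prop) : (forall A, P (reI A)) -> (forall A, P (imI A)) ->
  P vI -> forall i, P i.
Proof.
move=> Pr Pi Pv i; rewrite -(splitK i); case: (fintype.split i) => [k|k] /=.
  rewrite -(splitK k); case: (fintype.split k) => j /=.
    by rewrite -reI_z.
  by rewrite -imI_z.
rewrite -(splitK k); case: (fintype.split k) => [l|l] /=; last first.
  by rewrite (ord1 l).
rewrite -(splitK l); case: (fintype.split l) => j /=.
  by rewrite -reI_zeta.
by rewrite -imI_zeta.
Qed.

(** The columns of [Dz], [Dzb], [Dv] are the forms dz_A, their conjugates and
    dv; the rows of [Ez], [Ezb], [Ev] are the dual vector fields. *)
Definition Pre : 'M[C]_(n, d) := \matrix_(A, i) (i == reI A)%:R.
Definition Pim : 'M[C]_(n, d) := \matrix_(A, i) (i == imI A)%:R.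
Definition Ev : 'M[C]_(1, d) := \matrix_(A, i) (i == vI)%:R.
Definition Dz : 'M[C]_(d, n) := Pre^T + ii *: Pim^T.
Definition Dzb : 'M[C]_(d, n) := Pre^T - ii *: Pim^T.
Definition Dv : 'M[C]_(d, 1) := Ev^T.
Definition Ez : 'M[C]_(n, d) := 2^-1 *: (Pre - ii *: Pim).
Definition Ezb : 'M[C]_(n, d) := 2^-1 *: (Pre + ii *: Pim).

Lemma ii2 : ii * ii = -1.
Proof. rewrite iCE; by apply/eqP; rewrite eq_complex /= !mul0r !mul1r addr0 sub0r oppr0 !eqxx. Qed.

Lemma conj_ii : ii^* = - ii.
Proof. rewrite iCE; by apply/eqP; rewrite eq_complex /= oppr0 !eqxx. Qed.

Lemma mul_delta_col (k p : nat) (A : 'M[C]_(k, p)) (q : nat) (f : 'I_q -> 'I_p) a b :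
  (A *m (\matrix_(B, i) (i == f B)%:R)^T) a b = A a (f b).
Proof.
rewrite mxE (bigD1 (f b))//= !mxE eqxx mulr1 big1 ?addr0// => i /negbTE ib.
by rewrite !mxE ib mulr0.
Qed.

Lemma mulPre k (A : 'M[C]_(k, d)) a b : (A *m Pre^T) a b = A a (reI b).
Proof. exact: mul_delta_col. Qed.
Lemma mulPim k (A : 'M[C]_(k, d)) a b : (A *m Pim^T) a b = A a (imI b).
Proof. exact: mul_delta_col. Qed.
Lemma mulDv k (A : 'M[C]_(k, d)) a b : (A *m Dv) a b = A a vI.
Proof. exact: (@mul_delta_col _ _ _ _ (fun=> vI)). Qed.

Lemma mulDz k (A : 'M[C]_(k, d)) a b : (A *m Dz) a b = A a (reI b) + ii * A a (imI b).
Proof. by rewrite mulmxDr -scalemxAr mxE mulPre [X in _ + X]mxE mulPim. Qed.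
Lemma mulDzb k (A : 'M[C]_(k, d)) a b : (A *m Dzb) a b = A a (reI b) - ii * A a (imI b).
Proof. by rewrite mulmxBr -scalemxAr mxE mulPre [X in _ + X]mxE [X in - X]mxE mulPim. Qed.

Lemma EzDz : Ez *m Dz = 1%:M.
Proof.
apply/matrixP => a b; rewrite mulDz !mxE eq_reI eq_imI eq_reI_imI eq_imI_reI.
rewrite !mulr0 subr0 add0r [b == a]eq_sym; move: (_%:R : C) => e.
rewrite [LHS](_ : _ = 2^-1 * e - 2^-1 * (ii * ii) * e); last by ring.
by rewrite ii2; field.
Qed.
Lemma EzDzb : Ez *m Dzb = 0.
Proof.
apply/matrixP => a b; rewrite mulDzb !mxE eq_reI eq_imI eq_reI_imI eq_imI_reI.
rewrite !mulr0 subr0 add0r [b == a]eq_sym; move: (_%:R : C) => e.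
rewrite [LHS](_ : _ = 2^-1 * e + 2^-1 * (ii * ii) * e); last by ring.
by rewrite ii2; ring.
Qed.
Lemma EzbDz : Ezb *m Dz = 0.
Proof.
apply/matrixP => a b; rewrite mulDz !mxE eq_reI eq_imI eq_reI_imI eq_imI_reI.
rewrite !mulr0 addr0 add0r [b == a]eq_sym; move: (_%:R : C) => e.
rewrite [LHS](_ : _ = 2^-1 * e + 2^-1 * (ii * ii) * e); last by ring.
by rewrite ii2; ring.
Qed.
Lemma EzbDzb : Ezb *m Dzb = 1%:M.
Proof.
apply/matrixP => a b; rewrite mulDzb !mxE eq_reI eq_imI eq_reI_imI eq_imI_reI.
rewrite !mulr0 addr0 add0r [b == a]eq_sym; move: (_%:R : C) => e.
rewrite [LHS](_ : _ = 2^-1 * e - 2^-1 * (ii * ii) * e); last by ring.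
by rewrite ii2; field.
Qed.
Lemma EzDv : Ez *m Dv = 0.
Proof.
by apply/matrixP => a b; rewrite mulDv !mxE ![vI == _]eq_sym eq_reI_vI eq_imI_vI mulr0 subr0 mulr0.
Qed.
Lemma EzbDv : Ezb *m Dv = 0.
Proof.
by apply/matrixP => a b; rewrite mulDv !mxE ![vI == _]eq_sym eq_reI_vI eq_imI_vI mulr0 addr0 mulr0.
Qed.
Lemma EvDv : Ev *m Dv = 1%:M.
Proof. by apply/matrixP => a b; rewrite mulDv !mxE eqxx !ord1 eqxx. Qed.
Lemma EvDz : Ev *m Dz = 0.
Proof. by apply/matrixP => a b; rewrite mulDz !mxE eq_reI_vI eq_imI_vI mulr0 addr0. Qed.
Lemma EvDzb : Ev *m Dzb = 0.
Proof. by apply/matrixP => a b; rewrite mulDzb !mxE eq_reI_vI eq_imI_vI mulr0 subr0. Qed.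

Lemma frame_decomp k (X : 'M[C]_(k, d)) :
  X = X *m Dz *m Ez + X *m Dzb *m Ezb + X *m Dv *m Ev.
Proof.
have add3 (A B D : 'M[C]_(k, d)) a i : (A + B + D) a i = A a i + B a i + D a i by rewrite !mxE.
have mulE p (A : 'M[C]_(k, p)) (B : 'M[C]_(p, d)) a i : (A *m B) a i = \sum_j A a j * B j i.
  by rewrite mxE.
have EzE A i : Ez A i = 2^-1 * ((i == reI A)%:R - ii * (i == imI A)%:R) by rewrite !mxE.
have EzbE A i : Ezb A i = 2^-1 * ((i == reI A)%:R + ii * (i == imI A)%:R) by rewrite !mxE.
apply/matrixP => a i; rewrite add3 !(mulE n) mulE.
under eq_bigr do rewrite mulDz EzE.
under [X in _ = _ + X + _]eq_bigr do rewrite mulDzb EzbE.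
rewrite big_ord1 mulDv [Ev _ _]mxE -big_split/=.
elim/chart_ind: i => [A|A|].
- rewrite eq_reI_vI mulr0 addr0 (bigD1 A)//= big1 => [|B BA].
    by rewrite !eq_reI_imI !eqxx !mulr0 !subr0 !addr0 !mulr1; move: (X a (reI A)) (ii * X a (imI A)) => x y; field.
  by rewrite eq_reI eq_reI_imI eq_sym (negbTE BA) !(mulr0, subr0, addr0).
- rewrite eq_imI_vI mulr0 addr0 (bigD1 A)//= big1 => [|B BA].
    rewrite !eq_imI_reI !eqxx !addr0 !mulr1 !add0r; move: (X a (reI A)) (X a (imI A)) => y x.
    rewrite [RHS](_ : _ = - (ii * ii) * x); last by field.
    by rewrite ii2 opprK mul1r.
  by rewrite eq_imI eq_imI_reI eq_sym (negbTE BA) !(mulr0, subr0, addr0).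
- rewrite eqxx mulr1 big1 ?add0r// => B _.
  by rewrite ![vI == _]eq_sym eq_reI_vI eq_imI_vI !(mulr0, subr0, addr0).
Qed.

Lemma frame_ext k (X Y : 'M[C]_(k, d)) : X *m Dz = Y *m Dz -> X *m Dzb = Y *m Dzb ->
  X *m Dv = Y *m Dv -> X = Y.
Proof. by move=> e1 e2 e3; rewrite (frame_decomp X) (frame_decomp Y) e1 e2 e3. Qed.

Lemma conj_nat k : ((k%:R : C)^*) = k%:R.
Proof. exact: rmorph_nat. Qed.

Lemma conj_Ez : map_mx (@conjc R) Ez = Ezb.
Proof.
apply/matrixP => a b; rewrite !mxE rmorphM fmorphV rmorph_nat rmorphB rmorphM/=.
by rewrite !conj_nat conj_ii mulNr opprK.
Qed.
Lemma conj_Ezb : map_mx (@conjc R) Ezb = Ez.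
Proof.
apply/matrixP => a b; rewrite !mxE rmorphM fmorphV rmorph_nat rmorphD rmorphM/=.
by rewrite !conj_nat conj_ii mulNr.
Qed.
Lemma conj_Ev : map_mx (@conjc R) Ev = Ev.
Proof. by apply/matrixP => a b; rewrite !mxE rmorph_nat. Qed.
Lemma conj_Dz : map_mx (@conjc R) Dz = Dzb.
Proof.
by apply/matrixP => a b; rewrite !mxE rmorphD rmorphM/= !conj_nat conj_ii mulNr.
Qed.
Lemma conj_Dzb : map_mx (@conjc R) Dzb = Dz.
Proof.
by apply/matrixP => a b; rewrite !mxE rmorphB rmorphM/= !conj_nat conj_ii mulNr opprK.
Qed.
Lemma conj_Dv : map_mx (@conjc R) Dv = Dv.
Proof. by apply/matrixP => a b; rewrite !mxE rmorph_nat. Qed.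

Lemma conjv_mul k l (v : 'rV[C]_k) (A : 'M[C]_(k, l)) :
  conjv (v *m A) = conjv v *m map_mx (@conjc R) A.
Proof. by rewrite /conjv map_mxM. Qed.

Lemma conjvK k (v : 'rV[C]_k) : conjv (conjv v) = v.
Proof. by apply/rowP => i; rewrite !mxE conjcK. Qed.
End chart.

Section graph.
Variables (R : realType) (s m : nat).
Local Notation C := R[i].
Local Notation d := (chart_dim s m).
Local Notation n := (s + m)%N.
Local Notation ii := (iC R).
Local Notation Ez := (Ez R s m).
Local Notation Ezb := (Ezb R s m).
Local Notation Ev := (Ev R s m).
Local Notation Dz := (Dz R s m).
Local Notation Dzb := (Dzb R s m).
Local Notation Dv := (Dv R s m).
Variable F : 'rV[R]_d -> R.

Definition grad (f : 'rV[R]_d -> C) (x : 'rV[R]_d) : 'cV[C]_d := \col_i cpd i f x.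

Lemma dfun_grad f x (X : 'rV[C]_d) : dfun f x X = (X *m grad f x) 0 0.
Proof. by rewrite dfunE mxE; apply: eq_bigr => i _; rewrite mxE. Qed.

(** [kap] is the inverse of i - F_v and [mu] the slope of the (1,0)-frame
    L_A = d_A + mu_A d_v. *)
Definition kap (x : 'rV[R]_d) : C := (ii - (pd (vI s m) F x)%:C)^-1.
Definition dF (x : 'rV[R]_d) : 'rV[C]_n := (Ez *m grad (fun y => (F y)%:C) x)^T.
Definition mu (x : 'rV[R]_d) : 'rV[C]_n := kap x *: dF x.
(** The rows of [Lx] are the L_A, and [theta] is the real form annihilating
    them and their conjugates. *)
Definition Lx (x : 'rV[R]_d) : 'M[C]_(n, d) := Ez + (mu x)^T *m Ev.
Definition theta (x : 'rV[R]_d) : 'cV[C]_d :=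
  Dv - Dz *m (mu x)^T - Dzb *m (conjv (mu x))^T.

Lemma kap_neq0 x : ii - (pd (vI s m) F x)%:C != 0.
Proof. by rewrite iCE eq_complex /= subr0 oner_eq0 andbF. Qed.

Lemma sum_mul_delta (K : comNzRingType) (q : nat) (G : 'I_q -> K) i :
  \sum_j G j * (i == j)%:R = G i.
Proof.
rewrite (bigD1 i)//= eqxx mulr1 big1 ?addr0// => j ji.
by rewrite eq_sym (negbTE ji) mulr0.
Qed.

Lemma dfun_coord_conj (i k : 'I_d) x X :
  dfun (fun y : 'rV[R]_d => (y 0 i +i* y 0 k)^*) x X = X 0 i - ii * X 0 k.
Proof.
rewrite dfunE.
have E j : cpd j (fun y : 'rV[R]_d => (y 0 i +i* y 0 k)^*) x = (i == j)%:R - ii * (k == j)%:R.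
  rewrite /cpd /= pd_coord pdN ?pd_coord; last exact: differentiable_coord.
  rewrite iCE; case: (i == j); case: (k == j); rewrite /= ?mulr1n ?mulr0n;
    apply/eqP; rewrite eq_complex /=;
    by rewrite !(mulr0, mul0r, mulr1, subr0, addr0, oppr0, sub0r, add0r) !eqxx.
under eq_bigr do rewrite E mulrBr mulrCA.
by rewrite sumrB -mulr_sumr !sum_mul_delta.
Qed.

Lemma kap_eq x (a b : C) : a = kap x * b <-> a * (ii - (pd (vI s m) F x)%:C) = b.
Proof.
rewrite /kap; split=> [->|<-]; first by rewrite mulrAC mulVf ?kap_neq0// mul1r.
by rewrite mulrC mulfK ?kap_neq0.
Qed.

Lemma conj_grad x : map_mx (@conjc R) (grad (fun y => (F y)%:C) x) = grad (fun y => (F y)%:C) x.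
Proof. by apply/matrixP => i j; rewrite !mxE /cpd /= pd_cst oppr0. Qed.

Lemma dfun_F x (X : 'rV[C]_d) : dfun (fun y => (F y)%:C) x X =
  (X *m Dz *m (dF x)^T + X *m Dzb *m (conjv (dF x))^T) 0 0 + X 0 (vI s m) * (pd (vI s m) F x)%:C.
Proof.
set g := grad (fun y => (F y)%:C) x.
have E : X *m g = X *m Dz *m (dF x)^T + X *m Dzb *m (conjv (dF x))^T + X *m Dv *m (Ev *m g).
  refine (etrans (congr1 (fun Y => Y *m g) (frame_decomp X)) _).
  rewrite !mulmxDl -!(mulmxA _ _ g) /dF trmxK; congr (_ + _ *m _ + _).
  by rewrite /conjv -map_trmx trmxK map_mxM conj_Ez conj_grad.
have Eg : (Ev *m g) 0 0 = (pd (vI s m) F x)%:C.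
  rewrite mxE (bigD1 (vI s m))//= !mxE eqxx mul1r big1 => [|i iv].
    by rewrite addr0 /cpd /= pd_cst.
  by rewrite mxE (negbTE iv) mul0r.
rewrite dfun_grad E mxE; congr (_ + _).
by rewrite mxE big_ord1 mulDv Eg.
Qed.

Lemma graph_CRE x X : graph_CR F x X <-> X *m Dzb = 0 /\ X *m Dv = X *m Dz *m (mu x)^T.
Proof.
have co A : dfun (fun y : 'rV[R]_d => (y 0 (reI A) +i* y 0 (imI A))^*) x X = (X *m Dzb) 0 A.
  by rewrite dfun_coord_conj mulDzb.
have cz j : dfun (fun y : 'rV[R]_d => (zco y 0 j)^*) x X = (X *m Dzb) 0 (lshift m j).
  rewrite -co reI_z imI_z; have -> // : (fun y : 'rV[R]_d => (zco y 0 j)^*) =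
    (fun y => (y 0 (lshift _ (lshift s j)) +i* y 0 (lshift _ (rshift s j)))^*).
  by apply/funext => y; rewrite !mxE.
have cze al : dfun (fun y : 'rV[R]_d => (zetaco y 0 al)^*) x X = (X *m Dzb) 0 (rshift s al).
  rewrite -co reI_zeta imI_zeta; have -> // : (fun y : 'rV[R]_d => (zetaco y 0 al)^*) =
    (fun y => (y 0 (rshift (s + s) (lshift 1 (lshift m al))) +i*
               y 0 (rshift (s + s) (lshift 1 (rshift m al))))^*).
  by apply/funext => y; rewrite !mxE.
have cw : dfun (fun y => (F y +i* vco y)^*) x X =
    dfun (fun y => (F y)%:C) x X - ii * X 0 (vI s m).
  rewrite !dfunE -(sum_mul_delta (fun j => X 0 j) (vI s m)) mulr_sumr -sumrB.
  apply: eq_bigr => j _; rewrite mulrCA -mulrBr; congr (_ * _).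
  rewrite /cpd /= pd_cst; set a := pd j F x.
  have -> : (fun y : 'rV[R]_d => - vco y) = (fun y => - y 0 (vI s m)).
    by apply/funext => y; rewrite /vco !mxE.
  rewrite pdN ?pd_coord; last exact: differentiable_coord.
  rewrite iCE; case: (_ == j); rewrite /= ?mulr1n ?mulr0n;
    apply/eqP; rewrite eq_complex /=;
    by rewrite !(mulr0, mul0r, mulr1, subr0, addr0, oppr0, sub0r, add0r) !eqxx.
rewrite /graph_CR /=.
have eqv : X *m Dzb = 0 -> (dfun (fun y => (F y +i* vco y)^*) x X = 0 <->
    X *m Dv = X *m Dz *m (mu x)^T).
  move=> X0; rewrite cw dfun_F X0 mul0mx addr0 /mu.
  have -> : (X *m Dv = X *m Dz *m (kap x *: dF x)^T) <->
      (X 0 (vI s m) = kap x * (X *m Dz *m (dF x)^T) 0 0).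
    rewrite linearZ/= -scalemxAr; split=> [/matrixP/(_ 0 0)|E].
      by rewrite mulDv mxE.
    by apply/matrixP => a b; rewrite !ord1 mulDv E [RHS]mxE.
  rewrite kap_eq mulrBr; set c := _%:C; set e := (_ *m _) 0 0; set v := X 0 _.
  split => [E|<-]; last by ring.
  by rewrite -[RHS]subr0 -E; ring.
split=> [[hz hze hw]|[h0 hv]].
  have X0 : X *m Dzb = 0.
    by apply/rowP => A; rewrite [RHS]mxE; elim/chart_split: A => a; [rewrite -cz|rewrite -cze].
  by split=> //; exact: (eqv X0).1.
split=> [j|al|]; [by rewrite cz h0 mxE|by rewrite cze h0 mxE|exact: (eqv h0).2].
Qed.

Lemma bar_graph_CRE x X : bar (graph_CR F) x X <->
  X *m Dz = 0 /\ X *m Dv = X *m Dzb *m (conjv (mu x))^T.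
Proof.
rewrite /bar /conjset /= graph_CRE.
have e1 : conjv X *m Dzb = conjv (X *m Dz) by rewrite conjv_mul conj_Dz.
have e2 : conjv X *m Dv = conjv (X *m Dv) by rewrite conjv_mul conj_Dv.
have e3 : conjv X *m Dz *m (mu x)^T = conjv (X *m Dzb *m (conjv (mu x))^T).
  rewrite !conjv_mul conj_Dzb -map_trmx.
  by have := conjvK (mu x); rewrite /conjv => ->.
rewrite e1 e2 e3; split=> [[h1 h2]|[-> ->]].
  by split; apply: (can_inj (@conjvK _ _)) => //; rewrite h1 /conjv map_mx0.
by rewrite /conjv map_mx0.
Qed.

Lemma LxDz x : Lx x *m Dz = 1%:M.
Proof. by rewrite mulmxDl EzDz -mulmxA EvDz mulmx0 addr0. Qed.
Lemma LxDzb x : Lx x *m Dzb = 0.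
Proof. by rewrite mulmxDl EzDzb -mulmxA EvDzb mulmx0 addr0. Qed.
Lemma LxDv x : Lx x *m Dv = (mu x)^T.
Proof. by rewrite mulmxDl EzDv -mulmxA EvDv mulmx1 add0r. Qed.

Lemma graph_CR_Lx x xi : graph_CR F x (xi *m Lx x).
Proof.
by apply/graph_CRE; rewrite -[xi *m _ *m Dz]mulmxA -!mulmxA LxDzb LxDv !mulmxA -[xi *m _ *m Dz]mulmxA LxDz mulmx1 mulmx0.
Qed.

Lemma graph_CR_eqLx x X : graph_CR F x X -> X = X *m Dz *m Lx x.
Proof.
move=> /graph_CRE[h1 h2]; apply: frame_ext; rewrite -[RHS]mulmxA.
- by rewrite LxDz mulmx1.
- by rewrite LxDzb mulmx0.
- by rewrite LxDv.
Qed.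

(** The difference of X and the (1,0)-vector with the same z- and
    zeta-components is the (0,1)-part. *)
Lemma oplusE x X : oplus (graph_CR F) (bar (graph_CR F)) x X <-> X *m theta x = 0.
Proof.
rewrite /theta !mulmxBr !mulmxA; split.
  move=> [a [b [/graph_CRE[a1 a2] /bar_graph_CRE[b1 b2] ->]]].
  rewrite !mulmxDl a1 b1 a2 b2 !mul0mx addr0 add0r.
  by rewrite addrAC addrK subrr.
move=> /eqP; rewrite subr_eq0 => /eqP E.
exists (X *m Dz *m Lx x), (X - X *m Dz *m Lx x); split; last by rewrite addrC subrK.
  exact: graph_CR_Lx.
apply/bar_graph_CRE; set b := X - _.
have bDz : b *m Dz = 0 by rewrite mulmxBl -(mulmxA (X *m Dz)) LxDz mulmx1 subrr.
have bDzb : b *m Dzb = X *m Dzb.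
  by rewrite mulmxBl -(mulmxA (X *m Dz)) LxDzb mulmx0 subr0.
have bDv : b *m Dv = X *m Dv - X *m Dz *m (mu x)^T.
  by rewrite mulmxBl -(mulmxA (X *m Dz)) LxDv.
by rewrite bDz bDzb bDv E.
Qed.

Lemma thetaE x (Z : 'rV[C]_d) : (Z *m theta x) 0 0 = (Z *m Dv) 0 0
  - \sum_A (Z *m Dz) 0 A * mu x 0 A - \sum_A (Z *m Dzb) 0 A * (mu x 0 A)^*.
Proof.
have -> : \sum_A (Z *m Dz) 0 A * mu x 0 A = (Z *m Dz *m (mu x)^T) 0 0.
  by rewrite [RHS]mxE; apply: eq_bigr => A _; congr (_ * _); rewrite [RHS]mxE.
have -> : \sum_A (Z *m Dzb) 0 A * (mu x 0 A)^* = (Z *m Dzb *m (conjv (mu x))^T) 0 0.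
  rewrite [RHS]mxE; apply: eq_bigr => A _; congr (_ * _).
  by rewrite [RHS]mxE [RHS]mxE.
rewrite (_ : Z *m theta x = Z *m Dv - Z *m Dz *m (mu x)^T - Z *m Dzb *m (conjv (mu x))^T).
  by move: (Z *m Dv) (_ *m (mu x)^T) (_ *m (conjv _)^T) => a b c; rewrite !mxE.
by rewrite /theta mulmxBr mulmxBr !mulmxA.
Qed.

Lemma theta_H x X : graph_CR F x X -> X *m theta x = 0.
Proof.
move=> HX; apply/oplusE; exists X, 0; split=> //; last by rewrite addr0.
by apply/bar_graph_CRE; rewrite !mul0mx.
Qed.

Lemma EvTheta x : Ev *m theta x = 1%:M.
Proof. by rewrite /theta !mulmxBr !mulmxA EvDv EvDz EvDzb !mul0mx !subr0. Qed.

Lemma lie_mul k (D : 'M[C]_(d, k)) (X Y : vfield R d) q B :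
  (forall j, cdiff (fun y => X y 0 j) q) -> (forall j, cdiff (fun y => Y y 0 j) q) ->
  (lie X Y q *m D) 0 B = dfun (fun y => (Y y *m D) 0 B) q (X q)
                       - dfun (fun y => (X y *m D) 0 B) q (Y q).
Proof.
move=> dX dY.
have E (Z : vfield R d) (V : 'rV[C]_d) : (forall j, cdiff (fun y => Z y 0 j) q) ->
    dfun (fun y => (Z y *m D) 0 B) q V = \sum_j dfun (fun y => Z y 0 j) q V * D j B.
  move=> dZ; rewrite (_ : (fun y => _) = (fun y => \sum_j D j B * Z y 0 j)); last first.
    by apply/funext => y; rewrite mxE; apply: eq_bigr => j _; exact: mulrC.
  rewrite dfun_sum => [|j]; last by apply: cdiffM; [exact: cdiff_cst|exact: dZ].
  apply: eq_bigr => j _; rewrite dfunM; [|exact: cdiff_cst|exact: dZ].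
  by rewrite dfun_cst mulr0 addr0 mulrC.
rewrite !E// -sumrB mxE; apply: eq_bigr => j _.
by rewrite mxE mulrBl.
Qed.

Variable q : 'rV[R]_d.
Hypothesis sF : smooth_near q F.

Lemma csm_kap : csm q kap.
Proof.
apply: csm_inv; last exact: kap_neq0.
apply: csm_sub; first exact: csm_cst.
by apply: csm_real; exact: smooth_near_pd.
Qed.

Lemma csm_dF : csmooth_near q dF.
Proof.
move=> a b; apply: (@csm_ext _ _ _ (fun x => \sum_i Ez b i * cpd i (fun y => (F y)%:C) x)).
  by apply: filterE => x; rewrite !mxE; apply: eq_bigr => i _; rewrite !mxE.
apply: csm_sum => i; apply: csm_mul; first exact: csm_cst.
by apply: csm_cpd; exact: csm_real.
Qed.

Lemma csm_mu : csmooth_near q mu.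
Proof.
move=> a b; apply: (@csm_ext _ _ _ (fun x => kap x * dF x a b)).
  by apply: filterE => x; rewrite [RHS]mxE.
by apply: csm_mul; [exact: csm_kap|exact: csm_dF].
Qed.

Lemma csm_Lx : csmooth_near q Lx.
Proof.
move=> a b; apply: (@csm_ext _ _ _ (fun x => Ez a b + mu x 0 a * Ev 0 b)).
  apply: filterE => x; rewrite [RHS]mxE; congr (_ + _).
  by rewrite [RHS]mxE big_ord1; congr (_ * _); rewrite [RHS]mxE.
apply: csm_add; first exact: csm_cst.
by apply: csm_mul; [exact: csm_mu|exact: csm_cst].
Qed.

(** The Levi form in the frame L_A: theta([L_A, conj L_B]). *)
Definition lev (x : 'rV[R]_d) : 'M[C]_n :=
  \matrix_(A, B) (dfun (fun y => (mu y 0 B)^*) x (row A (Lx x))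
                  - dfun (fun y => mu y 0 A) x (conjv (row B (Lx x)))).

Lemma csm_lev : csmooth_near q lev.
Proof.
move=> a b; apply: (@csm_ext _ _ _ (fun x => dfun (fun y => (mu y 0 b)^*) x (row a (Lx x))
    - dfun (fun y => mu y 0 a) x (conjv (row b (Lx x))))).
  by apply: filterE => x; rewrite [RHS]mxE.
apply: csm_sub; apply: csm_dfun.
- by apply: csm_conj; exact: csm_mu.
- by move=> j; apply: csm_ext (csm_Lx a j); apply: filterE => x; rewrite [RHS]mxE.
- exact: csm_mu.
- move=> j; apply: csm_ext (csm_conj (csm_Lx b j)).
  by apply: filterE => x; rewrite [RHS]mxE [in RHS]mxE.
Qed.

Lemma csm_mulc k (X : vfield R d) (D : 'M[C]_(d, k)) B : csmooth_near q X ->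
  csm q (fun y => (X y *m D) 0 B).
Proof. by move=> sX; apply: csm_mulmx => // i j; exact: csm_cst. Qed.

Lemma dfun_mulmx k f x (xi : 'rV[C]_k) (A : 'M[C]_(k, d)) :
  dfun f x (xi *m A) = \sum_B xi 0 B * dfun f x (row B A).
Proof.
rewrite dfun_grad -mulmxA mxE; apply: eq_bigr => B _; congr (_ * _).
by rewrite dfun_grad -row_mul [RHS]mxE.
Qed.

Lemma bar_graph_CR_eqLx x X : bar (graph_CR F) x X ->
  X = X *m Dzb *m map_mx (@conjc R) (Lx x).
Proof.
move=> h; have := graph_CR_eqLx (h : graph_CR F x (conjv X)) => E.
by rewrite -{1}[X]conjvK E conjv_mul conjv_mul conjvK conj_Dz.
Qed.

Lemma theta_lie_algebra (k : nat) (e f b g x u v w : 'I_k -> C) :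
  \sum_A (e A * f A + b A * g A) - \sum_A (x A * u A + v A * w A)
    - \sum_A - (w A * v A) - \sum_A g A * b A = \sum_A e A * f A - \sum_A x A * u A.
Proof. by rewrite -!sumrB; apply: eq_bigr => A _; ring. Qed.

(** The derivatives of the components of X and Y cancel, because theta kills
    both fields, and the derivatives of the slopes remain. *)
Lemma theta_lie X Y : section (graph_CR F) q X -> section (bar (graph_CR F)) q Y ->
  lie X Y q *m theta q = (X q *m Dz) *m lev q *m (Y q *m Dzb)^T.
Proof.
move=> [sX HX] [sY HY].
have dX j : cdiff (fun y => X y 0 j) q by exact: csm_diff (sX 0 j).
have dY j : cdiff (fun y => Y y 0 j) q by exact: csm_diff (sY 0 j).
have EX : X q = X q *m Dz *m Lx q by apply: graph_CR_eqLx; exact: nbhs_singleton HX.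
have EY : Y q = Y q *m Dzb *m map_mx (@conjc R) (Lx q).
  by apply: bar_graph_CR_eqLx; exact: nbhs_singleton HY.
have cm A : cdiff (fun y => mu y 0 A) q by exact: csm_diff (csm_mu 0 A).
have cmb A : cdiff (fun y => (mu y 0 A)^*) q by exact: cdiff_conj.
have cX A : cdiff (fun y => (X y *m Dz) 0 A) q by exact: csm_diff (csm_mulc _ _ sX).
have cY A : cdiff (fun y => (Y y *m Dzb) 0 A) q by exact: csm_diff (csm_mulc _ _ sY).
have XvE V : dfun (fun y => (X y *m Dv) 0 0) q V = \sum_A ((X q *m Dz) 0 A * dfun (fun y => mu y 0 A) q V
    + mu q 0 A * dfun (fun y => (X y *m Dz) 0 A) q V).
  rewrite (@dfun_near _ _ _ (fun y => \sum_A (X y *m Dz) 0 A * mu y 0 A)); last first.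
    apply: filterS HX => y /graph_CRE[_ ->]; rewrite mxE; apply: eq_bigr => A _.
    by rewrite [_^T _ _]mxE.
  rewrite dfun_sum => [|A]; last exact: cdiffM.
  by apply: eq_bigr => A _; rewrite dfunM.
have YvE V : dfun (fun y => (Y y *m Dv) 0 0) q V = \sum_A ((Y q *m Dzb) 0 A * dfun (fun y => (mu y 0 A)^*) q V
    + (mu q 0 A)^* * dfun (fun y => (Y y *m Dzb) 0 A) q V).
  rewrite (@dfun_near _ _ _ (fun y => \sum_A (Y y *m Dzb) 0 A * (mu y 0 A)^*)); last first.
    apply: filterS HY => y /bar_graph_CRE[_ ->]; rewrite mxE; apply: eq_bigr => A _.
    by rewrite [_^T _ _]mxE [conjv _ _ _]mxE.
  rewrite dfun_sum => [|A]; last exact: (cdiffM (cY A) (cmb A)).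
  by apply: eq_bigr => A _; rewrite dfunM; [|exact: cY|exact: cmb].
have X0 A V : dfun (fun y => (X y *m Dzb) 0 A) q V = 0.
  rewrite (@dfun_near _ _ _ (fun=> 0)) ?dfun_cst//.
  by apply: filterS HX => y /graph_CRE[-> _]; rewrite mxE.
have Y0 A V : dfun (fun y => (Y y *m Dz) 0 A) q V = 0.
  rewrite (@dfun_near _ _ _ (fun=> 0)) ?dfun_cst//.
  by apply: filterS HY => y /bar_graph_CRE[-> _]; rewrite mxE.
apply/matrixP => a b; rewrite !ord1 thetaE lie_mul// XvE YvE.
under [X in _ - X - _]eq_bigr do rewrite lie_mul// Y0 sub0r mulNr.
under [X in _ - _ - X]eq_bigr do rewrite lie_mul// X0 subr0.
rewrite theta_lie_algebra.
under [X in X - _]eq_bigr do rewrite [X in dfun _ _ X]EX dfun_mulmx mulr_sumr.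
under [X in _ - X]eq_bigr do rewrite [X in dfun _ _ X]EY dfun_mulmx mulr_sumr.
rewrite [X in X - _]exchange_big.
have -> : (X q *m Dz *m lev q *m (Y q *m Dzb)^T) 0 0 =
    \sum_A \sum_B (X q *m Dz) 0 A * lev q A B * (Y q *m Dzb) 0 B.
  move: (X q *m Dz) (Y q *m Dzb) => x y; rewrite mxE exchange_big/=.
  by apply: eq_bigr => B _; rewrite mxE mulr_suml; apply: eq_bigr => A _; rewrite [y^T _ _]mxE.
rewrite -sumrB; apply: eq_bigr => A _; rewrite -sumrB; apply: eq_bigr => B _.
rewrite [lev q A B]mxE -map_row.
by move: (dfun _ _ _) (dfun _ _ _) ((X q *m Dz) 0 A) ((Y q *m Dzb) 0 B) => u v x y; ring.
Qed.

End graph.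

(** * The Levi kernel and the second Levi form *)

Section kernel_algebra.
Variables (K : fieldType) (s m : nat).
Implicit Types (M : 'M[K]_(s + m)).

Definition acoef M : 'M[K]_(m, s) := - dlsubmx M *m invmx (ulsubmx M).
(** Block elimination by the upper left block: when it is invertible, the row
    kernel of M is the image under [kerb M] of the row kernel of the Schur
    complement. *)
Definition schur M : 'M[K]_m := acoef M *m ursubmx M + drsubmx M.
Definition kerb M : 'M[K]_(m, s + m) := row_mx (acoef M) 1%:M.

Lemma kerb_mul M : ulsubmx M \in unitmx -> kerb M *m M = row_mx 0 (schur M).
Proof.
move=> uM; rewrite -[X in _ *m X]submxK mul_row_block !mul1mx; congr row_mx.
by rewrite /acoef -mulmxA mulVmx// mulmx1 addNr.
Qed.

Lemma ker_block M (x : 'rV[K]_(s + m)) : ulsubmx M \in unitmx ->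
  x *m M = 0 <-> x = rsubmx x *m kerb M /\ rsubmx x *m schur M = 0.
Proof.
move=> uM; split=> [xM|[xE xS]]; last first.
  by rewrite xE -mulmxA kerb_mul// mul_mx_row mulmx0 xS row_mx0.
have xl : lsubmx x = rsubmx x *m acoef M.
  have := xM; rewrite -[in X in X -> _](hsubmxK x) -[X in _ *m X = _]submxK mul_row_block.
  move=> /(congr1 lsubmx); rewrite row_mxKl linear0 => E.
  rewrite /acoef mulmxA mulmxN -(mulmxK uM (lsubmx x)); congr (_ *m _).
  by apply/eqP; rewrite -subr_eq0 opprK E.
have xE : x = rsubmx x *m kerb M.
  by rewrite /kerb mul_mx_row mulmx1 -xl hsubmxK.
split=> //; move: xM; rewrite {1}xE -mulmxA kerb_mul// mul_mx_row mulmx0.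
by move=> /(congr1 rsubmx); rewrite row_mxKr linear0.
Qed.
End kernel_algebra.

Section graph_kernel.
Variables (R : realType) (s m : nat).
Local Notation C := R[i].
Local Notation d := (chart_dim s m).
Local Notation n := (s + m)%N.
Local Notation ii := (iC R).
Local Notation Ez := (Ez R s m).
Local Notation Ezb := (Ezb R s m).
Local Notation Ev := (Ev R s m).
Local Notation Dz := (Dz R s m).
Local Notation Dzb := (Dzb R s m).
Local Notation Dv := (Dv R s m).
Variable F : 'rV[R]_d -> R.
Local Notation H := (graph_CR F).
Local Notation lev := (lev F).
Local Notation Lx := (Lx F).
Variable q : 'rV[R]_d.
Hypothesis sF : smooth_near q F.

Lemma near_smooth : \forall y \near q, smooth_near y F.
Proof. exact: smooth_near_near. Qed.

Lemma csm_mulcl k l (A : 'M[C]_(k, l)) j (B : 'rV[R]_d -> 'M[C]_(l, j)) :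
  csmooth_near q B -> csmooth_near q (fun y => A *m B y).
Proof. by move=> sB a b; apply: csm_mulmx => // i i'; exact: csm_cst. Qed.

Lemma csm_conj_mx k l (B : 'rV[R]_d -> 'M[C]_(k, l)) :
  csmooth_near q B -> csmooth_near q (fun y => map_mx (@conjc R) (B y)).
Proof.
move=> sB a b; apply: csm_ext (csm_conj (sB a b)).
by apply: filterE => x; rewrite [RHS]mxE.
Qed.

Lemma section_Lx (xi : 'rV[C]_n) : section H q (fun y => xi *m Lx y).
Proof.
split; first by apply: csm_mulcl; exact: csm_Lx.
by apply: filterE => y; exact: graph_CR_Lx.
Qed.

Lemma bar_conj (D : distribution R d) y X : D y X -> bar D y (conjv X).
Proof. by rewrite /bar /conjset /= conjvK. Qed.

Lemma section_conj (D : distribution R d) X : section D q X ->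
  section (bar D) q (fun y => conjv (X y)).
Proof.
move=> [sX DX]; split; first exact: csm_conj_mx.
by apply: filterS DX => y; exact: bar_conj.
Qed.

Lemma section_Lxb (eta : 'rV[C]_n) :
  section (bar H) q (fun y => eta *m map_mx (@conjc R) (Lx y)).
Proof.
have := section_conj (section_Lx (conjv eta)).
rewrite (_ : (fun y => conjv (conjv eta *m Lx y)) = (fun y => eta *m map_mx (@conjc R) (Lx y))) //.
by apply/funext => y; rewrite conjv_mul conjvK.
Qed.

Lemma conjv_Dzb (y : 'rV[C]_d) : conjv y *m Dzb = conjv (y *m Dz).
Proof. by rewrite conjv_mul conj_Dz. Qed.
Lemma conjv_Dz (y : 'rV[C]_d) : conjv y *m Dz = conjv (y *m Dzb).
Proof. by rewrite conjv_mul conj_Dzb. Qed.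

Lemma levi0E x y : H q x -> H q y ->
  levi H q x y 0 <-> x *m Dz *m lev q *m (conjv (y *m Dz))^T = 0.
Proof.
move=> Hx Hy; set c : C := (2%:R * (0 +i* 1))^-1.
have c0 : c != 0.
  rewrite invr_neq0// mulf_neq0// ?pnatr_eq0// eq_complex /= oner_eq0 andbF//.
have opE (Z : 'rV[C]_d) : oplus H (bar H) q (0 - c *: Z) <-> Z *m theta F q = 0.
  rewrite oplusE sub0r mulNmx -scalemxAl; split=> [/eqP|->]; last by rewrite scaler0 oppr0.
  by rewrite oppr_eq0 scaler_eq0 (negbTE c0)/= => /eqP.
split=> [[X [Y [sX sY Xq Yq]]]|E].
  by rewrite -/c opE (theta_lie sF sX (section_conj sY)) Xq Yq conjv_Dzb.
exists (fun z => x *m Dz *m Lx z), (fun z => y *m Dz *m Lx z).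
have sX := section_Lx (x *m Dz); have sY := section_Lx (y *m Dz).
split=> //; [by rewrite -graph_CR_eqLx|by rewrite -graph_CR_eqLx|].
rewrite -/c opE (theta_lie sF sX (section_conj sY)) -(graph_CR_eqLx Hx) -(graph_CR_eqLx Hy).
by rewrite conjv_Dzb.
Qed.

(** Evaluated against all L_B the Levi form gives the entries of a row, so its
    kernel is the row kernel of the Levi matrix. *)
Lemma K2E X : K2 H q X <-> H q X /\ X *m Dz *m lev q = 0.
Proof.
split=> [[HX KX]|[HX XE]]; split=> //; last first.
  by move=> w Hw; apply/levi0E => //; rewrite XE mul0mx.
apply/rowP => A; have Hy := graph_CR_Lx F q (delta_mx 0 A).
have /(levi0E HX Hy) := KX _ Hy.
rewrite -(mulmxA (delta_mx 0 A)) LxDz mulmx1 => /matrixP/(_ 0 0).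
have -> : (conjv (delta_mx 0 A : 'rV[C]_n))^T = delta_mx A 0.
  by rewrite /conjv map_delta_mx trmx_delta.
by rewrite -colE [LHS]mxE => ->; rewrite !mxE.
Qed.

(** When the Schur complement of the Levi matrix vanishes, the rows of [Lam]
    form a frame of K2, normalized by its zeta-components. *)
Definition Lam (x : 'rV[R]_d) : 'M[C]_(m, d) := kerb (lev x) *m Lx x.

(** The Levi form has rank s, and its zz-block is nondegenerate. *)
Definition good (x : 'rV[R]_d) := ulsubmx (lev x) \in unitmx /\ schur (lev x) = 0.

Lemma LamDz x : Lam x *m Dz = kerb (lev x).
Proof. by rewrite -mulmxA LxDz mulmx1. Qed.

Lemma K2_Lam X : good q -> K2 H q X <-> exists b, X = b *m Lam q.
Proof.
move=> [uq Sq]; rewrite K2E; split=> [[HX]|[b ->]].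
  move=> /(ker_block _ uq)[E _]; exists (rsubmx (X *m Dz)).
  by rewrite mulmxA -E -graph_CR_eqLx.
rewrite mulmxA; split; first exact: graph_CR_Lx.
by rewrite -!mulmxA (mulmxA (Lx q)) LxDz mul1mx kerb_mul// Sq row_mx0 mulmx0.
Qed.

Lemma Lam_free x : row_free (Lam x).
Proof.
apply/row_freeP; exists (Dz *m col_mx 0 1%:M).
by rewrite mulmxA LamDz mul_row_col mulmx0 add0r mulmx1.
Qed.

Lemma good_dim : good q -> has_dim (K2 H q) m.
Proof.
move=> gq; exists (Lam q); split; first exact: Lam_free.
move=> v; rewrite K2_Lam//; split=> [[b ->]|/submxP[b ->]]; first exact: submxMl.
by exists b.
Qed.

(** The projection to the zeta-components is injective on the kernel of the
    Levi matrix and maps it into the kernel of the Schur complement; by dimension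
    this kernel is everything. *)
Lemma dim_schur : ulsubmx (lev q) \in unitmx -> has_dim (K2 H q) m ->
  schur (lev q) = 0.
Proof.
move=> uq [B [fB BE]].
pose P : 'M[C]_(d, m) := Dz *m col_mx 0 1%:M.
have XP (X : 'rV[C]_d) : X *m P = rsubmx (X *m Dz).
  by rewrite mulmxA -[X in X *m col_mx _ _]hsubmxK mul_row_col mulmx0 add0r mulmx1.
have KE (X : 'rV[C]_d) : K2 H q X -> X *m Dz = X *m P *m kerb (lev q) /\ X *m P *m schur (lev q) = 0.
  by rewrite XP => /K2E[_ /(ker_block _ uq)].
have BPf : row_free (B *m P).
  apply: inj_row_free => v; rewrite mulmxA => vBP.
  have Kv : K2 H q (v *m B) by apply/BE; exact: submxMl.
  have [E _] := KE _ Kv; rewrite vBP mul0mx in E.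
  have := Kv => /K2E[/graph_CR_eqLx]; rewrite E mul0mx => vB _.
  by apply: (row_free_inj fB); rewrite vB mul0mx.
have uBP : B *m P \in unitmx by rewrite -row_free_unit.
apply/row_matrixP => i; rewrite row0 rowE.
have Kv : K2 H q (delta_mx 0 i *m invmx (B *m P) *m B) by apply/BE; exact: submxMl.
by have [_] := KE _ Kv; rewrite -(mulmxA _ B) mulmxKV.
Qed.

Definition Dlev (x : 'rV[R]_d) (w : 'rV[C]_d) : 'M[C]_n :=
  \matrix_(A, B) dfun (fun y => lev y A B) x w.

Lemma csm_acoef : ulsubmx (lev q) \in unitmx -> csmooth_near q (fun y => acoef (lev y)).
Proof.
move=> uq a b; apply: csm_mulmx => i j.
  apply: csm_ext (csm_opp (csm_lev sF (rshift s i) (lshift m j))).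
  by apply: filterE => x; rewrite [RHS]mxE [in RHS]mxE [in RHS]mxE.
apply: (@csm_invmx _ _ _ _ (fun y => ulsubmx (lev y))) => // i' j'.
apply: csm_ext (csm_lev sF (lshift m i') (lshift m j')).
by apply: filterE => x; rewrite [RHS]mxE [RHS]mxE.
Qed.

Lemma csm_Lam : ulsubmx (lev q) \in unitmx -> csmooth_near q Lam.
Proof.
move=> uq a b; apply: csm_mulmx => [i j|]; last exact: csm_Lx.
elim/chart_split: j => j.
  apply: csm_ext (csm_acoef uq i j); apply: filterE => x.
  by rewrite /kerb row_mxEl.
apply: csm_ext (csm_cst _ ((1%:M : 'M[C]_m) i j)); apply: filterE => x.
by rewrite /kerb row_mxEr.
Qed.

Lemma section_Lam b : (\forall y \near q, good y) ->
  (forall y, good y -> smooth_near y F -> K2 H y (b *m Lam y)) ->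
  section (K2 H) q (fun y => b *m Lam y).
Proof.
move=> gq KL; split.
  by apply: csm_mulcl; apply: csm_Lam; exact: (nbhs_singleton gq).1.
by apply: filterS2 gq near_smooth => y gy sy; exact: KL.
Qed.
End graph_kernel.

Section graph_forms.
Variables (R : realType) (s m : nat).
Local Notation C := R[i].
Local Notation d := (chart_dim s m).
Local Notation n := (s + m)%N.
Local Notation Ev := (Ev R s m).
Local Notation Dz := (Dz R s m).
Local Notation Dzb := (Dzb R s m).
Local Notation Dv := (Dv R s m).
Variable F : 'rV[R]_d -> R.
Local Notation H := (graph_CR F).
Local Notation lev := (lev F).
Local Notation Lx := (Lx F).
Variable q : 'rV[R]_d.
Hypothesis sF : smooth_near q F.

Lemma section_K2 b : (\forall y \near q, good F y) -> section (K2 H) q (fun y => b *m Lam F y).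
Proof.
move=> gq; apply: section_Lam => // y gy sy.
by apply/(K2_Lam sy) => //; exists b.
Qed.

Lemma oplusK2E x X : smooth_near x F -> oplus (K2 H) (bar H) x X <->
  X *m theta F x = 0 /\ X *m Dz *m lev x = 0.
Proof.
move=> sx; split.
  move=> [a [b [Ka Hb ->]]]; have [Ha aE] := (K2E sx a).1 Ka.
  have [b0 _] := (bar_graph_CRE F x b).1 Hb; split.
    by apply/oplusE; exists a, b.
  by rewrite mulmxDl b0 addr0.
move=> [/oplusE[a [b [Ha Hb ->]]]]; have [b0 _] := (bar_graph_CRE F x b).1 Hb.
rewrite mulmxDl b0 addr0 => aE; exists a, b; split=> //.
exact/(K2E sx).
Qed.

(** The second Levi form iota as a tensor: the derivative of the Levi matrix
    along conj H, contracted with its kernel. *)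
Lemma iota2E v w u : (\forall y \near q, good F y) ->
  iota2 H q v w u <-> [/\ H q u, K2 H q v, bar H q w &
    u *m Dz *m lev q = v *m Dz *m Dlev F q w].
Proof.
move=> gq.
have main V W : section (K2 H) q V -> section (bar H) q W -> H q u ->
    oplus (K2 H) (bar H) q (lie V W q - u) <->
      u *m Dz *m lev q = V q *m Dz *m Dlev F q (W q).
  move=> [sV KV] sW Hu.
  have HV : section H q V by split=> //; apply: filterS KV => y [].
  have [_ KVq] := (K2E sF _).1 (nbhs_singleton KV).
  rewrite oplusK2E// mulmxBl (theta_lie sF HV sW) KVq mul0mx (theta_H Hu) subr0.
  have dV j : cdiff (fun y => V y 0 j) q by exact: csm_diff (sV 0 j).
  have dW j : cdiff (fun y => W y 0 j) q by exact: csm_diff (sW.1 0 j).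
  have cV A : cdiff (fun y => (V y *m Dz) 0 A) q by exact: csm_diff (csm_mulc _ _ sV).
  have cl A B : cdiff (fun y => lev y A B) q by exact: csm_diff (csm_lev sF A B).
  have E : lie V W q *m Dz *m lev q = V q *m Dz *m Dlev F q (W q).
    apply/rowP => B; rewrite mxE [RHS]mxE.
    have lE A : (lie V W q *m Dz) 0 A = - dfun (fun y => (V y *m Dz) 0 A) q (W q).
      rewrite lie_mul// (@dfun_near _ _ _ (fun=> 0)) ?dfun_cst ?sub0r//.
      by apply: filterS sW.2 => y /bar_graph_CRE[-> _]; rewrite mxE.
    (* V lies in the kernel of the Levi matrix at all nearby points: this relation
       is differentiated along W. *)
    have : dfun (fun y => \sum_A (V y *m Dz) 0 A * lev y A B) q (W q) = 0.
      rewrite (@dfun_near _ _ _ (fun=> 0)) ?dfun_cst//.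
      apply: filterS2 KV (near_smooth sF) => y Ky sy.
      by have [_ /rowP/(_ B)] := (K2E sy _).1 Ky; rewrite mxE => ->; rewrite mxE.
    rewrite dfun_sum => [|A]; last exact: (cdiffM (cV A) (cl A B)).
    under eq_bigr do rewrite dfunM//.
    rewrite big_split/= => /eqP; rewrite addrC addr_eq0 => /eqP E.
    under eq_bigr do rewrite lE mulNr mulrC.
    rewrite sumrN E opprK; apply: eq_bigr => A _; congr (_ * _).
    by rewrite [RHS]mxE.
  rewrite !mulmxBl E; split=> [[_ /eqP]|->]; last by rewrite subrr.
  by rewrite subr_eq0 => /eqP.
split=> [[Hu [V [W [sV sW Vq Wq]]]]|[Hu Kv Hw E]].
  rewrite main// Vq Wq => E; split=> //.
    by rewrite -Vq; exact: nbhs_singleton sV.2.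
  by rewrite -Wq; exact: nbhs_singleton sW.2.
split=> //; have [b vE] := (K2_Lam sF v (nbhs_singleton gq)).1 Kv.
exists (fun y => b *m Lam F y), (fun y => w *m Dzb *m map_mx (@conjc R) (Lx y)).
have sV := section_K2 b gq; have sW := section_Lxb sF (w *m Dzb).
have wE := bar_graph_CR_eqLx Hw.
by split=> //; apply/main => //; rewrite -vE -wE.
Qed.

(** Modulo the contact distribution the bracket of a (1,0)- and a (0,1)-field is
    tensorial, so the condition on fields is one on vectors. *)
Lemma isF_bracketE (f : gr_map R d s) :
  (forall X, X *m gr_m2 f = 0 <-> oplus H (bar H) q X) ->
  (forall X Y, section H q X -> section (bar H) q Y ->
      hvec (lie X Y q *m gr_m2 f) 0 0
      = hbracket (hvec 0 (X q *m gr_1 f) 0) (hvec 0 0 (Y q *m gr_m1 f))) <->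
  (forall x y, H q x -> bar H q y ->
      hvec (x *m Dz *m lev q *m (y *m Dzb)^T *m (Ev *m gr_m2 f)) 0 0
      = hbracket (hvec 0 (x *m gr_1 f) 0) (hvec 0 0 (y *m gr_m1 f))).
Proof.
move=> kf; have main X Y : section H q X -> section (bar H) q Y ->
    lie X Y q *m gr_m2 f = X q *m Dz *m lev q *m (Y q *m Dzb)^T *m (Ev *m gr_m2 f).
  move=> sX sY; rewrite -(theta_lie sF sX sY).
  apply/eqP; rewrite -subr_eq0 mulmxA -mulmxBl; apply/eqP/kf/oplusE.
  by rewrite mulmxBl -(mulmxA _ Ev) EvTheta mulmx1 subrr.
split=> h.
  move=> x y Hx Hy.
  have [X [sX Xq]] : exists X, section H q X /\ X q = x.
    exists (fun z => x *m Dz *m Lx z); split; first exact: section_Lx.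
    by rewrite -graph_CR_eqLx.
  have [Y [sY Yq]] : exists Y, section (bar H) q Y /\ Y q = y.
    exists (fun z => y *m Dzb *m map_mx (@conjc R) (Lx z)); split; first exact: section_Lxb.
    by rewrite -bar_graph_CR_eqLx.
  have := h _ _ sX sY; rewrite (main _ _ sX sY) Xq Yq; exact.
move=> X Y sX sY; rewrite main//; apply: h; first exact: nbhs_singleton sX.2.
exact: nbhs_singleton sY.2.
Qed.
End graph_forms.

(** * Weighted comparison of two graphs *)

Section matrix_identities.
Variables (K : fieldType) (s m : nat).
Implicit Types (M N : 'M[K]_(s + m)).

Lemma invmx_sub p (A B : 'M[K]_p) : A \in unitmx -> B \in unitmx ->
  invmx A *m - (A - B) *m invmx B = invmx A - invmx B.
Proof.
move=> uA uB; rewrite opprB mulmxBr mulVmx// mulmxBl mul1mx.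
by rewrite -mulmxA mulmxV// mulmx1.
Qed.

Lemma acoef_sub M N : - (dlsubmx M - dlsubmx N) *m invmx (ulsubmx M)
   + - dlsubmx N *m (invmx (ulsubmx M) - invmx (ulsubmx N)) = acoef M - acoef N.
Proof.
rewrite /acoef mulmxBr !mulNmx mulmxBl opprB opprK.
by move: (dlsubmx M *m _) (dlsubmx N *m _) (dlsubmx N *m _) => a b c; rewrite addrACA addrC subrr addr0 addrC.
Qed.

Lemma schur_sub M N : (acoef M - acoef N) *m ursubmx M
   + acoef N *m (ursubmx M - ursubmx N) + (drsubmx M - drsubmx N) = schur M - schur N.
Proof.
rewrite /schur mulmxBr mulmxBl [X in X + _ = _]addrA subrK opprD.
by move: (acoef M *m _) (acoef N *m _) (drsubmx M) (drsubmx N) => a b c e; rewrite addrACA.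
Qed.

Lemma kerb_mul_col M (u : 'rV[K]_(s + m)) al : (kerb M *m u^T) al 0 =
  \sum_j acoef M al j * u 0 (lshift m j) + u 0 (rshift s al).
Proof.
rewrite mxE big_split_ord/=; congr (_ + _).
  by apply: eq_bigr => j _; rewrite /kerb row_mxEl; congr (_ * _); rewrite [LHS]mxE.
rewrite (bigD1 al)//= big1 => [|j ja].
  by rewrite addr0 /kerb row_mxEr mxE eqxx mul1r [LHS]mxE.
by rewrite /kerb row_mxEr mxE eq_sym (negbTE ja) mul0r.
Qed.

Lemma kerb_mul_col_sub M N (u v : 'rV[K]_(s + m)) al :
  \sum_j ((acoef M al j - acoef N al j) * u 0 (lshift m j)
   + acoef N al j * (u 0 (lshift m j) - v 0 (lshift m j)))
   + (u 0 (rshift s al) - v 0 (rshift s al))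
  = (kerb M *m u^T - kerb N *m v^T) al 0.
Proof.
rewrite [RHS]mxE [X in _ = _ + X]mxE !kerb_mul_col opprD addrACA; congr (_ + _).
by rewrite -sumrB; apply: eq_bigr => k _; rewrite mulrBl mulrBr addrA subrK.
Qed.

Lemma sub_mxE p q (A B : 'M[K]_(p, q)) i j : (A - B) i j = A i j - B i j.
Proof. by rewrite !mxE. Qed.
End matrix_identities.

Section frame_weights.
Variables (R : realType) (s m : nat).
Local Notation C := R[i].
Local Notation d := (chart_dim s m).
Local Notation n := (s + m)%N.
Local Notation ii := (iC R).
Local Notation Ez := (Ez R s m).
Local Notation Ezb := (Ezb R s m).
Local Notation Ev := (Ev R s m).
Local Notation vI := (vI s m).
Local Notation w := (@coord_wt s m).
Implicit Types (F G : 'rV[R]_d -> R).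

(** The weight of the complex coordinate with index A. *)
Definition wA (A : 'I_n) : nat := match fintype.split A with inl _ => 1%N | inr _ => 0%N end.

Lemma wA_z j : wA (lshift m j) = 1%N. Proof. by rewrite /wA split_l. Qed.
Lemma wA_zeta j : wA (rshift s j) = 0%N. Proof. by rewrite /wA split_r. Qed.
Lemma wA_le1 A : (wA A <= 1)%N. Proof. by rewrite /wA; case: fintype.split. Qed.
Lemma w_reI A : w (reI A) = wA A.
Proof.
by elim/chart_split: A => a; rewrite /coord_wt ?reI_z ?reI_zeta ?wA_z ?wA_zeta ?split_l// split_r split_l.
Qed.
Lemma w_imI A : w (imI A) = wA A.
Proof.
by elim/chart_split: A => a; rewrite /coord_wt ?imI_z ?imI_zeta ?wA_z ?wA_zeta ?split_l// split_r split_l.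
Qed.
Lemma w_vI : w vI = 2%N.
Proof. by rewrite /coord_wt split_r split_r. Qed.

Lemma sum_delta_mul' (K : comNzRingType) (q : nat) (G : 'I_q -> K) i :
  \sum_j (j == i)%:R * G j = G i.
Proof. by under eq_bigr do rewrite mulrC eq_sym; exact: sum_mul_delta. Qed.

Lemma dfun_rowEz f x A : dfun f x (row A Ez) = 2^-1 * (cpd (reI A) f x - ii * cpd (imI A) f x).
Proof.
rewrite dfunE; under eq_bigr do rewrite !mxE -mulrA mulrBl -mulrA.
by rewrite -mulr_sumr sumrB -mulr_sumr !sum_delta_mul'.
Qed.

Lemma dfun_rowEzb f x A : dfun f x (row A Ezb) = 2^-1 * (cpd (reI A) f x + ii * cpd (imI A) f x).
Proof.
rewrite dfunE; under eq_bigr do rewrite !mxE -mulrA mulrDl -mulrA.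
by rewrite -mulr_sumr big_split/= -mulr_sumr !sum_delta_mul'.
Qed.

Lemma dfun_Ev f x : dfun f x Ev = cpd vI f x.
Proof. by rewrite dfunE; under eq_bigr do rewrite !mxE; exact: sum_delta_mul'. Qed.

Lemma cW_sub N k (f g : 'rV[R]_d -> C) : cW w N k f -> cW w N k g ->
  cW w N k (fun x => f x - g x).
Proof. by move=> Wf Wg; apply: cW_add => //; exact: cW_opp. Qed.

Lemma cW_Ez N k f A : cW w N.+1 k f -> cW w N (k - wA A) (fun x => dfun f x (row A Ez)).
Proof.
move=> Wf; under eq_fun do rewrite dfun_rowEz.
apply/cW_scal/cW_sub; first by rewrite -w_reI; exact: cW_cpd.
by apply: cW_scal; rewrite -w_imI; exact: cW_cpd.
Qed.

Lemma cW_Ezb N k f A : cW w N.+1 k f -> cW w N (k - wA A) (fun x => dfun f x (row A Ezb)).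
Proof.
move=> Wf; under eq_fun do rewrite dfun_rowEzb.
apply/cW_scal/cW_add; first by rewrite -w_reI; exact: cW_cpd.
by apply: cW_scal; rewrite -w_imI; exact: cW_cpd.
Qed.

Lemma cW_Ev N k f : cW w N.+1 k f -> cW w N (k - 2) (fun x => dfun f x Ev).
Proof. by move=> Wf; under eq_fun do rewrite dfun_Ev; rewrite -w_vI; exact: cW_cpd. Qed.

Lemma dfun_add2 f x (X Y : 'rV[C]_d) : dfun f x (X + Y) = dfun f x X + dfun f x Y.
Proof. by have := dfun_linear f x 1 X Y; rewrite scale1r mul1r. Qed.

Lemma dfun_scale f x a (X : 'rV[C]_d) : dfun f x (a *: X) = a * dfun f x X.
Proof.
have := dfun_linear f x a X 0; rewrite addr0 => ->.
by rewrite [X in _ + X](_ : _ = 0) ?addr0// dfunE big1// => j _; rewrite mxE mul0r.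
Qed.

Lemma row_Lx F x A : row A (Lx F x) = row A Ez + mu F x 0 A *: Ev.
Proof.
rewrite /Lx linearD/=; congr (_ + _); apply/rowP => j.
by rewrite mxE mxE big_ord1 mxE [RHS]mxE.
Qed.

Lemma dfun_Lx f F x A : dfun f x (row A (Lx F x)) =
  dfun f x (row A Ez) + mu F x 0 A * dfun f x Ev.
Proof. by rewrite row_Lx dfun_add2 dfun_scale. Qed.

Lemma conj_row_Lx F x A : conjv (row A (Lx F x)) = row A Ezb + (mu F x 0 A)^* *: Ev.
Proof.
have eE j : (Ez A j)^* = Ezb A j by rewrite -conj_Ez [RHS]mxE.
have eV j : (Ev 0 j)^* = Ev 0 j by rewrite -{2}conj_Ev [RHS]mxE.
rewrite row_Lx; apply/rowP => j; rewrite [LHS]mxE [X in X^*]mxE [X in (X + _)^*]mxE [X in (_ + X)^*]mxE.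
by rewrite rmorphD rmorphM/= eE eV [RHS]mxE [X in _ = X + _]mxE [X in _ = _ + X]mxE.
Qed.

Lemma dfun_Lxb f F x A : dfun f x (conjv (row A (Lx F x))) =
  dfun f x (row A Ezb) + (mu F x 0 A)^* * dfun f x Ev.
Proof. by rewrite conj_row_Lx dfun_add2 dfun_scale. Qed.

Lemma dFE F x A : dF F x 0 A = dfun (fun y => (F y)%:C) x (row A Ez).
Proof. by rewrite [LHS]mxE dfun_grad -row_mul [RHS]mxE. Qed.

Lemma muE F x A : mu F x 0 A = kap F x * dfun (fun y => (F y)%:C) x (row A Ez).
Proof. by rewrite -dFE [LHS]mxE. Qed.

Lemma levE F x A B : lev F x A B =
  dfun (fun y => (mu F y 0 B)^*) x (row A Ez) + mu F x 0 A * dfun (fun y => (mu F y 0 B)^*) x Ev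
  - (dfun (fun y => mu F y 0 A) x (row B Ezb) + (mu F x 0 B)^* * dfun (fun y => mu F y 0 A) x Ev).
Proof. by rewrite [LHS]mxE dfun_Lx dfun_Lxb. Qed.

Lemma kap_sub F (F0 : 'rV[R]_d -> R) x : kap F x - kap F0 x =
  kap F x * kap F0 x * (cpd vI (fun y => (F y)%:C) x - cpd vI (fun y => (F0 y)%:C) x).
Proof.
have E (G : 'rV[R]_d -> R) : cpd vI (fun y => (G y)%:C) x = (pd vI G x)%:C.
  by rewrite /cpd /= pd_cst.
rewrite !E /kap; move: (kap_neq0 F x) (kap_neq0 F0 x).
set a := _%:C; set b := (pd vI F0 x)%:C; move: ii a b => i a b ha hb.
by field; rewrite ha hb.
Qed.

Local Opaque lev mu kap.
Definition cWmx N k p q (A : 'rV[R]_d -> 'M[C]_(p, q)) :=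
  forall i j, cW w N k (fun x => A x i j).

Lemma cWmx_mul N k l p q r (A : 'rV[R]_d -> 'M[C]_(p, q)) (B : 'rV[R]_d -> 'M[C]_(q, r)) :
  cWmx N k A -> cWmx N l B -> cWmx N (k + l) (fun x => A x *m B x).
Proof.
move=> WA WB i j; under eq_fun do rewrite mxE.
by apply: cW_sum => a; exact: cW_mul.
Qed.

Lemma cWmx_add N k p q (A B : 'rV[R]_d -> 'M[C]_(p, q)) :
  cWmx N k A -> cWmx N k B -> cWmx N k (fun x => A x + B x).
Proof.
by move=> WA WB i j; under eq_fun do rewrite mxE; apply: cW_add; [exact: WA|exact: WB].
Qed.

Lemma cWmx_opp N k p q (A : 'rV[R]_d -> 'M[C]_(p, q)) :
  cWmx N k A -> cWmx N k (fun x => - A x).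
Proof. by move=> WA i j; under eq_fun do rewrite mxE; apply: cW_opp; exact: WA. Qed.

Lemma cWmx_ext N k p q (A B : 'rV[R]_d -> 'M[C]_(p, q)) :
  (\forall x \near (0 : 'rV[R]_d), A x = B x) -> cWmx N k A -> cWmx N k B.
Proof. by move=> AB WA i j; apply: cW_ext (WA i j); apply: filterS AB => x ->. Qed.

Lemma cWmx_le N k k' p q (A : 'rV[R]_d -> 'M[C]_(p, q)) : (k' <= k)%N ->
  cWmx N k A -> cWmx N k' A.
Proof. by move=> kk WA i j; exact: (cW_le kk). Qed.

Section one.
Variable F : 'rV[R]_d -> R.
Hypothesis WF : forall N, W w N 2 F.

Lemma cW_kap N : cW w N 0 (kap F).
Proof. by apply: cW_smooth; apply: csm_kap; exact: (WF 0).1. Qed.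

(** L_A differentiates once in a direction of weight wA A, and F has weight
    at least 2. *)
Lemma cW_mu N A : cW w N (2 - wA A) (fun x => mu F x 0 A).
Proof.
under eq_fun do rewrite muE; rewrite -[(_ - _)%N]add0n.
by apply: cW_mul; [exact: cW_kap|apply/cW_Ez/cW_real].
Qed.

Lemma cW_lev N A B : cW w N (2 - wA A - wA B) (fun x => lev F x A B).
Proof.
under eq_fun do rewrite levE.
have mA := cW_mu N.+1 A; have mB := cW_conj (cW_mu N.+1 B).
apply: cW_sub; apply: cW_add.
- by rewrite subnAC; apply: cW_Ez.
- apply: (@cW_le _ _ _ _ ((2 - wA A) + (2 - wA B - 2))).
    by rewrite (leq_trans (leq_subr _ _))// leq_addr.
  by apply: cW_mul; [exact: cW_dec|exact: cW_Ev].
- by apply: cW_Ezb.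
- apply: (@cW_le _ _ _ _ ((2 - wA B) + (2 - wA A - 2))).
    by rewrite subnAC (leq_trans (leq_subr _ _))// leq_addr.
  by apply: cW_mul; [exact: cW_dec|exact: cW_Ev].
Qed.

Lemma cWmx_ul N : cWmx N 0 (fun x => ulsubmx (lev F x)).
Proof.
move=> i j; under eq_fun do rewrite mxE mxE.
by have := cW_lev N (lshift m i) (lshift m j); rewrite !wA_z.
Qed.
Lemma cWmx_dl N : cWmx N 1 (fun x => dlsubmx (lev F x)).
Proof.
move=> i j; under eq_fun do rewrite mxE mxE.
by have := cW_lev N (rshift s i) (lshift m j); rewrite wA_z wA_zeta.
Qed.
Lemma cWmx_ur N : cWmx N 1 (fun x => ursubmx (lev F x)).
Proof.
move=> i j; under eq_fun do rewrite mxE mxE.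
by have := cW_lev N (lshift m i) (rshift s j); rewrite wA_z wA_zeta.
Qed.
Lemma cWmx_dr N : cWmx N 2 (fun x => drsubmx (lev F x)).
Proof.
move=> i j; under eq_fun do rewrite mxE mxE.
by have := cW_lev N (rshift s i) (rshift s j); rewrite !wA_zeta.
Qed.

Hypothesis uF : ulsubmx (lev F 0) \in unitmx.

Lemma near_ul_unit : \forall x \near (0 : 'rV[R]_d), ulsubmx (lev F x) \in unitmx.
Proof.
apply: (near_unitmx (A := fun x => ulsubmx (lev F x))) => // i j.
exact: cW_csm (cWmx_ul 0 i j).
Qed.

Lemma cWmx_inv N : cWmx N 0 (fun x => invmx (ulsubmx (lev F x))).
Proof.
move=> i j; apply: cW_smooth; apply: (csm_invmx (A := fun x => ulsubmx (lev F x))) => // a b.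
exact: cW_csm (cWmx_ul 0 a b).
Qed.

Lemma cWmx_acoef N : cWmx N 1 (fun x => acoef (lev F x)).
Proof.
apply: (@cWmx_le _ (1 + 0)%N) => //; apply: cWmx_mul; last exact: cWmx_inv.
by apply: cWmx_opp; exact: cWmx_dl.
Qed.

End one.

Section compare.
Variables (F F0 : 'rV[R]_d -> R).
Hypothesis WF : forall N, W w N 2 F.
Hypothesis WF0 : forall N, W w N 2 F0.
Hypothesis WQ : forall N, W w N 3 (fun x => F x - F0 x).

Lemma near_dsub V : \forall x \near (0 : 'rV[R]_d),
  dfun (fun y => (F y)%:C) x (V x) - dfun (fun y => (F0 y)%:C) x (V x)
  = dfun (fun y => (F y - F0 y)%:C) x (V x).
Proof.
have dF := smooth_near_diff (WF 0).1; have dF0 := smooth_near_diff (WF0 0).1.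
apply: filterS2 dF dF0 => x dF dF0; rewrite !dfunE -sumrB; apply: eq_bigr => j _.
rewrite -mulrBr; congr (_ * _); rewrite /cpd /= !pd_cst pdB//.
by apply/eqP; rewrite eq_complex /= subrr !eqxx.
Qed.

Lemma cW_kap_sub N : cW w N 1 (fun x => kap F x - kap F0 x).
Proof.
under eq_fun do rewrite kap_sub.
apply: (@cW_le _ _ _ _ (0 + 1)%N) => //; apply: cW_mul.
  by apply: (@cW_le _ _ _ _ (0 + 0)%N) => //; apply: cW_mul; exact: cW_kap.
apply: (@cW_ext _ _ _ _ _ (fun x => cpd vI (fun y => (F y - F0 y)%:C) x)).
  have := near_dsub (fun=> Ev); apply: filterS => x; rewrite !dfun_Ev; exact: esym.
have := @cW_cpd _ _ w N 3 (fun y => (F y - F0 y)%:C) vI (cW_real (WQ N.+1)).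
by rewrite w_vI.
Qed.

(** A slope is the product of [kap] and a first derivative of F. The latter
    changes by order 3 - wA A, and [kap] by order 1, being a function of F_v. *)
Lemma cW_mu_sub N A : cW w N (3 - wA A) (fun x => mu F x 0 A - mu F0 x 0 A).
Proof.
have alg (a b u v : C) : a * (u - v) + (a - b) * v = a * u - b * v by ring.
apply: (@cW_ext _ _ _ _ _ (fun x => kap F x * dfun (fun y => (F y - F0 y)%:C) x (row A Ez)
   + (kap F x - kap F0 x) * dfun (fun y => (F0 y)%:C) x (row A Ez))).
  have h := near_dsub (fun=> row A Ez); apply: filterS h => x <-.
  refine (etrans (alg _ _ _ _) _).
  refine (esym (congr2 (fun a b : C => a - b) (muE F x A) (muE F0 x A))).
apply: cW_add; first by rewrite -[(_ - _)%N]add0n; apply: cW_mul; [exact: cW_kap|apply/cW_Ez/cW_real].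
apply: (@cW_le _ _ _ _ (1 + (2 - wA A))).
  by have := wA_le1 A; case: (wA A) => [|[]].
by apply: cW_mul; [exact: cW_kap_sub|apply/cW_Ez/cW_real].
Qed.

Lemma csm_mu0 G A : (forall N, W w N 2 G) -> csm 0 (fun x => mu G x 0 A).
Proof. by move=> WG; exact: (csm_mu (WG 0%N).1 0 A). Qed.

Lemma near_dfun_sub (f g : 'rV[R]_d -> C) V : csm 0 f -> csm 0 g ->
  \forall x \near (0 : 'rV[R]_d), dfun f x (V x) - dfun g x (V x)
    = dfun (fun y => f y - g y) x (V x).
Proof.
move=> sf sg; apply: filterS2 (csm_near sf) (csm_near sg) => x /csm_diff df /csm_diff dg.
rewrite -[LHS]/(_ + _) (_ : - dfun g x (V x) = dfun (fun y => - g y) x (V x)).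
  rewrite -dfunD//; case: dg => gr gi; split.
    rewrite (_ : (fun y => _) = (fun y => - reC (g y))); first exact: differentiableN.
    by apply/funext => y; case: (g y).
  rewrite (_ : (fun y => _) = (fun y => - imC (g y))); first exact: differentiableN.
  by apply/funext => y; case: (g y).
rewrite (_ : (fun y => - g y) = (fun y => (-1) * g y)); last by apply/funext => y; rewrite mulN1r.
by rewrite dfunM ?dfun_cst ?mulr0 ?addr0 ?mulN1r//; exact: cdiff_cst.
Qed.

Lemma lev_sub_algebra (a b a0 b0 p p0 e e0 r r0 g g0 : C) :
  p - p0 + ((a - a0) * e + a0 * (e - e0)) - (r - r0 + ((b - b0) * g + b0 * (g - g0)))
  = (p + a * e - (r + b * g)) - (p0 + a0 * e0 - (r0 + b0 * g0)).
Proof. ring. Qed.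

(** Each term of the difference of the two Levi matrices contains one factor
    that is a difference of slopes, hence gains one order over [cW_lev]. *)
Lemma cW_lev_sub N A B : cW w N (3 - wA A - wA B) (fun x => lev F x A B - lev F0 x A B).
Proof.
pose mb G (x : 'rV[R]_d) : C := (mu G x 0 B)^*; pose ma G (x : 'rV[R]_d) : C := mu G x 0 A.
have sb G : (forall N, W w N 2 G) -> csm 0 (mb G) by move=> WG; apply: csm_conj; exact: csm_mu0.
have sa G : (forall N, W w N 2 G) -> csm 0 (ma G) by move=> WG; exact: csm_mu0.
have Wb : forall N, cW w N (3 - wA B) (fun x => mb F x - mb F0 x).
  move=> N'; rewrite (_ : (fun x => _) = (fun x => (mu F x 0 B - mu F0 x 0 B)^*)); last first.
    by apply/funext => x; rewrite rmorphB.
  by apply: cW_conj; exact: cW_mu_sub.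
apply: (@cW_ext _ _ _ _ _ (fun x => dfun (fun y => mb F y - mb F0 y) x (row A Ez)
   + ((ma F x - ma F0 x) * dfun (mb F) x Ev + ma F0 x * dfun (fun y => mb F y - mb F0 y) x Ev)
   - (dfun (fun y => ma F y - ma F0 y) x (row B Ezb)
   + ((mb F x - mb F0 x) * dfun (ma F) x Ev + mb F0 x * dfun (fun y => ma F y - ma F0 y) x Ev)))).
  have n1 := near_dfun_sub (fun=> row A Ez) (sb _ WF) (sb _ WF0).
  have n2 := near_dfun_sub (fun=> Ev) (sb _ WF) (sb _ WF0).
  have n3 := near_dfun_sub (fun=> row B Ezb) (sa _ WF) (sa _ WF0).
  have n4 := near_dfun_sub (fun=> Ev) (sa _ WF) (sa _ WF0).
  apply: filterS2 (filterI n1 n2) (filterI n3 n4) => x [<- <-] [<- <-].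
  have lE G : lev G x A B = dfun (mb G) x (row A Ez) + ma G x * dfun (mb G) x Ev
     - (dfun (ma G) x (row B Ezb) + mb G x * dfun (ma G) x Ev) by exact: levE.
  rewrite [X in _ = X - _](lE F) [X in _ = _ - X](lE F0); clearbody ma mb.
  move: (ma F x) (ma F0 x) (mb F x) (mb F0 x) (dfun (mb F) x (row A Ez))
    (dfun (mb F0) x (row A Ez)) (dfun (ma F) x (row B Ezb)) (dfun (ma F0) x (row B Ezb))
    (dfun (mb F) x Ev) (dfun (mb F0) x Ev) (dfun (ma F) x Ev) (dfun (ma F0) x Ev).
  by move=> *; exact: lev_sub_algebra.
have bA := wA_le1 A; have bB := wA_le1 B.
have ar (a b : nat) : (a <= 1)%N -> (b <= 1)%N -> [/\ (3 - a - b <= (3 - a) + (2 - b - 2))%N &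
   (3 - a - b <= (2 - a) + (3 - b - 2))%N].
  by case: a => [|[]]//; case: b => [|[]].
have ar2 (a b : nat) : (a <= 1)%N -> (b <= 1)%N -> [/\ (3 - a - b <= (3 - b) + (2 - a - 2))%N &
   (3 - a - b <= (2 - b) + (3 - a - 2))%N].
  by case: a => [|[]]//; case: b => [|[]].
have [a1 a2] := ar _ _ bA bB; have [a3 a4] := ar2 _ _ bA bB.
apply: cW_sub; apply: cW_add.
- by rewrite subnAC; apply: cW_Ez.
- apply: cW_add.
    by apply: (cW_le a1); apply: cW_mul; [exact: cW_mu_sub|apply/cW_Ev/cW_conj/cW_mu].
  by apply: (cW_le a2); apply: cW_mul; [exact: cW_mu|apply/cW_Ev].
- by apply: cW_Ezb; exact: cW_mu_sub.
- apply: cW_add.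
    by apply: (cW_le a3); apply: cW_mul; [exact: Wb|apply/cW_Ev/cW_mu].
  by apply: (cW_le a4); apply: cW_mul; [apply/cW_conj/cW_mu|apply/cW_Ev/cW_mu_sub].
Qed.
Lemma cWmx_sub_block (p q : nat) N k (sub : 'M[C]_n -> 'M[C]_(p, q)) (f : 'I_p -> 'I_n) (g : 'I_q -> 'I_n) :
  (forall M i j, sub M i j = M (f i) (g j)) ->
  (forall i j, (k <= 3 - wA (f i) - wA (g j))%N) ->
  cWmx N k (fun x => sub (lev F x) - sub (lev F0 x)).
Proof.
move=> subE kle i j; apply: (cW_le (kle i j)).
rewrite (_ : (fun x => _) = (fun x => lev F x (f i) (g j) - lev F0 x (f i) (g j))).
  exact: cW_lev_sub.
apply/funext => x; apply: (etrans (sub_mxE _ _ i j)).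
exact: (congr2 (fun a b : C => a - b) (subE (lev F x) i j) (subE (lev F0 x) i j)).
Qed.

Lemma cWmx_ul_sub N : cWmx N 1 (fun x => ulsubmx (lev F x) - ulsubmx (lev F0 x)).
Proof.
apply: (@cWmx_sub_block _ _ _ _ _ (lshift m) (lshift m)) => [M i j|i j]; first by rewrite !mxE.
by rewrite !wA_z.
Qed.
Lemma cWmx_ur_sub N : cWmx N 2 (fun x => ursubmx (lev F x) - ursubmx (lev F0 x)).
Proof.
apply: (@cWmx_sub_block _ _ _ _ _ (lshift m) (@rshift s m)) => [M i j|i j]; first by rewrite !mxE.
by rewrite wA_z wA_zeta.
Qed.
Lemma cWmx_dl_sub N : cWmx N 2 (fun x => dlsubmx (lev F x) - dlsubmx (lev F0 x)).
Proof.
apply: (@cWmx_sub_block _ _ _ _ _ (@rshift s m) (lshift m)) => [M i j|i j]; first by rewrite !mxE.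
by rewrite wA_z wA_zeta.
Qed.
Lemma cWmx_dr_sub N : cWmx N 3 (fun x => drsubmx (lev F x) - drsubmx (lev F0 x)).
Proof.
apply: (@cWmx_sub_block _ _ _ _ _ (@rshift s m) (@rshift s m)) => [M i j|i j]; first by rewrite !mxE.
by rewrite !wA_zeta.
Qed.

Lemma leaf0 : leaf w (0 : 'rV[R]_d). Proof. by move=> i _; rewrite mxE. Qed.

(** The difference has order 3 - wA A - wA B, which is positive. *)
Lemma lev_leaf : \forall x \near (0 : 'rV[R]_d), leaf w x -> lev F x = lev F0 x.
Proof.
have H : forall AB : 'I_n * 'I_n, \forall x \near (0 : 'rV[R]_d), leaf w x ->
    lev F x AB.1 AB.2 - lev F0 x AB.1 AB.2 = 0.
  move=> [A B]; apply: (cW_leaf _ (cW_lev_sub 0 A B)).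
  by have := wA_le1 A; have := wA_le1 B; case: (wA A) => [|[]]//; case: (wA B) => [|[]].
have H' := filter_forall (nbhs_filter (0 : 'rV[R]_d)) H.
apply: filterS H' => x Hx lx; apply/matrixP => A B.
by apply/eqP; rewrite -subr_eq0; apply/eqP; exact: (Hx (A, B) lx).
Qed.

Hypothesis u0 : ulsubmx (lev F0 0) \in unitmx.

Lemma uF0 : ulsubmx (lev F 0) \in unitmx.
Proof. by rewrite (nbhs_singleton lev_leaf leaf0). Qed.

Lemma cWmx_inv_sub N : cWmx N 1 (fun x => invmx (ulsubmx (lev F x)) - invmx (ulsubmx (lev F0 x))).
Proof.
have nF := near_ul_unit WF uF0; have nF0 := near_ul_unit WF0 u0.
apply: (@cWmx_ext _ _ _ _ (fun x => invmx (ulsubmx (lev F x)) *m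
    - (ulsubmx (lev F x) - ulsubmx (lev F0 x)) *m invmx (ulsubmx (lev F0 x)))).
  by apply: filterS2 nF nF0 => x; exact: invmx_sub.
apply: (@cWmx_le _ (0 + 1 + 0)%N) => //.
apply: cWmx_mul; [apply: cWmx_mul|]; [exact: cWmx_inv uF0 _|apply: cWmx_opp; exact: cWmx_ul_sub|exact: cWmx_inv u0 _].
Qed.

Lemma cWmx_acoef_sub N : cWmx N 2 (fun x => acoef (lev F x) - acoef (lev F0 x)).
Proof.
apply: (@cWmx_ext _ _ _ _ (fun x => - (dlsubmx (lev F x) - dlsubmx (lev F0 x)) *m invmx (ulsubmx (lev F x))
   + - dlsubmx (lev F0 x) *m (invmx (ulsubmx (lev F x)) - invmx (ulsubmx (lev F0 x))))).
  by apply: filterE => x; exact: acoef_sub.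
apply: cWmx_add.
  apply: (@cWmx_le _ (2 + 0)%N) => //; apply: cWmx_mul; last exact: cWmx_inv uF0 _.
  by apply: cWmx_opp; exact: cWmx_dl_sub.
apply: (@cWmx_le _ (1 + 1)%N) => //; apply: cWmx_mul; last exact: cWmx_inv_sub.
by apply: cWmx_opp; exact: cWmx_dl.
Qed.

Lemma cWmx_schur_sub N : cWmx N 3 (fun x => schur (lev F x) - schur (lev F0 x)).
Proof.
apply: (@cWmx_ext _ _ _ _ (fun x => (acoef (lev F x) - acoef (lev F0 x)) *m ursubmx (lev F x)
   + acoef (lev F0 x) *m (ursubmx (lev F x) - ursubmx (lev F0 x))
   + (drsubmx (lev F x) - drsubmx (lev F0 x)))).
  by apply: filterE => x; exact: schur_sub.
apply: cWmx_add; [apply: cWmx_add|exact: cWmx_dr_sub].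
  by apply: (@cWmx_le _ (2 + 1)%N) => //; apply: cWmx_mul; [exact: cWmx_acoef_sub|exact: cWmx_ur].
by apply: (@cWmx_le _ (1 + 2)%N) => //; apply: cWmx_mul; [exact: cWmx_acoef u0 _|exact: cWmx_ur_sub].
Qed.

(** The compared quantities are the components along v of the frames [Lam]. *)
Lemma cWmx_tau_sub N : cWmx N 3 (fun x => kerb (lev F x) *m (mu F x)^T - kerb (lev F0 x) *m (mu F0 x)^T).
Proof.
move=> al j; rewrite (ord1 j).
apply: (@cW_ext _ _ _ _ _ (fun x => \sum_j ((acoef (lev F x) al j - acoef (lev F0 x) al j) * mu F x 0 (lshift m j)
   + acoef (lev F0 x) al j * (mu F x 0 (lshift m j) - mu F0 x 0 (lshift m j)))
   + (mu F x 0 (rshift s al) - mu F0 x 0 (rshift s al)))).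
  by apply: filterE => x; exact: kerb_mul_col_sub.
apply: cW_add; last by have := cW_mu_sub N (rshift s al); rewrite wA_zeta.
apply: cW_sum => k; apply: cW_add.
  apply: (@cW_le _ _ _ _ (2 + 1)%N) => //; apply: cW_mul.
    have := cWmx_acoef_sub N al k; rewrite (_ : (fun x => _) = (fun x => acoef (lev F x) al k - acoef (lev F0 x) al k))//.
    by apply/funext => x; exact: sub_mxE.
  by have := cW_mu WF N (lshift m k); rewrite wA_z.
apply: (@cW_le _ _ _ _ (1 + 2)%N) => //; apply: cW_mul; first exact: cWmx_acoef WF0 u0 _ _ _.
by have := cW_mu_sub N (lshift m k); rewrite wA_z.
Qed.
End compare.
End frame_weights.

(** * Two graphs along their common leaf *)

Section block_entries.
Variables (K : Type) (a b p q : nat) (M : 'M[K]_(a + b, p + q)).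
Lemma ulE i j : ulsubmx M i j = M (lshift b i) (lshift q j). Proof. by rewrite !mxE. Qed.
Lemma urE i j : ursubmx M i j = M (lshift b i) (rshift p j). Proof. by rewrite !mxE. Qed.
Lemma dlE i j : dlsubmx M i j = M (rshift a i) (lshift q j). Proof. by rewrite !mxE. Qed.
Lemma drE i j : drsubmx M i j = M (rshift a i) (rshift p j). Proof. by rewrite !mxE. Qed.
End block_entries.

Section leaf_geometry.
Variables (R : realType) (s m : nat).
Local Notation C := R[i].
Local Notation d := (chart_dim s m).
Local Notation n := (s + m)%N.
Local Notation ii := (iC R).
Local Notation Ez := (Ez R s m).
Local Notation Ezb := (Ezb R s m).
Local Notation Ev := (Ev R s m).
Local Notation Dz := (Dz R s m).
Local Notation Dzb := (Dzb R s m).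
Local Notation Dv := (Dv R s m).
Local Notation vI := (vI s m).
Local Notation w := (@coord_wt s m).
Implicit Types (F G : 'rV[R]_d -> R) (x q : 'rV[R]_d).

Lemma cWmx_leaf k p r (A : 'rV[R]_d -> 'M[C]_(p, r)) : (0 < k)%N -> cWmx 0 k A ->
  \forall x \near (0 : 'rV[R]_d), leaf w x -> A x = 0.
Proof.
move=> k0 WA.
have H : forall ij : 'I_p * 'I_r, \forall x \near (0 : 'rV[R]_d), leaf w x -> A x ij.1 ij.2 = 0.
  by move=> [i j]; exact: (cW_leaf k0 (WA i j)).
have H' := filter_forall (nbhs_filter (0 : 'rV[R]_d)) H.
by apply: filterS H' => x Hx lx; apply/matrixP => i j; rewrite (Hx (i, j) lx) mxE.
Qed.

(** The structure of a hypersurface at a point of the leaf z = 0, v = 0: the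
    slopes vanish, and the Levi matrix has the zeta-directions in its kernel. *)
Record leaf_pt F x : Prop := LeafPt {
  lp_leaf : leaf w x;
  lp_smooth : smooth_near x F;
  lp_good : \forall y \near x, good F y;
  lp_mu : mu F x = 0;
  lp_dl : dlsubmx (lev F x) = 0;
  lp_ur : ursubmx (lev F x) = 0;
  lp_dr : drsubmx (lev F x) = 0 }.

(** The slopes and the three blocks of the Levi matrix have positive order. *)
Lemma near_leaf_pt F : (forall N, W w N 2 F) ->
  (\forall y \near (0 : 'rV[R]_d), good F y) ->
  \forall x \near (0 : 'rV[R]_d), leaf w x -> leaf_pt F x.
Proof.
move=> WF gF.
have nm : \forall x \near (0 : 'rV[R]_d), leaf w x -> mu F x = 0.
  have Wm : cWmx 0 1 (mu F).
    by move=> i A; rewrite ord1; apply: (@cW_le _ _ _ _ (2 - wA A)) (cW_mu WF 0 A); have := wA_le1 A; case: (wA A) => [|[]].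
  exact: (cWmx_leaf _ Wm).
have ndl := cWmx_leaf (ltn0Sn 0) (cWmx_dl WF 0).
have nur := cWmx_leaf (ltn0Sn 0) (cWmx_ur WF 0).
have ndr := cWmx_leaf (ltn0Sn 1) (cWmx_dr WF 0).
have sn := smooth_near_near (WF 0).1; have gn := near_interior gF.
apply: filterS2 (filterI nm (filterI ndl nur)) (filterI ndr (filterI sn gn)).
by move=> x [a [b c]] [e [f g]] lx; split; [|exact: f|exact: g|exact: a|exact: b|exact: c|exact: e].
Qed.

Section at_leaf.
Variables (F : 'rV[R]_d -> R) (x : 'rV[R]_d).
Hypothesis lp : leaf_pt F x.

Lemma leaf_levzz : ulsubmx (lev F x) \in unitmx.
Proof. exact: (nbhs_singleton (lp_good lp)).1. Qed.

Lemma leaf_lev : lev F x = block_mx (ulsubmx (lev F x)) 0 0 0.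
Proof. by rewrite -{1}[lev F x]submxK (lp_dl lp) (lp_ur lp) (lp_dr lp). Qed.

Lemma leaf_Lx : Lx F x = Ez.
Proof. by rewrite /Lx (lp_mu lp) trmx0 mul0mx addr0. Qed.

Lemma leaf_kerb : kerb (lev F x) = row_mx 0 1%:M.
Proof. by rewrite /kerb /acoef (lp_dl lp) oppr0 mul0mx. Qed.

Lemma leaf_theta : theta F x = Dv.
Proof. by rewrite /theta (lp_mu lp) /conjv map_mx0 trmx0 !mulmx0 !subr0. Qed.

Lemma leaf_CR X : graph_CR F x X <-> X *m Dzb = 0 /\ X *m Dv = 0.
Proof. by rewrite graph_CRE (lp_mu lp) trmx0 mulmx0. Qed.

Lemma leaf_barCR X : bar (graph_CR F) x X <-> X *m Dz = 0 /\ X *m Dv = 0.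
Proof. by rewrite bar_graph_CRE (lp_mu lp) /conjv map_mx0 trmx0 mulmx0. Qed.

Lemma leaf_contact X : oplus (graph_CR F) (bar (graph_CR F)) x X <-> X *m Dv = 0.
Proof. by rewrite oplusE leaf_theta. Qed.

Lemma leaf_ker_lev (y : 'rV[C]_n) : y *m lev F x = 0 <-> lsubmx y = 0.
Proof.
rewrite leaf_lev -{1}(hsubmxK y) mul_row_block !mulmx0 !addr0.
split=> [/(congr1 lsubmx)|->]; last by rewrite mul0mx row_mx0.
rewrite row_mxKl linear0 => E.
by rewrite -(mulmxK leaf_levzz (lsubmx y)) E mul0mx.
Qed.

Lemma leaf_K2 X : K2 (graph_CR F) x X <->
  [/\ X *m Dzb = 0, X *m Dv = 0 & lsubmx (X *m Dz) = 0].
Proof.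
rewrite (K2E (lp_smooth lp)) leaf_CR leaf_ker_lev.
by split=> [[[]]|[]].
Qed.

Lemma leaf_barK2 X : bar (K2 (graph_CR F)) x X <->
  [/\ X *m Dz = 0, X *m Dv = 0 & lsubmx (X *m Dzb) = 0].
Proof.
apply: (iff_trans (leaf_K2 (conjv X))); rewrite conjv_Dzb conjv_Dz.
have c0 p (v : 'rV[C]_p) : conjv v = 0 <-> v = 0.
  split=> [E|->]; last by rewrite /conjv map_mx0.
  by rewrite -[v]conjvK E /conjv map_mx0.
have -> : conjv X *m Dv = conjv (X *m Dv) by rewrite conjv_mul conj_Dv.
have -> : lsubmx (conjv (X *m Dzb)) = conjv (lsubmx (X *m Dzb)).
  by apply/rowP => j; rewrite !mxE.
by split=> -[/c0 ? /c0 ? /c0 ?].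
Qed.

(** The coordinates of positive weight are z and v, those of weight 0 are
    zeta. *)
Lemma wt_pos_vanish (X : 'rV[C]_d) : (forall i, (0 < w i)%N -> X 0 i = 0) <->
  [/\ X *m Dv = 0, lsubmx (X *m Dz) = 0 & lsubmx (X *m Dzb) = 0].
Proof.
split=> [X0|[Xv Xz Xzb] i].
  have z0 j : X 0 (reI (lshift m j)) = 0 /\ X 0 (imI (lshift m j)) = 0.
    by split; apply: X0; rewrite ?w_reI ?w_imI wA_z.
  split; apply/rowP => j; rewrite ?[lsubmx _ _ _]mxE ?mulDv ?mulDz ?mulDzb [RHS]mxE ?ord1.
  - by apply: X0; rewrite w_vI.
  - by rewrite (z0 j).1 (z0 j).2 mulr0 addr0.
  - by rewrite (z0 j).1 (z0 j).2 mulr0 subr0.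
have e j : X 0 (reI (lshift m j)) + ii * X 0 (imI (lshift m j)) = 0.
  by have /rowP/(_ j) := Xz; rewrite [lsubmx _ _ _]mxE mulDz [RHS]mxE.
have f j : X 0 (reI (lshift m j)) - ii * X 0 (imI (lshift m j)) = 0.
  by have /rowP/(_ j) := Xzb; rewrite [lsubmx _ _ _]mxE mulDzb [RHS]mxE.
have ii0 : ii != 0.
  by apply/eqP => E; have := ii2 R; rewrite E mulr0 => /esym/eqP; rewrite oppr_eq0 oner_eq0.
have g j : X 0 (reI (lshift m j)) = 0.
  have := e j; have := f j; move: (X 0 _) (ii * _) => a b /eqP.
  rewrite subr_eq0 => /eqP <- /eqP; rewrite -mulr2n -mulr_natr mulf_eq0 pnatr_eq0 orbF.
  by move/eqP.
have h j : X 0 (imI (lshift m j)) = 0.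
  by have /eqP := e j; rewrite g add0r mulf_eq0 (negbTE ii0) => /eqP.
elim/chart_ind: i => [A|A|] //.
- by elim/chart_split: A => j; rewrite w_reI ?wA_zeta.
- by elim/chart_split: A => j; rewrite w_imI ?wA_zeta.
- by move=> _; have /rowP/(_ 0) := Xv; rewrite mulDv [RHS]mxE.
Qed.

(** On the leaf K2 is spanned by the zeta-directions, so the leaf is an integral
    manifold of the real part of K2 + conj K2. *)
Lemma leaf_K2_sum X : oplus (K2 (graph_CR F)) (bar (K2 (graph_CR F))) x X <->
  (forall i, (0 < w i)%N -> X 0 i = 0).
Proof.
rewrite wt_pos_vanish; split.
  move=> [a [b [/leaf_K2[a1 a2 a3] /leaf_barK2[b1 b2 b3] ->]]].
  by rewrite !mulmxDl a1 b1 a2 b2 !addr0 add0r.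
move=> [Xv Xz Xzb]; exists (X *m Dz *m Ez), (X *m Dzb *m Ezb); split.
- apply/leaf_K2; rewrite -(mulmxA _ Ez Dzb) -(mulmxA _ Ez Dv) -(mulmxA _ Ez Dz).
  by rewrite EzDzb EzDv EzDz !mulmx0 mulmx1.
- apply/leaf_barK2; rewrite -(mulmxA _ Ezb Dzb) -(mulmxA _ Ezb Dv) -(mulmxA _ Ezb Dz).
  by rewrite EzbDzb EzbDv EzbDz !mulmx0 mulmx1.
- by rewrite {1}(frame_decomp X) Xv mul0mx addr0.
Qed.
End at_leaf.

Lemma lsubmx0_entry (y : 'rV[C]_n) j : lsubmx y = 0 -> y 0 (lshift m j) = 0.
Proof. by move=> /rowP/(_ j); rewrite !mxE. Qed.

Lemma Dlev_Ezb G x (eta : 'rV[C]_n) A B : Dlev G x (eta *m Ezb) A B =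
  \sum_A' eta 0 A' * dfun (fun y => lev G y A B) x (row A' Ezb).
Proof. by rewrite [LHS]mxE; exact: dfun_mulmx. Qed.

Section agree.
Variables (F F0 : 'rV[R]_d -> R) (x : 'rV[R]_d).
Hypotheses (lF : leaf_pt F x) (lF0 : leaf_pt F0 x) (levE : lev F x = lev F0 x).
Hypothesis dlevE : forall al B A,
  dfun (fun y => lev F y (rshift s al) B) x (row A Ezb) =
  dfun (fun y => lev F0 y (rshift s al) B) x (row A Ezb).

Lemma Dlev_agree (eta : 'rV[C]_n) al B :
  Dlev F x (eta *m Ezb) (rshift s al) B = Dlev F0 x (eta *m Ezb) (rshift s al) B.
Proof.
refine (etrans (Dlev_Ezb F x eta (rshift s al) B) _).
refine (etrans _ (esym (Dlev_Ezb F0 x eta (rshift s al) B))).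
apply: eq_bigr => A _; refine (congr1 (fun a => eta 0 A * a) (dlevE al B A)).
Qed.

Lemma agree_CR : graph_CR F x = graph_CR F0 x.
Proof.
by apply/funext => X; apply/propext; exact: (iff_trans (leaf_CR lF X) (iff_sym (leaf_CR lF0 X))).
Qed.

Lemma agree_barCR : bar (graph_CR F) x = bar (graph_CR F0) x.
Proof. by rewrite /bar agree_CR. Qed.

Lemma agree_K2 : K2 (graph_CR F) x = K2 (graph_CR F0) x.
Proof.
by apply/funext => X; apply/propext; exact: (iff_trans (leaf_K2 lF X) (iff_sym (leaf_K2 lF0 X))).
Qed.

(** On the leaf K2 only has zeta-components, so only the zeta-rows of the
    derivative of the Levi matrix enter iota. *)
Lemma agree_iota2 v u u' : iota2 (graph_CR F) x v u u' <-> iota2 (graph_CR F0) x v u u'.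
Proof.
rewrite (iota2E (lp_smooth lF) _ _ _ (lp_good lF)) (iota2E (lp_smooth lF0) _ _ _ (lp_good lF0)).
rewrite -agree_CR -agree_barCR -agree_K2 -levE.
have E : K2 (graph_CR F) x v -> bar (graph_CR F) x u ->
    v *m Dz *m Dlev F x u = v *m Dz *m Dlev F0 x u.
  move=> /(leaf_K2 lF)[_ _ v0] /bar_graph_CR_eqLx uE.
  rewrite (leaf_Lx lF) conj_Ez in uE.
  apply/rowP => B; rewrite [LHS]mxE [RHS]mxE; apply: eq_bigr => A _.
  elim/chart_split: A => j.
    have e : (v *m Dz) 0 (lshift m j) = 0 := lsubmx0_entry j v0.
    by apply: (etrans (congr1 (fun a => a * _) e)); rewrite mul0r; apply: esym;
      apply: (etrans (congr1 (fun a => a * _) e)); rewrite mul0r.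
  apply: (congr1 (fun a => _ * a)); rewrite uE; exact: Dlev_agree.
split=> -[h1 h2 h3 h4].
  refine (And4 h1 h2 h3 (etrans h4 (E h2 h3))).
refine (And4 h1 h2 h3 (etrans h4 (esym (E h2 h3)))).
Qed.

Lemma agree_isF (f : gr_map R d s) : isF (graph_CR F) x f <-> isF (graph_CR F0) x f.
Proof.
have oE : oplus (graph_CR F) (bar (graph_CR F)) x = oplus (graph_CR F0) (bar (graph_CR F0)) x.
  by rewrite /oplus agree_CR agree_barCR.
have kE : bar (K2 (graph_CR F)) x = bar (K2 (graph_CR F0)) x by rewrite /bar agree_K2.
rewrite /isF -oE -kE -agree_CR -agree_barCR -agree_K2.
split=> -[h1 h2 h3 h4].
  split; [exact: h1|exact: h2|exact: h3|].
  apply/(isF_bracketE (lp_smooth lF0)); first by rewrite -oE; exact: h1.1.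
  rewrite -levE -agree_CR -agree_barCR; apply/(isF_bracketE (lp_smooth lF)); first exact: h1.1.
  exact: h4.
split; [exact: h1|exact: h2|exact: h3|].
apply/(isF_bracketE (lp_smooth lF)); first exact: h1.1.
rewrite levE agree_CR agree_barCR; apply/(isF_bracketE (lp_smooth lF0)); first by rewrite -oE; exact: h1.1.
exact: h4.
Qed.
End agree.

Section family.
Variable G : 'rV[R]_d -> R.
Hypothesis WG : forall N, W w N 2 G.
Hypothesis gG : \forall y \near (0 : 'rV[R]_d), good G y.
Local Notation H := (graph_CR G).

(** The second Levi form in the frames Lambda and conj L, as a matrix whose
    rows are indexed by the frame of K2; 2-nondegeneracy is the freeness of
    these rows. *)
Definition iota_mx (y : 'rV[R]_d) : 'M[C]_(m, n * n) :=
  \matrix_al mxvec (\matrix_(A, B) (kerb (lev G y) *m Dlev G y (conjv (row A (Lx G y)))) al B).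

Lemma iota_mxE y (b : 'rV[C]_m) A B : (b *m iota_mx y) 0 (mxvec_index A B) =
  (b *m kerb (lev G y) *m Dlev G y (conjv (row A (Lx G y)))) 0 B.
Proof.
rewrite -mulmxA [LHS]mxE [RHS]mxE; apply: eq_bigr => al _; congr (_ * _).
by rewrite [LHS]mxE mxvecE [LHS]mxE.
Qed.

Lemma Dlev_mulmx y (eta : 'rV[C]_n) k (M : 'M[C]_(k, n)) :
  M *m Dlev G y (eta *m map_mx (@conjc R) (Lx G y)) =
  \sum_A eta 0 A *: (M *m Dlev G y (conjv (row A (Lx G y)))).
Proof.
rewrite -[RHS](_ : M *m (\sum_A eta 0 A *: Dlev G y (conjv (row A (Lx G y)))) = _); last first.
  by rewrite mulmx_sumr; apply: eq_bigr => A _; rewrite scalemxAr.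
congr (_ *m _); apply/matrixP => i j; rewrite [LHS]mxE (dfun_mulmx (fun z => lev G z i j)) summxE.
by apply: eq_bigr => A _; rewrite [RHS]mxE [X in _ = _ * X]mxE /conjv -map_row.
Qed.

(** By [iota2E] the vector b Lam lies in the kernel of iota exactly when b
    annihilates all contractions that are listed in [iota_mx]. *)
Lemma iota_inj q : smooth_near q G -> (\forall y \near q, good G y) ->
  (forall v, K2 H q v -> (forall u, bar H q u -> iota2 H q v u 0) -> v = 0) <->
  row_free (iota_mx q).
Proof.
move=> sq gq; have gq0 := nbhs_singleton gq.
have H0 : H q 0 by apply/graph_CRE; rewrite !mul0mx.
have bL (b : 'rV[C]_m) : b *m Lam G q *m Dz = b *m kerb (lev G q).
  by rewrite -mulmxA LamDz.
split=> h.
  apply: inj_row_free => b bT.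
  have Kv : K2 H q (b *m Lam G q) by apply/(K2_Lam sq _ gq0); exists b.
  have := h _ Kv; rewrite -[_ = 0]/(b *m Lam G q = 0) => bL0.
  apply: (row_free_inj (Lam_free G q)); rewrite mul0mx; apply: bL0 => u Hu.
  apply/(iota2E sq _ _ _ gq); split=> //; rewrite !mul0mx bL (bar_graph_CR_eqLx Hu) Dlev_mulmx.
  rewrite big1// => A _; rewrite [X in _ *: X](_ : _ = 0) ?scaler0//.
  by apply/rowP => B; rewrite -iota_mxE bT !mxE.
move=> v /[dup] Kv /(K2_Lam sq _ gq0)[b vE] hv.
suff b0 : b = 0 by rewrite vE b0 mul0mx.
apply: (row_free_inj h); rewrite mul0mx; apply/rowP => k.
case/mxvec_indexP: k => A B; rewrite iota_mxE.
have Hu : bar H q (conjv (row A (Lx G q))).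
  by apply: bar_conj; rewrite rowE; exact: graph_CR_Lx.
have /(iota2E sq _ _ _ gq)[_ _ _] := hv _ Hu.
by rewrite !mul0mx {1}vE bL => <-; rewrite !mxE.
Qed.

Lemma csm_iota_mx : csmooth_near 0 iota_mx.
Proof.
have sG := (WG 0).1; have uG := (nbhs_singleton gG).1.
move=> al k; case/mxvec_indexP: k => A B.
apply: (@csm_ext _ _ _ (fun y => (kerb (lev G y) *m Dlev G y (conjv (row A (Lx G y)))) al B)).
  by apply: filterE => y; rewrite [RHS]mxE mxvecE [RHS]mxE.
apply: csm_mulmx => [i j|i j].
  apply: csm_ext (csm_mulmx i j (csm_Lam sG uG) (fun a b => csm_cst 0 (Dz a b))).
  by apply: filterE => y; rewrite LamDz.
apply: (@csm_ext _ _ _ (fun y => dfun (fun z => lev G z i j) y (conjv (row A (Lx G y))))).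
  by apply: filterE => y; rewrite [RHS]mxE.
apply: csm_dfun; first exact: csm_lev.
move=> k; apply: csm_ext (csm_conj (csm_Lx sG A k)).
by apply: filterE => y; rewrite [RHS]mxE [X in _ = X^*]mxE.
Qed.
End family.

Definition chom a k (f : 'rV[R]_d -> C) := \forall y \near (0 : 'rV[R]_d),
  forall t : R, 0 < t <= 1 -> (t ^+ a)%:C * f (scale w t y) = (t ^+ k)%:C * f y.

Lemma chom_real a k (f : 'rV[R]_d -> R) : homogeneous w a k f -> chom a k (fun y => (f y)%:C).
Proof. by apply: filterS => y hy t t01; rewrite -!rmorphM /= hy. Qed.

Lemma chom_cpd a k f i : csm 0 f -> chom a k f -> chom (a + w i) k (cpd i f).
Proof.
move=> [sr si] hf.
have reM (t : R) (z : C) : reC (t%:C * z) = t * reC z by case: z => u v /=; rewrite mul0r subr0.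
have imM (t : R) (z : C) : imC (t%:C * z) = t * imC z by case: z => u v /=; rewrite mul0r addr0.
have hr : homogeneous w a k (fun y => reC (f y)).
  by apply: filterS hf => y hy t /hy/(congr1 (@complex.Re R)); rewrite !reM.
have hi : homogeneous w a k (fun y => imC (f y)).
  by apply: filterS hf => y hy t /hy/(congr1 (@complex.Im R)); rewrite !imM.
apply: filterS2 (homogeneous_pd i sr hr) (homogeneous_pd i si hi) => y h1 h2 t t01.
apply/eqP; rewrite eq_complex; apply/andP; split; apply/eqP.
  rewrite (reM _ (cpd i f (scale w t y))) (reM _ (cpd i f y)); exact: h1.
rewrite (imM _ (cpd i f (scale w t y))) (imM _ (cpd i f y)); exact: h2.
Qed.

Lemma chom_lin a k f (g : 'rV[R]_d -> C) (c1 c2 : C) : chom a k f -> chom a k g ->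
  chom a k (fun y => c1 * f y + c2 * g y).
Proof.
have E (e u v : C) : e * (c1 * u + c2 * v) = c1 * (e * u) + c2 * (e * v) by ring.
move=> hf hg; apply: filterS2 hf hg => y hy gy t t01.
by apply: (etrans (E _ _ _)); rewrite (hy t t01) (gy t t01) E.
Qed.

Lemma chom_conj a k f : chom a k f -> chom a k (fun y => (f y)^*).
Proof.
have cr (t : R) : (t%:C)^* = t%:C by rewrite /= oppr0.
apply: filterS => y hy t t01; rewrite -[X in X * _ = _]cr -[X in _ = X * _]cr -!rmorphM.
by congr (_^*); exact: hy.
Qed.

Lemma chom_Ez a k f A : csm 0 f -> chom a k f -> chom (a + wA A) k (fun y => dfun f y (row A Ez)).
Proof.
move=> sf hf; rewrite (_ : (fun y => _) = (fun y => 2^-1 * cpd (reI A) f y + - (2^-1 * ii) * cpd (imI A) f y)).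
  by apply: chom_lin; [rewrite -(w_reI A)|rewrite -(w_imI A)]; exact: chom_cpd.
by apply/funext => y; rewrite dfun_rowEz mulrBr mulNr mulrA.
Qed.

Lemma chom_Ezb a k f A : csm 0 f -> chom a k f -> chom (a + wA A) k (fun y => dfun f y (row A Ezb)).
Proof.
move=> sf hf; rewrite (_ : (fun y => _) = (fun y => 2^-1 * cpd (reI A) f y + (2^-1 * ii) * cpd (imI A) f y)).
  by apply: chom_lin; [rewrite -(w_reI A)|rewrite -(w_imI A)]; exact: chom_cpd.
by apply/funext => y; rewrite dfun_rowEzb mulrDr mulrA.
Qed.

Definition v_invariant T (f : 'rV[R]_d -> T) :=
  forall h y, f (h *: (delta_mx 0 vI : 'rV[R]_d) + y) = f y.

Lemma v_invariant_pd f i : v_invariant f -> v_invariant (pd i f).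
Proof.
move=> fi h y; rewrite addrC; apply: (etrans (esym (pd_shift f (h *: (delta_mx 0 vI : 'rV[R]_d)) y i))).
by apply: pd_near; apply: filterE => z; rewrite addrC; exact: fi.
Qed.

Lemma v_invariant_cpd (f : 'rV[R]_d -> C) i : v_invariant f -> v_invariant (cpd i f).
Proof.
move=> fi h y; rewrite /cpd; congr (_ +i* _); apply: v_invariant_pd => k z; by rewrite fi.
Qed.

Lemma v_invariant_cpd0 (f : 'rV[R]_d -> C) y : v_invariant f -> cpd vI f y = 0.
Proof.
by move=> fi; rewrite /cpd; congr (_ +i* _); apply: pd_invariant => h z; rewrite fi.
Qed.

Lemma v_invariant_dfun (f : 'rV[R]_d -> C) (V : 'rV[C]_d) : v_invariant f ->
  v_invariant (fun y => dfun f y V).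
Proof. by move=> fi k z; rewrite !dfunE; apply: eq_bigr => j _; rewrite v_invariant_cpd. Qed.

Section invariant.
Variable G : 'rV[R]_d -> R.
Hypothesis iG : v_invariant G.

Lemma invariant_kap y : kap G y = ii^-1.
Proof. by rewrite /kap (pd_invariant _ iG) subr0. Qed.

Lemma invariant_muE y A : mu G y 0 A = ii^-1 * dfun (fun z => (G z)%:C) y (row A Ez).
Proof. by rewrite muE invariant_kap. Qed.

Lemma invariant_mu A : v_invariant (fun y => mu G y 0 A).
Proof.
move=> h y; apply: (etrans (invariant_muE _ A)); apply: esym; apply: (etrans (invariant_muE _ A)).
have iC : v_invariant (fun z => (G z)%:C) by move=> k z; rewrite iG.
by rewrite (v_invariant_dfun _ iC).
Qed.

Lemma invariant_conj_mu A : v_invariant (fun y => (mu G y 0 A)^*).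
Proof. by move=> h y; refine (congr1 (@conjc R) (invariant_mu A h y)). Qed.

Lemma invariant_levE y A B : lev G y A B =
  dfun (fun z => (mu G z 0 B)^*) y (row A Ez) - dfun (fun z => mu G z 0 A) y (row B Ezb).
Proof.
have vA : dfun (fun z => mu G z 0 A) y Ev = 0.
  by rewrite dfun_Ev; exact: v_invariant_cpd0 (invariant_mu A).
have vB : dfun (fun z => (mu G z 0 B)^*) y Ev = 0.
  by rewrite dfun_Ev; exact: v_invariant_cpd0 (invariant_conj_mu B).
refine (etrans (levE G y A B) (congr2 (fun a b : C => a - b) _ _)).
  by rewrite vB mulr0 addr0.
by rewrite vA mulr0 addr0.
Qed.

Lemma invariant_lev : v_invariant (lev G).
Proof.
move=> h y; apply/matrixP => A B.
have ib := invariant_conj_mu B.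
apply: (etrans (invariant_levE _ A B)); apply: esym; apply: (etrans (invariant_levE _ A B)).
exact: (congr2 (fun a b : C => a - b) (esym (v_invariant_dfun _ ib h y)) (esym (v_invariant_dfun _ (invariant_mu A) h y))).
Qed.

Hypothesis sG : smooth_near 0 G.
Hypothesis hG : homogeneous w 0 2 G.

Lemma chom_mu A : chom (wA A) 2 (fun y => mu G y 0 A).
Proof.
have h := chom_Ez A (csm_real sG) (chom_real hG).
rewrite (_ : (fun y => _) = (fun y => ii^-1 * dfun (fun z => (G z)%:C) y (row A Ez)
   + 0 * dfun (fun z => (G z)%:C) y (row A Ez))); first exact: chom_lin.
by apply/funext => y; rewrite invariant_muE mul0r addr0.
Qed.

Lemma chom_lev A B : chom (wA A + wA B) 2 (fun y => lev G y A B).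
Proof.
have sm A' : csm 0 (fun y => mu G y 0 A') := csm_mu sG 0 A'.
rewrite (_ : (fun y => _) = (fun y => 1 * dfun (fun z => (mu G z 0 B)^*) y (row A Ez)
  + (-1) * dfun (fun z => mu G z 0 A) y (row B Ezb))).
  apply: chom_lin; first by rewrite addnC; apply: chom_Ez; [exact: csm_conj|apply/chom_conj/chom_mu].
  by apply: chom_Ezb; [|exact: chom_mu].
by apply/funext => y; rewrite invariant_levE mul1r mulN1r.
Qed.

Lemma scale_schur (K : fieldType) (t : K) (M N : 'M[K]_(s + m)) : t != 0 ->
  ulsubmx M = ulsubmx N -> dlsubmx M = t *: dlsubmx N -> ursubmx M = t *: ursubmx N ->
  drsubmx M = t ^+ 2 *: drsubmx N -> schur M = t ^+ 2 *: schur N.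
Proof.
move=> t0 e1 e2 e3 e4; rewrite /schur /acoef e1 e2 e3 e4 -scalerN -!scalemxAl -scalemxAr.
by rewrite scalerA -expr2 scalerDr.
Qed.

(** The entry (A, B) of the Levi matrix is homogeneous of degree
    2 - wA A - wA B: the blocks have degrees 0, 1, 1, 2, and elimination respects
    these degrees. *)
Lemma lev_scale : \forall y \near (0 : 'rV[R]_d), forall t : R, 0 < t <= 1 ->
  schur (lev G (scale w t y)) = (t%:C) ^+ 2 *: schur (lev G y).
Proof.
have H : forall AB : 'I_n * 'I_n, \forall y \near (0 : 'rV[R]_d), forall t : R, 0 < t <= 1 ->
    (t ^+ (wA AB.1 + wA AB.2))%:C * lev G (scale w t y) AB.1 AB.2 = (t ^+ 2)%:C * lev G y AB.1 AB.2.
  by move=> [A B]; exact: chom_lev.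
have H' := filter_forall (nbhs_filter (0 : 'rV[R]_d)) H.
apply: filterS H' => y hy t t01.
have t0 : t%:C != 0.
  by have /andP[/gt_eqF t0 _] := t01; rewrite eq_complex /= eqxx andbT t0.
have e A B := hy (A, B) t t01; move: e => /= e.
have c1 (M N : 'M[C]_(s + m)) : (forall A B : 'I_n, (t ^+ (wA A + wA B))%:C * M A B = (t ^+ 2)%:C * N A B) ->
    schur M = (t%:C) ^+ 2 *: schur N.
  move=> E; apply: scale_schur => //; apply/matrixP => i j; rewrite ?ulE ?dlE ?urE ?drE.
  - have := E (lshift m i) (lshift m j); rewrite !wA_z.
    by move/mulfI; apply; rewrite rmorphXn expf_neq0.
  - rewrite [RHS]mxE dlE; have := E (rshift s i) (lshift m j); rewrite wA_z wA_zeta add0n.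
    by rewrite expr1 expr2 rmorphM -mulrA; move/(mulfI t0).
  - rewrite [RHS]mxE urE; have := E (lshift m i) (rshift s j); rewrite wA_z wA_zeta addn0.
    by rewrite expr1 expr2 rmorphM -mulrA; move/(mulfI t0).
  - rewrite [RHS]mxE drE; have := E (rshift s i) (rshift s j); rewrite !wA_zeta addn0.
    by rewrite expr0 mul1r rmorphXn.
exact: c1.
Qed.
End invariant.

(** Homogeneity of degree 2 turns the bound t^3 into |g y| <= B t. *)
Lemma scaling_vanish (g : 'rV[R]_d -> R) : wt0 w 3 g ->
  (\forall y \near (0 : 'rV[R]_d), forall t : R, 0 < t <= 1 -> g (scale w t y) = t ^+ 2 * g y) ->
  \forall y \near (0 : 'rV[R]_d), g y = 0.
Proof.
move=> [B gB] hg; apply: filterS2 gB hg => y gBy hy.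
apply/eqP; rewrite -normr_le0; apply/ler_addgt0Pr => e e0; rewrite add0r.
pose t : R := Num.min 1 (e / (`|B| + 1)).
have B1 : 0 < `|B| + 1 by rewrite ltr_pwDr.
have t0 : 0 < t by rewrite lt_min ltr01 divr_gt0.
have t1 : t <= 1 by rewrite ge_min lexx.
have t01 : 0 < t <= 1 by rewrite t0 t1.
have := gBy t t01; rewrite hy// normrM ger0_norm ?exprn_ge0 ?(ltW t0)//.
rewrite (_ : B * t ^+ 3 = t ^+ 2 * (B * t)); last by ring.
rewrite ler_pM2l ?exprn_gt0// => /le_trans; apply.
rewrite (le_trans (ler_wpM2r (ltW t0) (ler_norm B)))//.
apply: (@le_trans _ _ ((`|B| + 1) * t)); first by rewrite ler_wpM2r ?(ltW t0)// lerDl.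
by rewrite mulrC -ler_pdivlMr// ge_min lexx orbT.
Qed.

Lemma cscaling_vanish (f : 'rV[R]_d -> C) : cW w 0 3 f ->
  (\forall y \near (0 : 'rV[R]_d), forall t : R, 0 < t <= 1 -> f (scale w t y) = (t ^+ 2)%:C * f y) ->
  \forall y \near (0 : 'rV[R]_d), f y = 0.
Proof.
move=> [[_ Wr] [_ Wi]] sE.
have nr := scaling_vanish (wge0 Wr); have ni := scaling_vanish (wge0 Wi).
have reM (t : R) (z : C) : reC (t%:C * z) = t * reC z by case: z => u v /=; rewrite mul0r subr0.
have imM (t : R) (z : C) : imC (t%:C * z) = t * imC z by case: z => u v /=; rewrite mul0r addr0.
apply: filterS2 (nr _) (ni _).
- by move=> y e1 e2; apply/eqP; rewrite eq_complex e1 e2 eqxx.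
- by apply: filterS sE => y hy t t01; rewrite hy// reM.
- by apply: filterS sE => y hy t t01; rewrite hy// imM.
Qed.

Section two.
Variables (F F0 : 'rV[R]_d -> R).
Hypothesis WF : forall N, W w N 2 F.
Hypothesis WF0 : forall N, W w N 2 F0.
Hypothesis WQ : forall N, W w N 3 (fun x => F x - F0 x).
Hypothesis u0 : ulsubmx (lev F0 0) \in unitmx.
Hypothesis iF0 : v_invariant F0.
Hypothesis hF0 : homogeneous w 0 2 F0.
Hypothesis gF : \forall y \near (0 : 'rV[R]_d), good F y.

(** The Schur complement of the model is homogeneous of degree 2 and agrees to
    order 3 with that of the hypersurface, which is zero. *)
Lemma model_good : \forall y \near (0 : 'rV[R]_d), good F0 y.
Proof.
have nu := near_ul_unit WF0 u0.
have W3 : cWmx 0 3 (fun x => schur (lev F0 x)).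
  apply: (@cWmx_ext _ _ _ _ _ _ _ (fun x => - (schur (lev F x) - schur (lev F0 x)))).
    have e (V : zmodType) (a b : V) : a = 0 -> - (a - b) = b by move=> ->; rewrite sub0r opprK.
    by apply: filterS gF => y [_ Sy]; refine (e _ _ _ Sy).
  by apply: cWmx_opp; exact: cWmx_schur_sub.
have sc := lev_scale iF0 (WF0 0).1 hF0.
have H : forall ij : 'I_m * 'I_m, \forall y \near (0 : 'rV[R]_d), schur (lev F0 y) ij.1 ij.2 = 0.
  move=> [i j] /=; apply: (cscaling_vanish (W3 i j)).
  have e (M N : 'M[C]_m) a : M = a *: N -> M i j = a * N i j by move=> ->; rewrite mxE.
  have e2 (t : R) : (t ^+ 2)%:C = t%:C ^+ 2 by rewrite rmorphXn.
  by apply: filterS sc => y hy t t01; rewrite e2; refine (e _ _ _ (hy t t01)).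
have H' := filter_forall (nbhs_filter (0 : 'rV[R]_d)) H.
by apply: filterS2 nu H' => y uy Hy; split=> //; apply/matrixP => i j; rewrite (Hy (i, j)) mxE.
Qed.

(** The differentiated entries of the zeta-rows differ by order 3 - wA B, and
    one more derivative along conj z or conj zeta leaves a positive order. *)
Lemma near_dlev : \forall x \near (0 : 'rV[R]_d), leaf w x -> forall al B A,
  dfun (fun y => lev F y (rshift s al) B) x (row A Ezb) =
  dfun (fun y => lev F0 y (rshift s al) B) x (row A Ezb).
Proof.
have H : forall k : 'I_m * ('I_n * 'I_n), \forall x \near (0 : 'rV[R]_d), leaf w x ->
  dfun (fun y => lev F y (rshift s k.1) k.2.1) x (row k.2.2 Ezb) =
  dfun (fun y => lev F0 y (rshift s k.1) k.2.1) x (row k.2.2 Ezb).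
  move=> [al [B A]] /=.
  have sl G : (forall N, W w N 2 G) -> csm 0 (fun y => lev G y (rshift s al) B).
    by move=> WG; exact: (csm_lev (WG 0%N).1 (rshift s al) B).
  have e := near_dfun_sub (fun=> row A Ezb) (sl _ WF) (sl _ WF0).
  have := cW_Ezb A (cW_lev_sub WF WF0 WQ 1 (rshift s al) B).
  move/cW_leaf => h; apply: filterS2 e (h _).
    by move=> x ex hx lx; apply/eqP; rewrite -subr_eq0; apply/eqP; refine (etrans ex (hx lx)).
  by rewrite wA_zeta; have := wA_le1 A; have := wA_le1 B; case: (wA A) => [|[]]//; case: (wA B) => [|[]].
have H' := filter_forall (nbhs_filter (0 : 'rV[R]_d)) H.
by apply: filterS H' => x hx lx al B A; exact: (hx (al, (B, A)) lx).
Qed.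

Lemma near_agree : \forall x \near (0 : 'rV[R]_d), leaf w x ->
  [/\ leaf_pt F x, leaf_pt F0 x, lev F x = lev F0 x &
      forall al B A, dfun (fun y => lev F y (rshift s al) B) x (row A Ezb) =
        dfun (fun y => lev F0 y (rshift s al) B) x (row A Ezb)].
Proof.
have n1 := near_leaf_pt WF gF; have n2 := near_leaf_pt WF0 model_good.
have n3 := lev_leaf WF WF0 WQ; have n4 := near_dlev.
apply: filterS2 (filterI n1 n2) (filterI n3 n4) => x [a b] [c e] lx.
refine (And4 (a lx) (b lx) (c lx) (e lx)).
Qed.

(** Freeness of the rows of [iota_mx] is an open condition, and at the origin
    it holds for the model because it holds for the hypersurface. *)
Lemma model_nondegenerate : (0 < m)%N ->
  (forall v, K2 (graph_CR F) 0 v ->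
    (forall u, bar (graph_CR F) 0 u -> iota2 (graph_CR F) 0 v u 0) -> v = 0) ->
  uniformly_2nondegenerate (graph_CR F0) m 0.
Proof.
move=> m0 inj; split=> //.
have g0 := model_good; have s0 := smooth_near_near (WF0 0).1.
have [l1 l2 l3 l4] := nbhs_singleton near_agree (@leaf0 R s m).
have f0 : row_free (iota_mx F0 0).
  apply/(iota_inj (WF0 0).1 g0) => v Kv hv; apply: inj.
    by rewrite (agree_K2 l1 l2).
  move=> u Hu; apply/(agree_iota2 l1 l2 l3 l4); apply: hv.
  by rewrite -(agree_barCR l1 l2).
(* Multiplying by a right inverse at the origin turns freeness of the rows into
   the invertibility of a square matrix, which is an open condition. *)
have [K iK] := row_freeP f0.
have nu : \forall y \near (0 : 'rV[R]_d), iota_mx F0 y *m K \in unitmx.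
  apply: (near_unitmx (A := fun y => iota_mx F0 y *m K)); last by rewrite iK unitmx1.
  move=> i j; apply: (@csm_mulmx _ _ _ _ _ _ (iota_mx F0) (fun=> K)) => [|a b].
    exact: csm_iota_mx WF0 g0.
  exact: csm_cst.
apply: filterS2 (filterI s0 (near_interior g0)) nu => y [sy gy] uy.
split; first exact: good_dim (nbhs_singleton gy).
apply/(iota_inj sy gy); apply/row_freeP; exists (K *m invmx (iota_mx F0 y *m K)).
by rewrite mulmxA mulmxV.
Qed.
End two.
End leaf_geometry.

(** * Quotients by a foliation along a leaf *)

Section foliation.
Variables (R : realType) (d : nat) (w : 'I_d -> nat).
Implicit Types (f g Phi : 'rV[R]_d -> R) (x : 'rV[R]_d).

Lemma near_ray (A : set 'rV[R]_d) : (\forall x \near (0 : 'rV[R]_d), A x) ->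
  \forall x \near (0 : 'rV[R]_d), forall t : R, t \in `[0, 1]%R -> A (t *: x).
Proof.
move=> /nbhs_ballP[r /= r0 rA].
have nr : \forall x \near (0 : 'rV[R]_d), `|x| < r by exact: nbhs0_lt.
apply: filterS nr => x xr t; rewrite in_itv/= => /andP[t0 t1]; apply: rA.
rewrite -ball_normE/= sub0r normrN normrZ ger0_norm//.
by apply: le_lt_trans xr; exact: ler_piMl.
Qed.

Lemma leaf_scale x t : leaf w x -> leaf w (t *: x).
Proof. by move=> lx i wi; rewrite mxE lx// mulr0. Qed.

Lemma schwarz_near f p i j : smooth_near p f -> pd j (pd i f) p = pd i (pd j f) p.
Proof.
move=> /smooth_nearP[U [oU Up sf]]; exact: (schwarz_pd i j oU Up (sf 1%N)).
Qed.

(** First integrals of the frame V. *)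
Definition killed (V : 'I_d -> 'I_d -> 'rV[R]_d -> R) Phi :=
  smooth_near 0 Phi /\
  \forall x \near (0 : 'rV[R]_d), forall l, \sum_j V l j x * pd j Phi x = 0.

(** A frame of a foliation having the weight 0 subspace as a leaf, indexed
    redundantly by all coordinates: on the leaf the combination of the V_l with the
    components of a tangent vector is this vector. By [ad_pd] transverse
    derivatives of the frame only have components of weight 1, which closes the
    equations of [killed_derive]. *)
Record adapted (V : 'I_d -> 'I_d -> 'rV[R]_d -> R) : Prop := Adapted {
  ad_smooth : forall l j, smooth_near 0 (V l j);
  ad_leaf : \forall x \near (0 : 'rV[R]_d), leaf w x -> forall (e : 'rV[R]_d),
    leaf w e -> forall j, \sum_l e 0 l * V l j x = e 0 j;
  ad_pd : \forall x \near (0 : 'rV[R]_d), leaf w x -> forall l j i, (0 < w i)%N ->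
    w j != 1%N -> pd i (V l j) x = 0 }.

(** The equations V_l Phi = 0 are differentiated in the transverse direction i
    and combined so that V becomes the tangent vector e. *)
Lemma killed_derive V Phi : adapted V -> killed V Phi ->
  \forall x \near (0 : 'rV[R]_d), leaf w x -> forall e : 'rV[R]_d, leaf w e ->
    forall i, (0 < w i)%N ->
    \sum_j e 0 j * pd j (pd i Phi) x =
    - \sum_(j | w j == 1%N) (\sum_l e 0 l * pd i (V l j) x) * pd j Phi x.
Proof.
move=> aV [sP kP].
have nV : \forall x \near (0 : 'rV[R]_d), forall lj : 'I_d * 'I_d, smooth_near x (V lj.1 lj.2).
  apply: (filter_forall (nbhs_filter (0 : 'rV[R]_d))) => -[l j] /=.
  by apply: smooth_near_near; exact: ad_smooth.
apply: filterS2 (filterI nV (smooth_near_near sP)) (filterI (near_interior kP) (filterI (ad_leaf aV) (ad_pd aV))).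
move=> x [sV sPx] [kPx [lV pV]] lx e le i wi.
have E l : \sum_j (V l j x * pd j (pd i Phi) x + pd j Phi x * pd i (V l j) x) = 0.
  have dV j : differentiable (V l j) x by exact: (smooth_near_diff1 (sV (l, j))).
  have dP j : differentiable (pd j Phi) x by exact: smooth_near_diff1 (smooth_near_pd j sPx).
  have main (r : seq 'I_d) : pd i (fun y => \sum_(j <- r) V l j y * pd j Phi y) x =
      \sum_(j <- r) (V l j x * pd j (pd i Phi) x + pd j Phi x * pd i (V l j) x) /\
      differentiable (fun y => \sum_(j <- r) V l j y * pd j Phi y) x.
    elim: r => [|j r [IH IHd]].
      rewrite (_ : (fun y => _) = (fun=> 0)); last by apply/funext => y; rewrite big_nil.
      by rewrite pd_cst big_nil; split=> //; exact: differentiable_cst.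
    rewrite (_ : (fun y => _) = (fun y => V l j y * pd j Phi y + \sum_(j <- r) V l j y * pd j Phi y)); last first.
      by apply/funext => y; rewrite big_cons.
    split; last by apply: differentiableD => //; exact: differentiableM.
    rewrite pdD//; last exact: differentiableM.
    rewrite big_cons; refine (congr2 (fun a b : R => a + b) _ IH).
    refine (etrans (pdM i (dV j) (dP j)) _).
    refine (congr1 (fun a : R => V l j x * a + pd j Phi x * pd i (V l j) x) (schwarz_near j i sPx)).
  rewrite -(main _).1 (@pd_near _ _ _ (fun=> 0)) ?pd_cst//.
  by apply: filterS kPx => y /(_ l).
have : \sum_l e 0 l * \sum_j (V l j x * pd j (pd i Phi) x + pd j Phi x * pd i (V l j) x) = 0.
  by rewrite big1// => l _; rewrite E mulr0.
under eq_bigr do rewrite mulr_sumr.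
rewrite exchange_big/=.
under eq_bigr => j _.
  under eq_bigr do rewrite mulrDr mulrA.
  rewrite big_split/= -mulr_suml lV//.
  under [X in _ + X]eq_bigr do rewrite mulrCA.
  rewrite -mulr_sumr mulrC.
  over.
rewrite big_split/= => /eqP; rewrite addr_eq0 => /eqP E2.
under eq_bigr do rewrite mulrC.
rewrite E2 (bigID (fun j => w j == 1%N))/= [X in _ + X]big1 ?addr0.
  by congr (- _); apply: eq_bigr => j _; rewrite mulrC.
by move=> j wj; rewrite big1 ?mulr0// => l _; rewrite pV ?mulr0.
Qed.

Lemma ode_sum (P : pred 'I_d) (A A0 p q : 'I_d -> R) : (forall j, P j -> A j = A0 j) ->
  - (\sum_(j | P j) A j * p j) - - (\sum_(j | P j) A0 j * q j) =
  \sum_j (if true && P j then - A j else 0) * (if P j then p j - q j else 0).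
Proof.
move=> AA; rewrite opprK addrC -sumrB big_mkcond; apply: eq_bigr => j _ /=.
by case: ifP => Pj; rewrite ?mulr0// AA// -mulrBr mulNr -mulrN opprB.
Qed.

(** Along a ray in the leaf, the first derivatives in the directions of weight
    1 of a function killed by an adapted frame satisfy a linear differential
    equation whose coefficients are the derivatives of the frame. *)
Lemma killed_unique V V0 Phi Phi0 : adapted V -> adapted V0 ->
  (\forall x \near (0 : 'rV[R]_d), leaf w x -> forall l j i, w i = 1%N -> w j = 1%N ->
    pd i (V l j) x = pd i (V0 l j) x) ->
  killed V Phi -> killed V0 Phi0 ->
  (forall i, w i = 1%N -> pd i Phi 0 = pd i Phi0 0) ->
  \forall x \near (0 : 'rV[R]_d), leaf w x -> forall i, w i = 1%N ->
    pd i Phi x = pd i Phi0 x.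
Proof.
move=> aV aV0 VV0 kP kP0 E0.
have [B B0 nB] : exists2 B : R, 0 < B & \forall x \near (0 : 'rV[R]_d),
    \sum_i \sum_j \sum_l `|pd i (V l j) x| <= B.
  have bd i j l : exists B : R, \forall x \near (0 : 'rV[R]_d), `|pd i (V l j) x| <= B.
    by apply: smooth_near_bounded; apply: smooth_near_pd; exact: ad_smooth.
  have /choice[b bP] : forall k : 'I_d * ('I_d * 'I_d), exists B : R, \forall x \near (0 : 'rV[R]_d),
      `|pd k.1 (V k.2.2 k.2.1) x| <= B by move=> [i [j l]]; exact: bd.
  exists (\sum_i \sum_j \sum_l `|b (i, (j, l))| + 1).
    by rewrite ltr_wpDl//; do 3 (apply: sumr_ge0 => ? _).
  have bP' := filter_forall (nbhs_filter (0 : 'rV[R]_d)) bP.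
  apply: filterS bP' => x bx; rewrite ler_wpDr//.
  apply: ler_sum => i _; apply: ler_sum => j _; apply: ler_sum => l _.
  by rewrite (le_trans (bx (i, (j, l))))// ler_norm.
(* On rays of this length the coefficients of the equation stay below 1/2. *)
have nsm : \forall x \near (0 : 'rV[R]_d), `|x| < (2 * B)^-1.
  by apply: nbhs0_lt; rewrite invr_gt0 mulr_gt0.
have r1 := near_ray (killed_derive aV kP); have r2 := near_ray (killed_derive aV0 kP0).
have r3 := near_ray nB; have r4 := near_ray VV0.
have r5 := near_ray (smooth_near_near kP.1); have r6 := near_ray (smooth_near_near kP0.1).
apply: filterS2 (filterI (filterI r1 r2) (filterI r3 r4)) (filterI nsm (filterI r5 r6)).
move=> x [[h1 h2] [h3 h4]] [xB [h5 h6]] lx.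
pose u (i : 'I_d) (t : R) : R := if w i == 1%N then pd i Phi (t *: x) - pd i Phi0 (t *: x) else 0.
pose Cf (i j : 'I_d) (t : R) : R := if (w i == 1%N) && (w j == 1%N)
  then - \sum_l x 0 l * pd i (V l j) (t *: x) else 0.
have key := @lin_ode_unique R 'I_d u Cf.
suff uz : forall i (t : R), t \in `[0, 1]%R -> u i t = 0.
  move=> i wi; have := uz i 1; rewrite /u wi eqxx scale1r => /(_ _)/eqP.
  by rewrite subr_eq0 => /(_ _)/eqP; apply; rewrite in_itv/= ler01 lexx.
apply: key.
- move=> i t t01; rewrite /u /Cf; have [wi|wi] := boolP (w i == 1%N); last first.
    rewrite [X in is_derive _ _ _ X]big1 => [|j _]; last by rewrite mul0r.
    exact: is_derive_cst.
  have wi0 : (0 < w i)%N by rewrite (eqP wi).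
  have line Psi : smooth_near (t *: x) Psi ->
      is_derive t 1 (fun r : R => pd i Psi (r *: x)) (\sum_j x 0 j * pd j (pd i Psi) (t *: x)).
    move=> sPsi; have := @derive_line R d (pd i Psi) 0 x t.
    rewrite add0r => /(_ (smooth_near_diff1 (smooth_near_pd i sPsi))).
    by rewrite (_ : (fun r : R => pd i Psi (0 + r *: x)) = (fun r : R => pd i Psi (r *: x)))//;
      apply/funext => r; rewrite add0r.
  have D := is_deriveB (line _ (h5 t t01)) (line _ (h6 t t01)).
  rewrite (_ : (fun=> _) = (fun r : R => pd i Phi (r *: x)) - (fun r : R => pd i Phi0 (r *: x)))//.
  apply: is_derive_eq D _; have lt := leaf_scale t lx.
  refine (etrans (congr2 (fun a b : R => a - b) (h1 t t01 lt x lx i wi0) (h2 t t01 lt x lx i wi0)) _).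
  apply: ode_sum => j wj.
  by apply: eq_bigr => l _; rewrite (h4 t t01 lt l j i (eqP wi) (eqP wj)).
- move=> i t t01; apply: (@le_trans _ _ (`|x| * \sum_j \sum_l `|pd i (V l j) (t *: x)|)).
    rewrite mulr_sumr; apply: ler_sum => j _; rewrite /Cf; case: ifP => _; last first.
      by rewrite normr0 mulr_ge0// sumr_ge0.
    rewrite normrN (le_trans (ler_norm_sum _ _ _))// mulr_sumr.
    by apply: ler_sum => l _; rewrite normrM ler_wpM2r// norm_coord_le.
  have Bi : \sum_j \sum_l `|pd i (V l j) (t *: x)| <= B.
    apply: le_trans (h3 t t01); rewrite [leRHS](bigD1 i)//= lerDl.
    by do 3 (apply: sumr_ge0 => ? _).
  rewrite (le_trans (ler_wpM2l (normr_ge0 x) Bi))//.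
  rewrite (le_trans (ler_wpM2r (ltW B0) (ltW xB)))// invfM mulrVK//.
  by rewrite unitfE gt_eqF.
- by move=> i; rewrite /u scale0r; case: ifP => // /eqP wi; rewrite E0 ?subrr.
Qed.

Section quotient.
Variables (k : nat).
Implicit Types (quo : 'rV[R]_d -> 'rV[R]_k).

Definition jac quo q : 'M[R]_(d, k) := \matrix_(i, j) pd i (fun y => quo y 0 j) q.
Definition cjac quo q : 'M[R[i]]_(d, k) := map_mx (real_complex R) (jac quo q).

Lemma dmapE quo q (X : 'rV[R[i]]_d) : dmap quo q X = X *m cjac quo q.
Proof.
apply/rowP => j; rewrite [LHS]mxE [RHS]mxE; apply: eq_bigr => i _; congr (_ * _).
by rewrite [RHS]mxE [X in _ = X%:C]mxE /= pd_cst.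
Qed.

Lemma complexify_mul l p (X : 'rV[R]_l) (M : 'M[R]_(l, p)) :
  complexify X *m map_mx (real_complex R) M = complexify (X *m M).
Proof. by rewrite /complexify map_mxM. Qed.

Lemma complexify_eq0 l (X : 'rV[R]_l) : complexify X = 0 <-> X = 0.
Proof.
split=> [/rowP E|->]; last by apply/rowP => j; rewrite !mxE.
by apply/rowP => j; have := E j; rewrite !mxE => -[].
Qed.

(** The data used of a local quotient: it is smooth, submersive, and its fibres
    are tangent to D, which on the leaf is spanned by the coordinates of weight
    0 and near it contains an adapted frame. *)
Record quotient_at (D : distribution R d) (V : 'I_d -> 'I_d -> 'rV[R]_d -> R) quo : Prop := QuotientAt {
  qa_smooth : forall j, smooth_near 0 (fun q => quo q 0 j);
  qa_surj : \forall q \near (0 : 'rV[R]_d), forall Y, exists X, dmap quo q X = Y;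
  qa_ker : \forall q \near (0 : 'rV[R]_d), forall X : 'rV[R]_d,
    dmap quo q (complexify X) = 0 <-> D q (complexify X);
  qa_leaf : \forall q \near (0 : 'rV[R]_d), leaf w q -> forall X : 'rV[R[i]]_d,
    D q X <-> forall i, (0 < w i)%N -> X 0 i = 0;
  qa_adapted : adapted V;
  qa_frame : \forall q \near (0 : 'rV[R]_d), forall l, D q (complexify (\row_j V l j q)) }.

Lemma leaf_0 : leaf w (0 : 'rV[R]_d). Proof. by move=> i _; rewrite mxE. Qed.

Section one_quotient.
Variables (D : distribution R d) (V : 'I_d -> 'I_d -> 'rV[R]_d -> R) (quo : 'rV[R]_d -> 'rV[R]_k) (v0 : 'I_d).
Hypothesis qa : quotient_at D V quo.

Lemma jac_ker : \forall q \near (0 : 'rV[R]_d), leaf w q -> forall X : 'rV[R]_d,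
  X *m jac quo q = 0 <-> forall i, (0 < w i)%N -> X 0 i = 0.
Proof.
apply: filterS2 (qa_ker qa) (qa_leaf qa) => q kq lq leafq X.
rewrite -complexify_eq0 -complexify_mul -[_ *m _]/(_ *m cjac quo q) -dmapE kq lq//.
split=> h i wi; last by rewrite mxE h.
by have := h i wi; rewrite mxE => -[].
Qed.

Lemma jac_row0 : \forall q \near (0 : 'rV[R]_d), leaf w q -> forall i, w i = 0%N ->
  row i (jac quo q) = 0.
Proof.
apply: filterS jac_ker => q kq lq i wi; rewrite rowE; apply/kq => // j wj.
by rewrite mxE eqxx /=; case: eqP => // ij; rewrite ij wi in wj.
Qed.

Lemma jac_section : exists G : 'M[R]_(k, d), G *m jac quo 0 = 1%:M.
Proof.
have /choice[f fP] : forall j : 'I_k, exists X : 'rV[R]_d, X *m jac quo 0 = delta_mx 0 j.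
  move=> j; have [X XE] := nbhs_singleton (qa_surj qa) (complexify (delta_mx 0 j)).
  exists (map_mx (@complex.Re R) X); apply/rowP => l.
  have /rowP/(_ l) := XE; rewrite dmapE => /(congr1 (@complex.Re R)).
  rewrite [complexify _ _ _]mxE /= => <-; rewrite [LHS]mxE [in RHS]mxE raddf_sum.
  apply: eq_bigr => i _; rewrite [map_mx _ X _ _]mxE [cjac _ _ _ _]mxE.
  by case: (X 0 i) => a b /=; rewrite mulr0 subr0.
exists (\matrix_j f j); apply/row_matrixP => j; rewrite row_mul rowK fP.
by rewrite rowE mulmx1.
Qed.

(** The composite of the differential at the origin and a section of it is the
    identity up to the directions of weight 0. *)
Lemma jac_section_ker G : G *m jac quo 0 = 1%:M -> forall i j, (0 < w j)%N ->
  (jac quo 0 *m G) i j = (i == j)%:R.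
Proof.
move=> GE i j wj; have := (nbhs_singleton jac_ker leaf_0 (row i (jac quo 0 *m G - 1%:M))).1.
rewrite -row_mul mulmxBl -mulmxA GE mulmx1 mul1mx subrr row0 => /(_ erefl j wj).
by rewrite !mxE => /eqP; rewrite subr_eq0 => /eqP.
Qed.

Definition comb (c : 'cV[R]_k) (x : 'rV[R]_d) : R := (quo x *m c) 0 0.

Lemma combE c : comb c = fun x => \sum_(j <- enum 'I_k) c j 0 * quo x 0 j.
Proof. by apply/funext => x; rewrite /comb mxE big_enum; apply: eq_bigr => j _; rewrite mulrC. Qed.

Lemma smooth_comb c : smooth_near 0 (comb c).
Proof.
rewrite combE; elim: (enum 'I_k) => [|j r IH].
  apply: smooth_near_ext (smooth_near_cst _ 0); apply: filterE => x; by rewrite big_nil.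
apply: smooth_near_ext (smooth_near_add (smooth_near_mul (smooth_near_cst _ (c j 0)) (qa_smooth qa j)) IH).
by apply: filterE => x; rewrite big_cons.
Qed.

Lemma near_quo_diff : \forall x \near (0 : 'rV[R]_d), forall j, differentiable (fun q => quo q 0 j) x.
Proof.
apply: (filter_forall (nbhs_filter (0 : 'rV[R]_d))) => j.
exact: smooth_near_diff (qa_smooth qa j).
Qed.

Lemma pd_comb c x : (forall j, differentiable (fun q => quo q 0 j) x) ->
  forall i, pd i (comb c) x = (jac quo x *m c) i 0.
Proof.
move=> dq i; rewrite combE mxE -big_enum.
suff : pd i (fun x => \sum_(j <- enum 'I_k) c j 0 * quo x 0 j) x = \sum_(j <- enum 'I_k) jac quo x i j * c j 0 /\
    differentiable (fun x => \sum_(j <- enum 'I_k) c j 0 * quo x 0 j) x by case.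
elim: (enum 'I_k) => [|j r [IH IHd]].
  rewrite (_ : (fun x => _) = (fun=> 0)); last by apply/funext => y; rewrite big_nil.
  by rewrite pd_cst big_nil; split=> //; exact: differentiable_cst.
have dc : differentiable (fun _ : 'rV[R]_d => c j 0) x by exact: differentiable_cst.
have dj : differentiable (fun y => c j 0 * quo y 0 j) x by exact: differentiableM.
rewrite (_ : (fun x => _) = (fun y => c j 0 * quo y 0 j + \sum_(l <- r) c l 0 * quo y 0 l)); last first.
  by apply/funext => y; rewrite big_cons.
split; last exact: differentiableD.
rewrite pdD// IH big_cons pdM// pd_cst mulr0 addr0; congr (_ + _).
by rewrite mulrC [in RHS]mxE.
Qed.

Lemma killed_comb c : killed V (comb c).
Proof.
split; first exact: smooth_comb.
apply: filterS2 near_quo_diff (filterI (qa_ker qa) (qa_frame qa)) => x dx [kx fx] l.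
have : (\row_j V l j x *m jac quo x *m c) 0 0 = 0.
  have /complexify_eq0 -> : complexify (\row_j V l j x *m jac quo x) = 0.
    by rewrite -complexify_mul -[_ *m _]/(_ *m cjac quo x) -dmapE; apply/kx; exact: fx.
  by rewrite mul0mx mxE.
rewrite -mulmxA mxE => E; rewrite -[RHS]E; apply: eq_bigr => j _.
by rewrite pd_comb// [X in _ = X * _]mxE.
Qed.

(** The quotient is constant on the leaf since its differential kills the
    directions of weight 0 there. Conversely, if q and its projection to the leaf
    have the same image, the mean value theorem applied to components of the
    quotient that are close to the transverse coordinates bounds the displacement
    by half of itself. *)
Lemma fibre_leaf : \forall q \near (0 : 'rV[R]_d), quo q = quo 0 <-> leaf w q.
Proof.
have [G GE] := jac_section.
(* Components of the quotient whose differentials at the origin are the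
   transverse coordinates. *)
pose psi i := comb (col i G).
have psi0 i j : (0 < w i)%N -> pd j (psi i) 0 = (j == i)%:R.
  move=> wi; rewrite (pd_comb (col i G) (nbhs_singleton near_quo_diff)).
  by rewrite -(jac_section_ker GE j wi) [LHS]mxE [RHS]mxE; apply: eq_bigr => l _; rewrite [col _ _ _ _]mxE.
(* Summed over the d coordinates, errors of this size contribute at most half
   of the displacement. *)
have D0 : (0 : R) < (2 * d.+1%:R)^-1 by rewrite invr_gt0 mulr_gt0.
have npd : \forall x \near (0 : 'rV[R]_d), forall ij : 'I_d * 'I_d, (0 < w ij.1)%N ->
    `|pd ij.2 (psi ij.1) x - (ij.2 == ij.1)%:R| <= (2 * d.+1%:R)^-1.
  apply: (filter_forall (nbhs_filter (0 : 'rV[R]_d))) => -[i j] /=.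
  have [wi|_] := boolP (0 < w i)%N; last exact: filterE.
  have := smooth_near_cont (smooth_near_pd j (smooth_comb (col i G))).
  move=> /cvgr_dist_le/(_ _ D0); rewrite -[comb _]/(psi i) psi0//.
  by apply: filterS => x; rewrite distrC.
have [rr /= rr0 rA] : exists2 rr : R, 0 < rr & forall x : 'rV[R]_d, `|x| < rr ->
    [/\ forall j, differentiable (fun q => quo q 0 j) x,
        forall i j, (0 < w i)%N -> `|pd j (psi i) x - (j == i)%:R| <= (2 * d.+1%:R)^-1 &
        leaf w x -> forall i, w i = 0%N -> row i (jac quo x) = 0].
  have FF := nbhs_filter (0 : 'rV[R]_d).
  have := @filterI _ _ FF _ _ near_quo_diff (@filterI _ _ FF _ _ npd jac_row0).
  move=> /nbhs_ballP[rr /= rr0 rA]; exists rr => // x xr.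
  have /rA[a [b c]] : ball (0 : 'rV[R]_d) rr x by rewrite -ball_normE/= sub0r normrN.
  by split=> // i j wi; exact: (b (i, j)).
have leafQ x : `|x| < rr -> leaf w x -> quo x = quo 0.
  move=> xr lx; apply/rowP => j; apply/eqP; rewrite -subr_eq0; apply/eqP.
  have xt (t : R) : t \in `[0, 1]%R -> `|t *: x| < rr.
    rewrite in_itv/= => /andP[t0 t1]; rewrite normrZ ger0_norm//.
    by apply: le_lt_trans xr; exact: ler_piMl.
  have df (t : R) : t \in `[0, 1]%R -> differentiable (fun q => quo q 0 j) (0 + t *: x).
    by rewrite add0r => /xt/rA[].
  have [t t01] := MVT_line df; rewrite add0r => ->.
  rewrite big1// => i _; have [wi|/lx ->] := posnP (w i); last by rewrite mul0r.
  have [_ _ /(_ (leaf_scale t lx) i wi)/rowP/(_ j)] := rA _ (xt t t01).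
  by rewrite !mxE add0r => ->; rewrite mulr0.
have nr : \forall x \near (0 : 'rV[R]_d), `|x| < rr by exact: nbhs0_lt.
apply: filterS nr => q qr; split=> [E|]; last exact: leafQ.
(* The projection of q to the leaf. *)
pose q' : 'rV[R]_d := \row_i (if w i == 0%N then q 0 i else 0).
pose nq := q - q'.
have nE i : nq 0 i = if w i == 0%N then 0 else q 0 i.
  by rewrite !mxE; case: ifP => _; rewrite ?subrr ?subr0.
have q'r : `|q'| < rr.
  apply: le_lt_trans qr; apply: norm_row_le => // i; rewrite mxE.
  by case: ifP => _; rewrite ?normr0// norm_coord_le.
have lq' : leaf w q' by move=> i wi; rewrite mxE gtn_eqF.
have seg (t : R) : t \in `[0, 1]%R -> `|q' + t *: nq| < rr.
  rewrite in_itv/= => /andP[t0 t1]; apply: le_lt_trans qr.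
  have eE i : (q' + t *: nq) 0 i = if w i == 0%N then q 0 i else t * q 0 i.
    rewrite [LHS]mxE [X in X + _]mxE [X in _ + X]mxE nE.
    by case: ifP => _; rewrite ?mulr0 ?addr0 ?add0r.
  apply: norm_row_le => // i; rewrite eE.
  case: ifP => _; first exact: norm_coord_le.
  rewrite normrM ger0_norm//; apply: le_trans (norm_coord_le q i).
  exact: ler_piMl.
have qE : q' + nq = q by rewrite addrC subrK.
have est i : (0 < w i)%N -> `|nq 0 i| <= \sum_j `|nq 0 j| * (2 * d.+1%:R)^-1.
  move=> wi; have dpsi (t : R) : t \in `[0, 1]%R -> differentiable (psi i) (q' + t *: nq).
    move=> /seg/rA[dq _ _]; rewrite /psi combE; elim: (enum 'I_k) => [|j r IH].
      rewrite (_ : (fun x => _) = (fun=> 0)); last by apply/funext => y; rewrite big_nil.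
      exact: differentiable_cst.
    rewrite (_ : (fun x => _) = (fun y => (col i G) j 0 * quo y 0 j + \sum_(l <- r) (col i G) l 0 * quo y 0 l)); last first.
      by apply/funext => y; rewrite big_cons.
    by apply: differentiableD => //; apply: differentiableM => //; exact: differentiable_cst.
  have [t t01] := MVT_line dpsi; rewrite qE /psi /comb E (leafQ _ q'r lq') subrr.
  set xi := q' + t *: nq => /esym E0.
  have -> : nq 0 i = - \sum_j nq 0 j * (pd j (psi i) xi - (j == i)%:R).
    under eq_bigr do rewrite mulrBr.
    rewrite sumrB E0 sub0r opprK (bigD1 i)//= eqxx mulr1 big1 ?addr0// => j ji.
    by rewrite (negbTE ji) mulr0.
  rewrite normrN (le_trans (ler_norm_sum _ _ _))//; apply: ler_sum => j _.
  rewrite normrM ler_wpM2l//; have [_ h _] := rA _ (seg t t01); exact: h.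
pose Sn : R := \sum_i `|nq 0 i|.
have Sn0 : Sn <= 0.
  have : Sn <= \sum_(i < d) Sn * (2 * d.+1%:R)^-1.
    apply: ler_sum => i _; have [wi|wi] := posnP (w i).
      by rewrite nE wi eqxx normr0 mulr_ge0 ?invr_ge0// sumr_ge0.
    by rewrite (le_trans (est i wi))// mulr_suml.
  rewrite sumr_const card_ord -[X in _ <= X]mulr_natr -mulrA => h.
  have : (2 * d.+1%:R)^-1 * d%:R <= 2^-1 :> R.
    rewrite invfM -mulrA ler_piMr// ?invr_ge0//.
    by rewrite mulrC ler_pdivrMr// mul1r ler_nat.
  have Sp : 0 <= Sn by apply: sumr_ge0.
  move: h; move: (_ * d%:R) => c h hc.
  by have := le_trans h (ler_wpM2l Sp hc); lra.
move=> i wi; have : `|nq 0 i| <= Sn by rewrite /Sn (bigD1 i)//= lerDl sumr_ge0.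
by move=> /le_trans/(_ Sn0); rewrite normr_le0 nE gtn_eqF// => /eqP.
Qed.

Hypothesis wv : forall i, w i != 1%N -> (0 < w i)%N -> i = v0.
Hypothesis wv0 : (1 < w v0)%N.

Lemma adapted_zero : killed V (fun=> 0).
Proof.
split; first exact: smooth_near_cst.
by apply: filterE => x l; rewrite big1// => j _; rewrite pd_cst mulr0.
Qed.

(** A component of the quotient with differential dv at the origin has this
    differential along the whole leaf: its derivatives in the directions of weight
    1 vanish by comparison with the zero function in [killed_unique], and then
    [killed_derive] makes its v-derivative constant along rays. *)
Lemma jac_conormal : exists c : 'cV[R]_k, \forall q \near (0 : 'rV[R]_d), leaf w q ->
  jac quo q *m c = delta_mx v0 0.
Proof.
have [G GE] := jac_section; exists (col v0 G); set c := col v0 G.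
have w0 : (0 < w v0)%N by apply: ltn_trans wv0.
have pd0 i : pd i (comb c) 0 = (i == v0)%:R.
  rewrite (pd_comb c (nbhs_singleton near_quo_diff)) -(jac_section_ker GE i w0) [LHS]mxE [RHS]mxE.
  by apply: eq_bigr => l _; rewrite [col _ _ _ _]mxE.
have kc := killed_comb c.
have n1 : \forall x \near (0 : 'rV[R]_d), leaf w x -> forall i, w i = 1%N -> pd i (comb c) x = 0.
  have n0 : \forall x \near (0 : 'rV[R]_d), leaf w x -> forall l j i, w i = 1%N -> w j = 1%N ->
    pd i (V l j) x = pd i (V l j) x by apply: filterE.
  have := killed_unique (qa_adapted qa) (qa_adapted qa) n0 kc adapted_zero _.
  move=> h; apply: filterS (h _) => [x hx lx i wi|i wi]; first by rewrite hx// pd_cst.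
  by rewrite pd0 pd_cst; case: eqP => // iv; move: wv0; rewrite -iv wi.
have r1 := near_ray n1; have r2 := near_ray (killed_derive (qa_adapted qa) kc).
have r3 := near_ray (smooth_near_near kc.1).
apply: filterS2 (filterI r1 r2) (filterI r3 (filterI near_quo_diff jac_row0)).
move=> q [h1 h2] [h3 [dq h4]] lq; apply/matrixP => i j; rewrite ord1 -pd_comb// [RHS]mxE eqxx andbT.
have h1q := h1 1 _; rewrite scale1r in h1q.
have i01 : (1 : R) \in `[0, 1]%R by rewrite in_itv/= ler01 lexx.
have [wi|wi] := posnP (w i).
  rewrite pd_comb// [LHS]mxE big1 => [|l _].
    by case: eqP => // iv; move: wv0; rewrite -iv wi.
  by have /rowP/(_ l) := h4 lq i wi; rewrite !mxE => ->; rewrite mul0r.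
have [/eqP w1|w1] := boolP (w i == 1%N).
  by rewrite h1q//; case: eqP => // iv; move: wv0; rewrite -iv w1.
rewrite (wv w1 wi) eqxx; have df (t : R) : t \in `[0, 1]%R -> differentiable (pd v0 (comb c)) (0 + t *: q).
  by move=> /h3 sc; rewrite add0r; exact: smooth_near_diff1 (smooth_near_pd v0 sc).
have [t t01] := MVT_line df; rewrite add0r pd0 eqxx add0r => E.
apply/eqP; rewrite -subr_eq0 E; apply/eqP.
refine (etrans (h2 t t01 (leaf_scale t lq) q lq v0 w0) _).
by rewrite big1 ?oppr0// => l /eqP wl; rewrite (h1 t t01 (leaf_scale t lq) l wl) mulr0.
Qed.

(** In terms of the conormal of [jac_conormal] the condition compares the
    v-components. *)
Lemma contact_transport : \forall q \near (0 : 'rV[R]_d), leaf w q -> forall X X' : 'rV[R[i]]_d,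
  (exists X'' : 'rV[R[i]]_d, X'' 0 v0 = 0 /\ dmap quo q X - dmap quo 0 X' = dmap quo 0 X'') <-> X 0 v0 = X' 0 v0.
Proof.
have [c nc] := jac_conormal; have [G GE] := jac_section.
have c0 := nbhs_singleton nc leaf_0.
pose cc := map_mx (real_complex R) c.
have cE q : jac quo q *m c = delta_mx v0 0 -> forall Y : 'rV[R[i]]_d, (dmap quo q Y *m cc) 0 0 = Y 0 v0.
  move=> h Y; rewrite dmapE -mulmxA -map_mxM h mxE (bigD1 v0)//= big1 => [|i iv].
    by rewrite !mxE !eqxx mulr1 addr0.
  by rewrite !mxE (negbTE iv) mulr0.
have subE (Y Y' : 'rV[R[i]]_k) : ((Y - Y') *m cc) 0 0 = (Y *m cc) 0 0 - (Y' *m cc) 0 0.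
  by rewrite mulmxBl [LHS]mxE [X in _ + X]mxE.
apply: filterS nc => q hq lq X X'; split=> [[X'' [X0 E]]|XX].
  have := congr1 (fun Y => (Y *m cc) 0 0) E; rewrite /= subE.
  rewrite (cE _ (hq lq) X) (cE _ c0 X') (cE _ c0 X'') X0 => /eqP.
  by rewrite subr_eq0 => /eqP.
pose Y := dmap quo q X - dmap quo 0 X'.
exists (Y *m map_mx (real_complex R) G); split; last first.
  by rewrite [RHS]dmapE -mulmxA -map_mxM GE map_mx1 mulmx1.
rewrite -(cE _ c0) dmapE -(mulmxA Y) -map_mxM GE map_mx1 mulmx1 subE.
by rewrite (cE _ (hq lq) X) (cE _ c0 X') XX subrr.
Qed.
End one_quotient.

Lemma cjac_vanish l (M : 'M[R]_(d, l)) (X : 'rV[R[i]]_d) (P : pred 'I_d) :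
  (forall i, ~~ P i -> X 0 i = 0 \/ row i M = 0) ->
  forall j, (X *m map_mx (real_complex R) M) 0 j = \sum_(i | P i) X 0 i * (M i j)%:C.
Proof.
move=> h j; rewrite mxE (bigID P)/= [X in _ + X]big1 ?addr0.
  by apply: eq_bigr => i _; rewrite mxE.
move=> i /h[->|/rowP/(_ j)]; first by rewrite mul0r.
by rewrite !mxE => ->; rewrite mulr0.
Qed.

(** Two quotients identify the contact planes along the leaf in the same way,
    because the rows of their Jacobians that act on these planes solve the same
    linear equation along rays, whose coefficients are the compared derivatives of
    the frames. *)
Lemma frame_transport D D' V V' quo quo' : quotient_at D V quo -> quotient_at D' V' quo' ->
  (\forall x \near (0 : 'rV[R]_d), leaf w x -> forall l j i, w i = 1%N -> w j = 1%N ->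
    pd i (V l j) x = pd i (V' l j) x) ->
  \forall q \near (0 : 'rV[R]_d), leaf w q -> forall X X' : 'rV[R[i]]_d,
    (forall i, (1 < w i)%N -> X 0 i = 0 /\ X' 0 i = 0) ->
    dmap quo q X = dmap quo 0 X' -> dmap quo' q X = dmap quo' 0 X'.
Proof.
move=> qa qa' VV; have [G GE] := jac_section qa.
(* The two quotients have differentials with the same kernel at the origin, so
   they differ there by a linear map; the components of quo N and quo' are then
   first integrals with the same initial data. *)
pose N := G *m jac quo' 0.
have NE : jac quo 0 *m N = jac quo' 0.
  apply/eqP; rewrite -subr_eq0 mulmxA -[X in _ - X]mul1mx -mulmxBl; apply/eqP/row_matrixP => i.
  rewrite row_mul row0; apply/(nbhs_singleton (jac_ker qa') leaf_0)/(nbhs_singleton (jac_ker qa) leaf_0).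
  by rewrite -row_mul mulmxBl -mulmxA GE mulmx1 mul1mx subrr row0.
have H : forall j, \forall x \near (0 : 'rV[R]_d), leaf w x -> forall i, w i = 1%N ->
    (jac quo x *m N) i j = jac quo' x i j.
  move=> j; have k1 := killed_comb qa (col j N); have k2 := killed_comb qa' (col j 1%:M).
  have cE (q : 'rV[R]_d -> 'rV[R]_k) (M : 'M[R]_k) x i : (forall j, differentiable (fun y => q y 0 j) x) ->
      pd i (comb q (col j M)) x = (jac q x *m M) i j.
    move=> dq; rewrite pd_comb// [LHS]mxE [RHS]mxE; apply: eq_bigr => a _.
    by rewrite [col _ _ _ _]mxE.
  have d1 := near_quo_diff qa; have d2 := near_quo_diff qa'.
  have h := killed_unique (qa_adapted qa) (qa_adapted qa') VV k1 k2.
  apply: filterS2 (h _) (filterI d1 d2) => [x hx [dx dx'] lx i wi|i wi].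
    by have := hx lx i wi; rewrite !cE// mulmx1.
  by rewrite !cE ?NE ?mulmx1//; [exact: nbhs_singleton d2|exact: nbhs_singleton d1].
have H' := filter_forall (nbhs_filter (0 : 'rV[R]_d)) H.
have r0 := jac_row0 qa; have r0' := jac_row0 qa'.
apply: filterS2 H' (filterI r0 r0') => q hq [r r'] lq X X' X2.
have vanish (M : 'M[R]_(d, k)) (Y : 'rV[R[i]]_d) : (forall i, w i = 0%N -> row i M = 0) ->
    (forall i, (1 < w i)%N -> Y 0 i = 0) -> forall i, ~~ (w i == 1%N) -> Y 0 i = 0 \/ row i M = 0.
  by move=> M0 Y0 i; case: (w i) (M0 i) (Y0 i) => [|[|u]]// h1 h2 _; [right; exact: h1|left; exact: h2].
rewrite !dmapE => E.
have E2 : X *m cjac quo' q = X *m map_mx (real_complex R) (jac quo q *m N).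
  apply/rowP => j.
  have v1 := vanish (jac quo' q) X (r' lq) (fun i wi => (X2 i wi).1).
  have v2 : forall i, ~~ (w i == 1%N) -> X 0 i = 0 \/ row i (jac quo q *m N) = 0.
    by apply: vanish => [i wi|i /X2[]//]; rewrite row_mul r// mul0mx.
  refine (etrans (cjac_vanish v1 j) (etrans _ (esym (cjac_vanish v2 j)))).
  by apply: eq_bigr => i /eqP wi; rewrite hq.
by rewrite E2 map_mxM mulmxA -[map_mx _ (jac quo q)]/(cjac quo q) E -mulmxA -map_mxM NE.
Qed.
End quotient.
End foliation.

(** * Real frames of K2 + conj K2 *)

Section frame.
Variables (R : realType) (s m : nat).
Local Notation C := R[i].
Local Notation d := (chart_dim s m).
Local Notation n := (s + m)%N.
Local Notation ii := (iC R).
Local Notation Ez := (Ez R s m).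
Local Notation Ezb := (Ezb R s m).
Local Notation Ev := (Ev R s m).
Local Notation Dz := (Dz R s m).
Local Notation Dzb := (Dzb R s m).
Local Notation Dv := (Dv R s m).
Local Notation vI := (vI s m).
Local Notation w := (@coord_wt s m).
Implicit Types (F G : 'rV[R]_d -> R) (x q : 'rV[R]_d).

Definition Zp : 'M[C]_(d, m) := Dz *m col_mx 0 1%:M.

Definition LamC G (l j : 'I_d) x : C := 2%:R * (row l Zp *m Lam G x) 0 j.

(** For a coordinate vector e_l in a zeta-direction, twice the real part of
    dzeta(e_l) Lam is the real field in K2 + conj K2 with the same zeta-components
    as e_l; for the other l the field is zero. *)
Definition Vfr G (l j : 'I_d) x : R := reC (LamC G l j x).

Lemma w_cases (P : 'I_d -> Prop) :
  (forall j, P (reI (lshift m j))) -> (forall j, P (imI (lshift m j))) ->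
  (forall al, P (reI (rshift s al))) -> (forall al, P (imI (rshift s al))) ->
  P vI -> forall i, P i.
Proof.
by move=> h1 h2 h3 h4 h5; apply: chart_ind => // A; elim/chart_split: A.
Qed.

Lemma Ez_u0 j : w j != 1%N -> col j (usubmx Ez) = 0.
Proof.
move=> wj; apply/colP => a; rewrite !mxE; apply/eqP; rewrite mulf_eq0; apply/orP; right.
have [e1 e2] : (j == reI (lshift m a)) = false /\ (j == imI (lshift m a)) = false.
  by split; apply: contraNF wj => /eqP ->; rewrite ?w_reI ?w_imI wA_z.
by rewrite e1 e2 mulr0 subr0.
Qed.

Lemma Ez_d0 j : w j != 0%N -> col j (dsubmx Ez) = 0.
Proof.
move=> wj; apply/colP => a; rewrite !mxE; apply/eqP; rewrite mulf_eq0; apply/orP; right.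
have [e1 e2] : (j == reI (rshift s a)) = false /\ (j == imI (rshift s a)) = false.
  by split; apply: contraNF wj => /eqP ->; rewrite ?w_reI ?w_imI wA_zeta.
by rewrite e1 e2 mulr0 subr0.
Qed.

Lemma w_vIE j : (w j == 2%N) = (j == vI).
Proof.
apply/idP/idP => [|/eqP ->]; last by rewrite w_vI.
by elim/w_cases: j => [j|j|j|j|] //; rewrite ?w_reI ?w_imI ?wA_z ?wA_zeta.
Qed.

Lemma w_le2 j : (w j <= 2)%N.
Proof. by elim/w_cases: j => [j|j|j|j|]; rewrite ?w_reI ?w_imI ?wA_z ?wA_zeta ?w_vI. Qed.

Lemma mul_entry_col (p r : nat) (u : 'rV[C]_p) (M : 'M[C]_(p, r)) j : col j M = 0 -> (u *m M) 0 j = 0.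
Proof.
move=> /colP M0; rewrite mxE big1// => i _.
by have := M0 i; rewrite !mxE => ->; rewrite mulr0.
Qed.

(** The three groups of components: along z given by [acoef], along zeta
    constant, and along v. *)
Lemma LamE G l j x : LamC G l j x = 2%:R * ((row l Zp *m acoef (lev G x) *m usubmx Ez) 0 j
   + (row l Zp *m dsubmx Ez) 0 j + (row l Zp *m (kerb (lev G x) *m (mu G x)^T)) 0 0 * Ev 0 j).
Proof.
rewrite /LamC; congr (_ * _).
have e (M N P : 'M[C]_(1, d)) : (M + N + P) 0 j = M 0 j + N 0 j + P 0 j by rewrite !mxE.
have e1 (M : 'M[C]_1) : (M *m Ev) 0 j = M 0 0 * Ev 0 j by rewrite mxE big_ord1.
rewrite -e1 -e; congr (fun_of_matrix _ 0 j); rewrite /Lam /Lx mulmxDr mulmxDr !mulmxA; congr (_ + _).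
by rewrite -{1}[Ez]vsubmxK /kerb /acoef mul_mx_row mulmx1 mul_row_col !mulmxA.
Qed.

Lemma LamE0 G l j x : w j = 0%N -> LamC G l j x = 2%:R * (row l Zp *m dsubmx Ez) 0 j.
Proof.
move=> wj; rewrite LamE mul_entry_col ?Ez_u0 ?wj// add0r [Ev 0 j]mxE.
rewrite (_ : (j == vI) = false); first by rewrite mulr0 addr0.
by apply: contra_eqF wj => /eqP ->; rewrite w_vI.
Qed.

Lemma LamE1 G l j x : w j = 1%N -> LamC G l j x = 2%:R * (row l Zp *m acoef (lev G x) *m usubmx Ez) 0 j.
Proof.
move=> wj; rewrite LamE [X in _ + X + _]mul_entry_col ?Ez_d0 ?wj// addr0 [Ev 0 j]mxE.
rewrite (_ : (j == vI) = false); first by rewrite mulr0 addr0.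
by apply: contra_eqF wj => /eqP ->; rewrite w_vI.
Qed.

Lemma LamE2 G l x : LamC G l vI x = 2%:R * (row l Zp *m (kerb (lev G x) *m (mu G x)^T)) 0 0.
Proof.
rewrite LamE mul_entry_col ?Ez_u0 ?w_vI// [X in 0 + X + _]mul_entry_col ?Ez_d0 ?w_vI//.
by rewrite !add0r [Ev 0 vI]mxE eqxx mulr1.
Qed.

Lemma cWmx_cst N p r (M : 'M[C]_(p, r)) : @cWmx R s m N 0 p r (fun=> M).
Proof. by move=> i j; apply: cW_smooth; exact: csm_cst. Qed.

Section frame_one.
Variable G : 'rV[R]_d -> R.
Hypothesis WG : forall N, W w N 2 G.
Hypothesis gG : \forall y \near (0 : 'rV[R]_d), good G y.

Let uG : ulsubmx (lev G 0) \in unitmx. Proof. exact: (nbhs_singleton gG).1. Qed.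

Lemma csm_LamC l j : csm 0 (LamC G l j).
Proof.
apply: csm_mul; first exact: csm_cst.
by apply: csm_mulmx => [a b|]; [exact: csm_cst|exact: csm_Lam (WG 0).1 uG].
Qed.

Lemma cWmx_tau N : cWmx N 2 (fun x => kerb (lev G x) *m (mu G x)^T).
Proof.
move=> al j; rewrite (ord1 j).
apply: (@cW_ext _ _ _ _ _ (fun x => \sum_j acoef (lev G x) al j * mu G x 0 (lshift m j) + mu G x 0 (rshift s al))).
  by apply: filterE => x; refine (esym (kerb_mul_col _ _ _)).
apply: cW_add; last by have := cW_mu WG N (rshift s al); rewrite wA_zeta.
apply: cW_sum => k; apply: (@cW_le _ _ _ _ (1 + 1)%N) => //; apply: cW_mul.
  exact: cWmx_acoef WG uG _ _ _.
by have := cW_mu WG N (lshift m k); rewrite wA_z.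
Qed.

Lemma cW_LamC2 N l : cW w N 2 (LamC G l vI).
Proof.
apply: (@cW_ext _ _ _ _ _ (fun x => 2%:R * (row l Zp *m (kerb (lev G x) *m (mu G x)^T)) 0 0)).
  by apply: filterE => x; refine (esym (LamE2 _ _ _)).
apply: cW_scal; exact: (cWmx_mul (cWmx_cst N (row l Zp)) (cWmx_tau N)).
Qed.

(** On the leaf [Lam] consists of the coordinate fields of zeta, and a real
    vector is twice the real part of its (1,0)-part. *)
Lemma Vfr_leaf : \forall x \near (0 : 'rV[R]_d), leaf w x -> forall e : 'rV[R]_d, leaf w e ->
  forall j, \sum_l e 0 l * Vfr G l j x = e 0 j.
Proof.
apply: filterS (near_leaf_pt WG gG) => x lp /lp lpx e le j.
pose ec : 'rV[C]_d := complexify e.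
have e0 : forall i, (0 < w i)%N -> ec 0 i = 0 by move=> i wi; rewrite mxE le.
have [ev ez ezb] := (wt_pos_vanish ec).1 e0.
have E : ec *m Zp *m Lam G x = ec *m Dz *m Ez.
  rewrite /Lam (leaf_kerb lpx) (leaf_Lx lpx) /Zp !mulmxA; congr (_ *m _).
  rewrite -[ec *m Dz]hsubmxK ez mul_row_col mul0mx add0r mulmx1 mul_mx_row mulmx0 mulmx1.
  by [].
have -> : \sum_l e 0 l * Vfr G l j x = reC (2%:R * (ec *m Zp *m Lam G x) 0 j).
  have -> : 2%:R * (ec *m Zp *m Lam G x) 0 j = \sum_l ec 0 l * LamC G l j x.
    rewrite -mulmxA mxE mulr_sumr; apply: eq_bigr => l _.
    by rewrite /LamC -row_mul [row _ _ _ _]mxE mulrCA.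
  rewrite raddf_sum; apply: eq_bigr => l _; rewrite /Vfr [ec 0 l]mxE.
  by case: (LamC G l j x) => a b /=; rewrite mul0r subr0.
rewrite E; have := frame_decomp ec; rewrite ev mul0mx addr0 => ecE.
have cE : ec *m Dzb *m Ezb = conjv (ec *m Dz *m Ez).
  rewrite !conjv_mul conj_Dz conj_Ez; congr (_ *m _ *m _).
  by apply/rowP => i; rewrite !mxE /= oppr0.
have : ec 0 j = (ec *m Dz *m Ez) 0 j + ((ec *m Dz *m Ez) 0 j)^*.
  by rewrite {1}ecE cE [LHS]mxE [X in _ + X]mxE.
rewrite [ec 0 j]mxE; case: ((ec *m Dz *m Ez) 0 j) => a b /=.
move=> /(congr1 (@complex.Re R))/= ->; rewrite !(mul0r, mul1r, addr0, subr0).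
by rewrite mulrDl mul1r.
Qed.

Lemma smooth_Vfr l j : smooth_near 0 (Vfr G l j).
Proof. exact: (csm_LamC l j).1. Qed.

(** The zeta-components are constant and the v-component has order 2, which
    settles all derivatives except that of the v-component along v. *)
Lemma adapted_Vfr : (forall l, \forall x \near (0 : 'rV[R]_d), leaf w x -> pd vI (Vfr G l vI) x = 0) ->
  adapted w (Vfr G).
Proof.
move=> hv; split; [exact: smooth_Vfr|exact: Vfr_leaf|].
have H : forall k : 'I_d * ('I_d * 'I_d), \forall x \near (0 : 'rV[R]_d), leaf w x ->
    (0 < w k.2.2)%N -> w k.2.1 != 1%N -> pd k.2.2 (Vfr G k.1 k.2.1) x = 0.
  move=> [l [j i]] /=; have [wj1|wj1] := boolP (w j == 1%N); first exact: filterE.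
  have [wi|wi] := posnP (w i); first exact: filterE.
  have [/eqP wj0|wj0] := boolP (w j == 0%N).
    have e : Vfr G l j = fun=> reC (2%:R * (row l Zp *m dsubmx Ez) 0 j).
      by apply/funext => y; refine (congr1 _ (LamE0 _ _ _ wj0)).
    by apply: filterE => x _ _ _; refine (etrans (congr1 (fun f => pd i f x) e) (pd_cst _ _ _)).
  have jv : j = vI.
    by apply/eqP; rewrite -w_vIE; have := w_le2 j; move: wj0 wj1; case: (w j) => [|[|[|]]].
  have [/eqP wi1|wi1] := boolP (w i == 1%N).
    have := W_pd i (cW_LamC2 1 l).1; rewrite wi1 => /W_leaf h; rewrite jv.
    by apply: filterS (h isT) => x hx lx _ _; exact: hx.
  have iv : i = vI.
    by apply/eqP; rewrite -w_vIE; have := w_le2 i; move: wi wi1; case: (w i) => [|[|[|]]].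
  by rewrite jv iv; apply: filterS (hv l) => x hx lx _ _; exact: hx.
have H' := filter_forall (nbhs_filter (0 : 'rV[R]_d)) H.
by apply: filterS H' => x hx lx l j i wi wj; exact: (hx (l, (j, i)) lx wi wj).
Qed.

Lemma Vfr_K2 : \forall x \near (0 : 'rV[R]_d), forall l,
  oplus (K2 (graph_CR G)) (bar (K2 (graph_CR G))) x (complexify (\row_j Vfr G l j x)).
Proof.
apply: filterS2 (smooth_near_near (WG 0).1) gG => x sx gx l.
have Kx : K2 (graph_CR G) x (row l Zp *m Lam G x).
  by apply/(K2_Lam sx _ gx); exists (row l Zp).
exists (row l Zp *m Lam G x), (conjv (row l Zp *m Lam G x)); split=> //; first exact: bar_conj.
apply/rowP => j; rewrite [LHS]mxE [X in X%:C]mxE [RHS]mxE [X in _ + X]mxE /Vfr /LamC.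
case: ((row l Zp *m Lam G x) 0 j) => a b /=.
by apply/eqP; rewrite eq_complex /= !(mul0r, mul1r, addr0, subr0) subrr mulrDl mul1r !eqxx.
Qed.
End frame_one.

Section frame_two.
Variables (F F0 : 'rV[R]_d -> R).
Hypothesis WF : forall N, W w N 2 F.
Hypothesis WF0 : forall N, W w N 2 F0.
Hypothesis WQ : forall N, W w N 3 (fun x => F x - F0 x).
Hypothesis u0 : ulsubmx (lev F0 0) \in unitmx.
Hypothesis iF0 : v_invariant F0.
Hypothesis gF : \forall y \near (0 : 'rV[R]_d), good F y.
Hypothesis gF0 : \forall y \near (0 : 'rV[R]_d), good F0 y.

Lemma W_Vfr_sub N k l j : cW w N k (fun x => LamC F l j x - LamC F0 l j x) ->
  W w N k (fun x => Vfr F l j x - Vfr F0 l j x).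
Proof.
move=> [h _]; apply: W_ext h; apply: filterE => x; rewrite /Vfr.
by case: (LamC F l j x) (LamC F0 l j x) => [a b] [].
Qed.

Lemma pd_Vfr_sub l j i : \forall x \near (0 : 'rV[R]_d),
  pd i (fun x => Vfr F l j x - Vfr F0 l j x) x = pd i (Vfr F l j) x - pd i (Vfr F0 l j) x.
Proof.
apply: filterS2 (smooth_near_diff (smooth_Vfr WF gF l j)) (smooth_near_diff (smooth_Vfr WF0 gF0 l j)).
by move=> x a b; refine (pdB i a b).
Qed.

Lemma Vfr_pd_eq l j i k : cW w 1 k (fun x => LamC F l j x - LamC F0 l j x) -> (w i < k)%N ->
  \forall x \near (0 : 'rV[R]_d), leaf w x -> pd i (Vfr F l j) x = pd i (Vfr F0 l j) x.
Proof.
move=> /W_Vfr_sub/(W_pd i)/W_leaf h wi.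
apply: filterS2 (pd_Vfr_sub l j i) (h _) => [x e hx lx|]; last by rewrite subn_gt0.
by apply/eqP; rewrite -subr_eq0; apply/eqP; refine (etrans (esym e) (hx lx)).
Qed.

Lemma mulmx_sub3 (p r t : nat) (u : 'rV[C]_p) (A B : 'M[C]_(p, r)) (M : 'M[C]_(r, t)) j :
  2%:R * (u *m (A - B) *m M) 0 j = 2%:R * (u *m A *m M) 0 j - 2%:R * (u *m B *m M) 0 j.
Proof.
rewrite mulmxBr mulmxBl -mulrBr; congr (_ * _); move: (u *m A *m M) (u *m B *m M) => x y.
by rewrite !mxE.
Qed.

Lemma mulmx_sub2 (p r : nat) (u : 'rV[C]_p) (A B : 'M[C]_(p, r)) j :
  2%:R * (u *m (A - B)) 0 j = 2%:R * (u *m A) 0 j - 2%:R * (u *m B) 0 j.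
Proof.
rewrite mulmxBr -mulrBr; congr (_ * _); move: (u *m A) (u *m B) => x y.
by rewrite !mxE.
Qed.

(** By [LamE1] the z-components of the frames differ as the [acoef] do, that is
    by order 2. *)
Lemma Vfr_agree : \forall x \near (0 : 'rV[R]_d), leaf w x -> forall l j i, w i = 1%N -> w j = 1%N ->
  pd i (Vfr F l j) x = pd i (Vfr F0 l j) x.
Proof.
have H : forall k : 'I_d * ('I_d * 'I_d), \forall x \near (0 : 'rV[R]_d), leaf w x ->
    w k.2.2 = 1%N -> w k.2.1 = 1%N -> pd k.2.2 (Vfr F k.1 k.2.1) x = pd k.2.2 (Vfr F0 k.1 k.2.1) x.
  move=> [l [j i]] /=; have [/eqP wj|wj] := boolP (w j == 1%N); last first.
    by apply: filterE => x _ _ wj1; exfalso; move: wj; rewrite wj1.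
  have [/eqP wi|wi] := boolP (w i == 1%N); last first.
    by apply: filterE => x _ wi1; exfalso; move: wi; rewrite wi1.
  suff h : cW w 1 2 (fun x => LamC F l j x - LamC F0 l j x).
    have wi2 : (w i < 2)%N by rewrite wi.
    by apply: filterS (Vfr_pd_eq h wi2) => x hx lx _ _; refine (hx lx).
  apply: (@cW_ext _ _ _ _ _ (fun x => 2%:R * (row l Zp *m (acoef (lev F x) - acoef (lev F0 x)) *m usubmx Ez) 0 j)).
    apply: filterE => x; refine (etrans (mulmx_sub3 _ _ _ _ _) _).
    by refine (congr2 (fun a b => a - b) (esym (LamE1 _ _ _ wj)) (esym (LamE1 _ _ _ wj))).
  apply: cW_scal; apply: (@cW_le _ _ _ _ (0 + 2 + 0)%N) => //.
  apply: cWmx_mul (cWmx_cst _ _) _ _; apply: cWmx_mul (cWmx_cst _ _) _.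
  exact: cWmx_acoef_sub.
have H' := filter_forall (nbhs_filter (0 : 'rV[R]_d)) H.
by apply: filterS H' => x hx lx l j i wi wj; exact: (hx (l, (j, i)) lx wi wj).
Qed.

Lemma pd_v_model l x : pd vI (Vfr F0 l vI) x = 0.
Proof.
apply: pd_invariant => h y; rewrite /Vfr !LamE2.
have e1 : lev F0 (h *: (delta_mx 0 vI : 'rV[R]_d) + y) = lev F0 y by exact: invariant_lev.
have e2 : mu F0 (h *: (delta_mx 0 vI : 'rV[R]_d) + y) = mu F0 y.
  by apply/rowP => A; exact: (invariant_mu iF0).
by rewrite e1 e2.
Qed.

Lemma adapted_model : adapted w (Vfr F0).
Proof. by apply: adapted_Vfr => // l; apply: filterE => x _; exact: pd_v_model. Qed.

(** The v-derivative of the v-component vanishes for the model, which does not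
    depend on v, and the two v-components differ by order 3. *)
Lemma adapted_F : adapted w (Vfr F).
Proof.
apply: adapted_Vfr => // l.
suff h : cW w 1 3 (fun x => LamC F l vI x - LamC F0 l vI x).
  have wv2 : (w vI < 3)%N by rewrite w_vI.
  by apply: filterS (Vfr_pd_eq h wv2) => x hx lx; refine (etrans (hx lx) (pd_v_model l x)).
apply: (@cW_ext _ _ _ _ _ (fun x => 2%:R * (row l Zp *m (kerb (lev F x) *m (mu F x)^T - kerb (lev F0 x) *m (mu F0 x)^T)) 0 0)).
  apply: filterE => x; refine (etrans (mulmx_sub2 _ _ _ _) _).
  by refine (congr2 (fun a b => a - b) (esym (LamE2 _ _ _)) (esym (LamE2 _ _ _))).
apply: cW_scal; apply: (@cW_le _ _ _ _ (0 + 3)%N) => //.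
apply: cWmx_mul (cWmx_cst _ _) _ _ _; exact: cWmx_tau_sub.
Qed.
End frame_two.

Lemma quotient_graph G (k : nat) (quo : 'rV[R]_d -> 'rV[R]_k) : (forall N, W w N 2 G) ->
  (\forall y \near (0 : 'rV[R]_d), good G y) -> adapted w (Vfr G) ->
  local_quotient (graph_CR G) 0 quo ->
  quotient_at w (oplus (K2 (graph_CR G)) (bar (K2 (graph_CR G)))) (Vfr G) quo.
Proof.
move=> WG gG aG [sq nq]; split=> //.
- by apply: filterS nq => q [].
- by apply: filterS nq => q [].
- by apply: filterS (near_leaf_pt WG gG) => x lp /lp lpx X; exact: leaf_K2_sum.
- exact: Vfr_K2.
Qed.
End frame.

(** * Modified symbols depend only on data along the leaf *)

Section transfer.
Variables (R : realType) (d k s m : nat).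
Implicit Types (H : distribution R d) (quo : 'rV[R]_d -> 'rV[R]_k) (p q : 'rV[R]_d).
Implicit Types (f : 'rV[R]_d -> gr_map R d s).

(** Everything entering the modified symbol at p is read off these data along
    the leaf through p. *)
Record leafwise p H quo H' quo' : Prop := Leafwise {
  lw_fibre : \forall q \near p, quo q = quo p <-> quo' q = quo' p;
  lw_CR : \forall q \near p, quo q = quo p -> H q = H' q;
  lw_K2 : \forall q \near p, quo q = quo p -> K2 H q = K2 H' q;
  lw_iota2 : \forall q \near p, quo q = quo p -> forall v w u,
    iota2 H q v w u <-> iota2 H' q v w u;
  lw_isF : \forall q \near p, quo q = quo p -> forall g : gr_map R d s,
    isF H q g <-> isF H' q g;
  lw_transition : forall f, \forall q \near p, quo q = quo p ->
    transition H quo f p q = transition H' quo' f p q;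
  lw_frame : forall e : 'I_m -> vfield R d, K2_frame H p e -> exists e' : 'I_m -> vfield R d,
    K2_frame H' p e' /\ \forall q \near p, quo q = quo p -> forall al, e al q = e' al q;
  lw_frame' : forall e : 'I_m -> vfield R d, K2_frame H' p e -> exists e' : 'I_m -> vfield R d,
    K2_frame H p e' /\ \forall q \near p, quo q = quo p -> forall al, e al q = e' al q }.

Lemma leafwise_sym p H quo H' quo' : leafwise p H quo H' quo' -> leafwise p H' quo' H quo.
Proof.
move=> [h1 h2 h3 h4 h5 h6 h7 h8].
have tr (P : 'rV[R]_d -> Prop) : (\forall q \near p, quo q = quo p -> P q) ->
    \forall q \near p, quo' q = quo' p -> P q.
  by move=> hP; apply: filterS2 h1 hP => q e hq /e.
split.
- by apply: filterS h1 => q e; split=> /e.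
- by apply: tr; apply: filterS h2 => q hq e; rewrite hq.
- by apply: tr; apply: filterS h3 => q hq e; rewrite hq.
- by apply: tr; apply: filterS h4 => q hq e v w u; split=> /(hq e v w u).
- by apply: tr; apply: filterS h5 => q hq e g; split=> /(hq e g).
- by move=> f; apply: tr; apply: filterS (h6 f) => q hq e; rewrite hq.
- by move=> e /h8[e' [Ke ee]]; exists e'; split=> //; exact: tr.
- by move=> e /h7[e' [Ke ee]]; exists e'; split=> //; exact: tr.
Qed.

Section one_side.
Variables (p : 'rV[R]_d) (H H' : distribution R d) (quo quo' : 'rV[R]_d -> 'rV[R]_k).
Hypothesis L : leafwise p H quo H' quo'.

Lemma lw_tr (P : 'rV[R]_d -> Prop) : (\forall q \near p, quo q = quo p -> P q) ->
  \forall q \near p, quo' q = quo' p -> P q.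
Proof. by move=> hP; apply: filterS2 (lw_fibre L) hP => q e hq /e. Qed.

Lemma lw_CR0 : H p = H' p. Proof. exact: (nbhs_singleton (lw_CR L) erefl). Qed.
Lemma lw_K20 : K2 H p = K2 H' p. Proof. exact: (nbhs_singleton (lw_K2 L) erefl). Qed.

Lemma push2_leafwise : \forall q \near p, quo q = quo p -> forall (g : gr_map R d s) v,
  push2 H q g v = push2 H' q g v /\ pushm2 H q g v = pushm2 H' q g v.
Proof.
apply: filterS2 (lw_CR L) (lw_iota2 L) => q hq iq e g v.
have bE : bar H q = bar H' q by rewrite /bar hq.
split; congr (xget 0); apply/seteqP; split=> D /= [h1 h2]; split=> // w u;
  rewrite ?bE ?hq// => hw /(iq e)hi; apply: h2 => //; rewrite ?bE ?hq//.
Qed.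

Lemma leaf_section_leafwise f : leaf_section H quo p f -> leaf_section H' quo' p f.
Proof.
move=> [h1 h2 h3 h4]; split=> //; apply: lw_tr.
by apply: filterS2 (lw_isF L) h4 => q iq hq e; apply/iq => //; exact: hq.
Qed.

Lemma fg_leafwise (g : gr_map R d s) : [/\ fg_2 H p g = fg_2 H' p g, fg_m2 H p g = fg_m2 H' p g &
  fg_0 H p g = fg_0 H' p g].
Proof.
have e := nbhs_singleton push2_leafwise erefl g.
have e2 : fg_2 H p g = fg_2 H' p g.
  by rewrite /fg_2 lw_K20; apply: eq_imagel => v _; exact: (e v).1.
have em2 : fg_m2 H p g = fg_m2 H' p g.
  by rewrite /fg_m2 lw_K20; apply: eq_imagel => v _; exact: (e v).2.
by split=> //; rewrite /fg_0 e2 em2.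
Qed.

Lemma leaf_curve_near c X (P : 'rV[R]_d -> Prop) : leaf_curve quo p c X ->
  (\forall q \near p, P q) -> \forall t \near (0 : R), P (c t).
Proof.
move=> [c0 _ _ cd] nP; have cc : c t @[t --> (0 : R)] --> c 0.
  by apply: differentiable_continuous; apply/derivable1_diffP; case: cd.
by rewrite c0 in cc; exact: cc _ nP.
Qed.

Lemma leaf_curve_leafwise c X : leaf_curve quo p c X -> leaf_curve quo' p c X.
Proof.
move=> lc; have lf := leaf_curve_near lc (lw_fibre L).
have [c0 cq cs cd] := lc; split=> //.
by apply: filterS2 lf cq => t /= e /e.
Qed.

Lemma leaf_derive_leafwise a b (F F' : 'rV[R]_d -> 'M[R[i]]_(a, b)) X D :
  (\forall q \near p, quo q = quo p -> F q = F' q) ->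
  leaf_derive quo p F X D -> leaf_derive quo' p F' X D.
Proof.
move=> FF [c1 [c2 [D1 [D2 [[l1 l2] d1 d2 ->]]]]]; exists c1, c2, D1, D2.
have main c Y E : leaf_curve quo p c Y -> is_cderive0 (fun t => F (c t)) E ->
    is_cderive0 (fun t => F' (c t)) E.
  move=> lc hE i j; have lf := leaf_curve_near lc FF; have [c0 cq cs cd] := lc; have [hr hi] := hE i j.
  have E1 : \forall t \near (0 : R), F (c t) = F' (c t).
    by apply: filterS2 lf cq => t /= e /e.
  split.
    by apply: near_eq_is_derive hr => //; apply: filterS E1 => t ->.
  by apply: near_eq_is_derive hi => //; apply: filterS E1 => t ->.
split=> //; [by split; exact: leaf_curve_leafwise|exact: main l1 d1|exact: main l2 d2].
Qed.
End one_side.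

Variables (p : 'rV[R]_d) (H H' : distribution R d) (quo quo' : 'rV[R]_d -> 'rV[R]_k).
Hypothesis L : leafwise p H quo H' quo'.
Let L' := leafwise_sym L.

Lemma iota_image_leafwise f : iota_image H quo p f = iota_image H' quo' p f.
Proof.
have oE : oplus (K2 H) (bar (K2 H)) p = oplus (K2 H') (bar (K2 H')) p.
  by rewrite /oplus /bar (lw_K20 L).
apply/seteqP; split=> D [X [oX lX]]; exists X; (split; first by rewrite ?oE// -oE).
  exact: (@leaf_derive_leafwise _ _ _ _ _ L _ _ (transition H quo f p) (transition H' quo' f p) _ _ (lw_transition L f) lX).
exact: (@leaf_derive_leafwise _ _ _ _ _ L' _ _ (transition H' quo' f p) (transition H quo f p) _ _ (lw_transition L' f) lX).
Qed.

Lemma symbol_leafwise f : modified_symbol_along H quo p f = modified_symbol_along H' quo' p f.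
Proof.
have [_ _ e0] := fg_leafwise L (f p).
by rewrite /modified_symbol_along iota_image_leafwise e0.
Qed.

Lemma omap_sub p1 H1 H2 quo1 quo2 (S1 S2 : 'rV[R]_d -> 'rV[R[i]]_d -> 'M[R[i]]_(heis_dim s)) G X E D :
  leafwise p1 H1 quo1 H2 quo2 ->
  (\forall q \near p1, quo1 q = quo1 p1 -> forall v, S1 q v = S2 q v) ->
  omap_of m H1 quo1 p1 S1 G X E D -> omap_of m H2 quo2 p1 S2 G X E D.
Proof.
move=> L1 SS [KX [e [c [D' [Ke -> De GD]]]]]; split; first by rewrite -(lw_K20 L1).
have [e' [Ke' ee']] := lw_frame L1 Ke.
exists e', c, D'; split=> //.
- apply: eq_bigr => al _; rewrite -(nbhs_singleton SS erefl) -(nbhs_singleton ee' erefl).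
  by [].
- move=> al; apply: (leaf_derive_leafwise L1 _ (De al)).
  by apply: filterS2 SS ee' => q Sq eq e0; rewrite Sq// eq.
Qed.

Lemma opair_leafwise f : opair m H quo p f = opair m H' quo' p f.
Proof.
have [e2 em2 _] := fg_leafwise L (f p); rewrite /opair e2 em2.
have n1 := push2_leafwise L; have n2 := push2_leafwise L'.
congr (_, _); apply/funext => X; apply/funext => E; apply/seteqP; split=> D.
- by apply: omap_sub L _; apply: filterS n1 => q h e v; exact: (h e (f q) v).2.
- by apply: omap_sub L' _; apply: filterS n2 => q h e v; exact: (h e (f q) v).2.
- by apply: omap_sub L _; apply: filterS n1 => q h e v; exact: (h e (f q) v).1.
- by apply: omap_sub L' _; apply: filterS n2 => q h e v; exact: (h e (f q) v).1.
Qed.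

Lemma gr_eq_leafwise (g g' : gr_map R d s) : gr_eq H p g g' <-> gr_eq H' p g g'.
Proof. by rewrite /gr_eq /bar (lw_CR0 L). Qed.

Lemma leaf_section_leafwiseE f : leaf_section H quo p f <-> leaf_section H' quo' p f.
Proof. by split; [exact: leaf_section_leafwise L f|exact: leaf_section_leafwise L' f]. Qed.

Lemma opair_class_leafwise (g : gr_map R d s) : opair_class m H quo p g = opair_class m H' quo' p g.
Proof.
apply/seteqP; split=> o [f [lf fg] <-]; exists f.
- by split; [exact/leaf_section_leafwiseE|exact/gr_eq_leafwise].
- by rewrite opair_leafwise.
- by split; [exact/leaf_section_leafwiseE|exact/gr_eq_leafwise].
- by rewrite opair_leafwise.
Qed.

Lemma normalized_leafwise (nu : choice_rule R d s) f : normalized m nu H quo p f <-> normalized m nu H' quo' p f.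
Proof.
have [e2 em2 _] := fg_leafwise L (f p).
by rewrite /normalized opair_leafwise opair_class_leafwise e2 em2 (lw_K20 L).
Qed.

Lemma modified_symbol_leafwise (nu : choice_rule R d s) (g : gr_map R d s) :
  modified_symbol m nu H quo p g = modified_symbol m nu H' quo' p g.
Proof.
apply/seteqP; split=> o [f [lf fg nf] <-]; exists f.
- by split; [exact/leaf_section_leafwiseE|exact/gr_eq_leafwise|exact/normalized_leafwise].
- by rewrite symbol_leafwise.
- by split; [exact/leaf_section_leafwiseE|exact/gr_eq_leafwise|exact/normalized_leafwise].
- by rewrite symbol_leafwise.
Qed.

Lemma involution_leafwise (g : gr_map R d s) : involution H p g = involution H' p g.
Proof. by rewrite /involution /bar (lw_CR0 L). Qed.

End transfer.

Section existence.
Variables (R : realType) (d k s m : nat) (H : distribution R d) (quo : 'rV[R]_d -> 'rV[R]_k).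
Variables (p : 'rV[R]_d).
Implicit Types (g h : gr_map R d s).

Lemma gr_eq_sym g h : gr_eq H p g h -> gr_eq H p h g.
Proof. by move=> [h1 h2 h3]; split=> [|X hX|X hX]; rewrite ?h1 ?h2 ?h3. Qed.

Lemma gr_eq_trans g h i : gr_eq H p g h -> gr_eq H p h i -> gr_eq H p g i.
Proof.
move=> [h1 h2 h3] [e1 e2 e3]; split=> [|X hX|X hX]; first by rewrite h1.
  by rewrite h2// e2.
by rewrite h3// e3.
Qed.

Lemma gr_eq_push2 g h : gr_eq H p g h -> push2 H p g = push2 H p h.
Proof.
move=> [h1 h2 h3]; apply/funext => v; congr (xget 0); apply/seteqP.
by split=> D /= [cD hD]; split=> // w u hw /[dup] -[Hu _] hi;
  [rewrite -h3// -h2//|rewrite h3// h2//]; exact: hD.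
Qed.

Lemma gr_eq_pushm2 g h : gr_eq H p g h -> pushm2 H p g = pushm2 H p h.
Proof.
move=> [h1 h2 h3]; apply/funext => v; congr (xget 0); apply/seteqP.
have cc (u : 'rV[R[i]]_d) : H p u -> bar H p (conjv u).
  move=> Hu; rewrite /bar /conjset /= (_ : conjv (conjv u) = u)//.
  by apply/rowP => j; rewrite !mxE conjcK.
by split=> D /= [cD hD]; split=> // w u hw /[dup] -[Hu _] hi;
  [rewrite -h2// -h3//; last exact: cc|rewrite h2// h3//; last exact: cc]; exact: hD.
Qed.

(** The choice made by a normalization condition is, by definition of the
    class, realized by a section, and this section is normalized. *)
Lemma modified_symbol_nonempty (nu : choice_rule R d s) (f : 'rV[R]_d -> gr_map R d s) : normalization_condition nu -> leaf_section H quo p f ->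
  modified_symbol m nu H quo p (f p) !=set0.
Proof.
move=> nnu lf; pose cls := opair_class m H quo p (f p).
have cn : cls !=set0 by exists (opair m H quo p f); exists f.
have [[g [lg gf] gE] _] := nnu (K2 H p) (fg_m2 H p (f p)) (fg_2 H p (f p)) cls cn.
exists (modified_symbol_along H quo p g); exists g => //; split=> //.
rewrite /normalized gE; congr (nu _ _ _ _).
- by rewrite /fg_m2 (gr_eq_pushm2 gf).
- by rewrite /fg_2 (gr_eq_push2 gf).
- apply/seteqP; split=> o [h [lh hh] <-]; exists h => //; split=> //.
    exact: gr_eq_trans hh (gr_eq_sym gf).
  exact: gr_eq_trans hh gf.
Qed.
End existence.

Lemma same_symbol_leafwise (R : realType) (d k s m : nat) (nu : choice_rule R d s) p
    (H H' : distribution R d) (quo quo' : 'rV[R]_d -> 'rV[R]_k) (f : 'rV[R]_d -> gr_map R d s) :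
  normalization_condition nu -> leafwise s m p H quo H' quo' -> leaf_section H quo p f ->
  same_modified_symbol m nu p H quo H' quo'.
Proof.
move=> nnu L lf; have [_ _ _ iF] := lf; have iF0 := nbhs_singleton iF erefl.
exists (f p), (f p); split=> //.
- exact/(nbhs_singleton (lw_isF L) erefl).
- exact: involution_leafwise L _.
- exact: modified_symbol_nonempty.
- exact: modified_symbol_leafwise L _ _.
Qed.

(** * The two hypersurfaces have the same data along the leaf *)

(** The condition defining a transition map uses the quotient only to decide
    which tangent vectors at q and p have equal images, respectively equal images
    modulo the contact distribution. *)
Lemma transition_sub (R : realType) (d k s : nat) (H : distribution R d)
    (quo quo' : 'rV[R]_d -> 'rV[R]_k) (f : 'rV[R]_d -> gr_map R d s) p q A :
  (forall X1 X2 X1' X2' : 'rV[R[i]]_d, H q X1 -> bar H q X2 -> H p X1' -> bar H p X2' ->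
    dmap quo' q (X1 + X2) = dmap quo' p (X1' + X2') ->
    dmap quo q (X1 + X2) = dmap quo p (X1' + X2')) ->
  (forall X X' : 'rV[R[i]]_d,
    (exists X'', oplus H (bar H) p X'' /\ dmap quo' q X - dmap quo' p X' = dmap quo' p X'') ->
    exists X'', oplus H (bar H) p X'' /\ dmap quo q X - dmap quo p X' = dmap quo p X'') ->
  (forall x x' Y Y' Z, quo_frame H quo f q x Y Z -> quo_frame H quo f p x' Y' Z ->
    (exists X, oplus H (bar H) p X /\ Y - Y' = dmap quo p X) -> x *m A = x') ->
  forall x x' Y Y' Z, quo_frame H quo' f q x Y Z -> quo_frame H quo' f p x' Y' Z ->
    (exists X, oplus H (bar H) p X /\ Y - Y' = dmap quo' p X) -> x *m A = x'.
Proof.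
move=> h1 h2 h x x' Y Y' Z [X [X1 [X2 [H1 H2 xE YE ZE]]]] [X' [X1' [X2' [H1' H2' xE' YE' ZE']]]] hY.
apply: (h x x' (dmap quo q X) (dmap quo p X') (dmap quo q (X1 + X2))).
- exists X, X1, X2; split; [exact: H1|exact: H2|exact: xE|by []|by []].
- exists X', X1', X2'; split; [exact: H1'|exact: H2'|exact: xE'|by []|].
  by apply: (h1 _ _ _ _ H1 H2 H1' H2'); rewrite -ZE.
- by apply: h2; rewrite -YE -YE'.
Qed.

Lemma quo_frame_H (R : realType) (d k s : nat) (H H' : distribution R d)
    (quo : 'rV[R]_d -> 'rV[R]_k) (f : 'rV[R]_d -> gr_map R d s) q x Y Z :
  H q = H' q -> quo_frame H quo f q x Y Z -> quo_frame H' quo f q x Y Z.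
Proof.
move=> HE [X [X1 [X2 [h1 h2 h3 h4 h5]]]]; exists X, X1, X2; split=> //; first by rewrite -HE.
by rewrite /bar -HE.
Qed.

Section assembly.
Variables (R : realType) (s m : nat).
Local Notation C := R[i].
Local Notation d := (chart_dim s m).
Local Notation n := (s + m)%N.
Local Notation Ez := (Ez R s m).
Local Notation Ezb := (Ezb R s m).
Local Notation Ev := (Ev R s m).
Local Notation Dz := (Dz R s m).
Local Notation Dzb := (Dzb R s m).
Local Notation Dv := (Dv R s m).
Local Notation vI := (vI s m).
Local Notation w := (@coord_wt s m).
Local Notation Zp := (Zp R s m).
Implicit Types (F G : 'rV[R]_d -> R) (x q : 'rV[R]_d).

Lemma Lam_Zp G x : Lam G x *m Zp = 1%:M.
Proof. by rewrite mulmxA LamDz mul_row_col mulmx0 add0r mulmx1. Qed.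

Lemma leaf_Lam G x : leaf_pt G x -> Lam G x = row_mx 0 1%:M *m Ez.
Proof. by move=> lp; rewrite /Lam (leaf_kerb lp) (leaf_Lx lp). Qed.

Lemma row_spaceE (p a : nat) (A : 'M[C]_(p, a)) (v : 'rV[C]_a) : (exists b, v = b *m A) <-> (v <= A)%MS.
Proof. by split=> [[b ->]|/submxP[b ->]]; [exact: submxMl|exists b]. Qed.

Lemma matrix_rows_mul (p a b r : nat) (e : 'I_p -> 'rV[C]_a) (A : 'M[C]_(a, b)) (B : 'M[C]_(b, r)) :
  \matrix_al (e al *m A *m B) = (\matrix_al e al) *m A *m B.
Proof. by apply/row_matrixP => al; rewrite rowK -!mulmxA row_mul rowK. Qed.

(** A frame of K2 for one hypersurface is moved to another one by keeping its
    zeta-components. *)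
Lemma frame_transfer (F F0 : 'rV[R]_d -> R) (e : 'I_m -> vfield R d) :
  (forall N, W w N 2 F) -> (forall N, W w N 2 F0) ->
  (\forall y \near (0 : 'rV[R]_d), good F y) -> (\forall y \near (0 : 'rV[R]_d), good F0 y) ->
  K2_frame (graph_CR F) 0 e -> exists e' : 'I_m -> vfield R d,
    K2_frame (graph_CR F0) 0 e' /\ \forall q \near (0 : 'rV[R]_d), leaf w q -> forall al, e al q = e' al q.
Proof.
move=> WF WF0 gF gF0 [se fe].
pose e' (al : 'I_m) (x : 'rV[R]_d) : 'rV[C]_d := e al x *m Zp *m Lam F0 x.
have sF := smooth_near_near (WF 0).1; have sF0 := smooth_near_near (WF0 0).1.
have eE : \forall q \near (0 : 'rV[R]_d), forall al, e al q = e al q *m Zp *m Lam F q.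
  have n1 : \forall q \near (0 : 'rV[R]_d), forall al, K2 (graph_CR F) q (e al q).
    by apply: (filter_forall (nbhs_filter (0 : 'rV[R]_d))) => al; exact: (se al).2.
  apply: filterS2 n1 (filterI sF gF) => q Kq [sq gq] al.
  have [b bE] := (K2_Lam sq _ gq).1 (Kq al).
  have eZ : b *m Lam F q *m Zp = b by rewrite -(mulmxA b) Lam_Zp mulmx1.
  by rewrite {2}bE eZ.
exists e'; split; last first.
  apply: filterS2 eE (filterI (near_leaf_pt WF gF) (near_leaf_pt WF0 gF0)) => q eq [l1 l2] lq al.
  by rewrite eq /e' (leaf_Lam (l1 lq)) (leaf_Lam (l2 lq)).
have KL0 : \forall q \near (0 : 'rV[R]_d), forall v, K2 (graph_CR F0) q v <-> exists b, v = b *m Lam F0 q.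
  by apply: filterS2 sF0 gF0 => q sq gq v; exact: K2_Lam.
split=> [al|].
  split.
    move=> i j; apply: csm_mulmx => [a b|]; last first.
      exact: csm_Lam (WF0 0).1 (nbhs_singleton gF0).1.
    by apply: csm_mulmx => [a' b'|a' b']; [exact: (se al).1|exact: csm_cst].
  by apply: filterS KL0 => q Kq; apply/Kq; exists (e al q *m Zp).
apply: filterS2 (filterI fe eE) KL0 => q [[fq _] eq] Kq.
pose E := \matrix_al e al q.
have EE : E = E *m Zp *m Lam F q.
  by apply/row_matrixP => al; rewrite !row_mul rowK.
have E'E : \matrix_al e' al q = E *m Zp *m Lam F0 q.
  refine (matrix_rows_mul (fun al => e al q) Zp (Lam F0 q)).
have uE : E *m Zp \in unitmx.
  rewrite -row_free_unit; apply: inj_row_free => v vE.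
  have e1 : v *m (E *m Zp *m Lam F q) = 0 by rewrite mulmxA vE mul0mx.
  by apply: (row_free_inj fq); rewrite mul0mx -/E EE e1.
rewrite E'E; split.
  by rewrite /row_free mxrankMfree ?Lam_free// mxrank_unit.
move=> v; rewrite Kq eqmxMfull ?row_full_unit//.
exact: row_spaceE.
Qed.

Lemma w_gt1 i : (1 < w i)%N -> i = vI.
Proof. by move=> wi; apply/eqP; rewrite -w_vIE eqn_leq w_le2. Qed.

Lemma mulDv0 (X : 'rV[C]_d) : X *m Dv = 0 <-> X 0 vI = 0.
Proof.
split=> [/rowP/(_ 0)|X0]; first by rewrite mulDv [RHS]mxE.
by apply/rowP => j; rewrite mulDv X0 [RHS]mxE.
Qed.

Section leafwise_graph.
Variables (F F0 : 'rV[R]_d -> R).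
Hypothesis WF : forall N, W w N 2 F.
Hypothesis WF0 : forall N, W w N 2 F0.
Hypothesis WQ : forall N, W w N 3 (fun x => F x - F0 x).
Hypothesis u0 : ulsubmx (lev F0 0) \in unitmx.
Hypothesis iF0 : v_invariant F0.
Hypothesis hF0 : homogeneous w 0 2 F0.
Hypothesis gF : \forall y \near (0 : 'rV[R]_d), good F y.
Variables (k : nat) (quo quo0 : 'rV[R]_d -> 'rV[R]_k).
Hypothesis lq : local_quotient (graph_CR F) 0 quo.
Hypothesis lq0 : local_quotient (graph_CR F0) 0 quo0.

Let gF0 : \forall y \near (0 : 'rV[R]_d), good F0 y. Proof. exact: (model_good WF WF0 WQ u0 iF0 hF0 gF). Qed.
Let qa := quotient_graph WF gF (adapted_F WF WF0 WQ u0 iF0 gF gF0) lq.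
Let qa0 := quotient_graph WF0 gF0 (adapted_model WF0 iF0 gF0) lq0.
Let agree := near_agree WF WF0 WQ u0 iF0 hF0 gF.

Lemma fibreF : \forall q \near (0 : 'rV[R]_d), quo q = quo 0 <-> leaf w q.
Proof. exact: fibre_leaf qa. Qed.

Lemma fibreF0 : \forall q \near (0 : 'rV[R]_d), quo0 q = quo0 0 <-> leaf w q.
Proof. exact: fibre_leaf qa0. Qed.

Lemma on_fibre (P : 'rV[R]_d -> Prop) : (\forall q \near (0 : 'rV[R]_d), leaf w q -> P q) ->
  \forall q \near (0 : 'rV[R]_d), quo q = quo 0 -> P q.
Proof. by move=> h; apply: filterS2 fibreF h => q e hq /e. Qed.

Lemma wv i : w i != 1%N -> (0 < w i)%N -> i = vI.
Proof. by move=> w1 w0; apply: w_gt1; rewrite ltn_neqAle eq_sym w1. Qed.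

Lemma wv0 : (1 < w vI)%N. Proof. by rewrite w_vI. Qed.

(** Both sides say that X and X' have the same v-component. *)
Lemma contact_both : \forall q \near (0 : 'rV[R]_d), leaf w q -> forall X X' : 'rV[C]_d,
  (exists X'' : 'rV[C]_d, X'' 0 vI = 0 /\ dmap quo q X - dmap quo 0 X' = dmap quo 0 X'') <->
  (exists X'' : 'rV[C]_d, X'' 0 vI = 0 /\ dmap quo0 q X - dmap quo0 0 X' = dmap quo0 0 X'').
Proof.
have c1 := contact_transport qa wv wv0; have c2 := contact_transport qa0 wv wv0.
apply: filterS2 c1 c2 => q h1 h2 lfq X X'.
exact: iff_trans (h1 lfq X X') (iff_sym (h2 lfq X X')).
Qed.

Lemma frame_both : \forall q \near (0 : 'rV[R]_d), leaf w q -> forall X X' : 'rV[C]_d,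
  X 0 vI = 0 -> X' 0 vI = 0 ->
  dmap quo q X = dmap quo 0 X' <-> dmap quo0 q X = dmap quo0 0 X'.
Proof.
have VV := Vfr_agree WF WF0 WQ u0 gF gF0.
have VV0 : \forall x \near (0 : 'rV[R]_d), leaf w x -> forall l j i, w i = 1%N -> w j = 1%N ->
    pd i (Vfr F0 l j) x = pd i (Vfr F l j) x.
  by apply: filterS VV => x h lx l j i wi wj; refine (esym (h lx l j i wi wj)).
apply: filterS2 (frame_transport qa qa0 VV) (frame_transport qa0 qa VV0) => q h1 h2 lfq X X' X0 X0'.
have hv i : (1 < w i)%N -> X 0 i = 0 /\ X' 0 i = 0 by move=> /w_gt1 ->.
by split; [exact: h1|exact: h2].
Qed.

Lemma transition_leafwise (f : 'rV[R]_d -> gr_map R d s) : \forall q \near (0 : 'rV[R]_d), leaf w q ->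
  transition (graph_CR F) quo f 0 q = transition (graph_CR F0) quo0 f 0 q.
Proof.
have [l0 l00 e0 d0] := nbhs_singleton agree (@leaf0 R s m).
have H0E := agree_CR l0 l00.
have oE X : oplus (graph_CR F) (bar (graph_CR F)) 0 X <-> X 0 vI = 0.
  exact: iff_trans (leaf_contact l0 X) (mulDv0 X).
have oE0 X : oplus (graph_CR F0) (bar (graph_CR F0)) 0 X <-> X 0 vI = 0.
  exact: iff_trans (leaf_contact l00 X) (mulDv0 X).
apply: filterS2 agree (filterI contact_both frame_both) => q aq [cq fq] lfq.
have [l l' _ _] := aq lfq; have HqE := agree_CR l l'.
have v0 G y (X1 X2 : 'rV[C]_d) : leaf_pt G y -> graph_CR G y X1 -> bar (graph_CR G) y X2 -> (X1 + X2) 0 vI = 0.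
  move=> lp /(leaf_CR lp)[_ h1] /(leaf_barCR lp)[_ h2]; apply/mulDv0.
  by rewrite mulmxDl h1 h2 addr0.
congr (xget 0); apply/seteqP; split=> A /= hA x x' Y Y' Z.
- move=> /(quo_frame_H (esym HqE)) fr /(quo_frame_H (esym H0E)) fr' hY.
  apply: (transition_sub _ _ hA fr fr').
  + move=> X1 X2 X1' X2' h1 h2 h3 h4; apply: (fq lfq _ _ _ _).2; [exact: v0 l h1 h2|exact: v0 l0 h3 h4].
  + move=> X X' [X'' [/oE X0 XE]].
    case: ((cq lfq X X').2 (ex_intro _ X'' (conj X0 XE))) => X3 [X30 X3E].
    refine (ex_intro _ X3 (conj ((oE X3).2 X30) X3E)).
  + case: hY => X [oX YE]; refine (ex_intro _ X (conj ((oE X).2 ((oE0 X).1 oX)) YE)).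
- move=> /(quo_frame_H HqE) fr /(quo_frame_H H0E) fr' hY.
  apply: (transition_sub _ _ hA fr fr').
  + move=> X1 X2 X1' X2' h1 h2 h3 h4; apply: (fq lfq _ _ _ _).1; [exact: v0 l' h1 h2|exact: v0 l00 h3 h4].
  + move=> X X' [X'' [/oE0 X0 XE]].
    case: ((cq lfq X X').1 (ex_intro _ X'' (conj X0 XE))) => X3 [X30 X3E].
    refine (ex_intro _ X3 (conj ((oE0 X3).2 X30) X3E)).
  + case: hY => X [oX YE]; refine (ex_intro _ X (conj ((oE0 X).2 ((oE X).1 oX)) YE)).
Qed.

Lemma leafwise_graph : leafwise s m 0 (graph_CR F) quo (graph_CR F0) quo0.
Proof.
split.
- by apply: filterS2 fibreF fibreF0 => q h1 h2; exact: iff_trans h1 (iff_sym h2).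
- by apply: on_fibre; apply: filterS agree => q h /h[l l' _ _]; exact: agree_CR.
- by apply: on_fibre; apply: filterS agree => q h /h[l l' _ _]; exact: agree_K2.
- by apply: on_fibre; apply: filterS agree => q h /h[l l' e dl] v u u'; exact: agree_iota2.
- by apply: on_fibre; apply: filterS agree => q h /h[l l' e dl] g; exact: agree_isF.
- by move=> f; apply: on_fibre; exact: transition_leafwise.
- move=> e /(frame_transfer WF WF0 gF gF0)[e' [Ke ee]]; exists e'; split=> //.
  exact: on_fibre.
- move=> e /(frame_transfer WF0 WF gF0 gF)[e' [Ke ee]]; exists e'; split=> //.
  exact: on_fibre.
Qed.

Definition Pz : 'M[C]_(n, s) := col_mx 1%:M 0.

(** A frame of the graded algebra along the leaf: the coordinate v, the
    coordinates z, and the coordinates dual to the conjugates of z for the Levi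
    matrix. *)
Definition coord_section (x : 'rV[R]_d) : gr_map R d s :=
  GrMap Dv (Dz *m Pz) (Dzb *m Pz *m (ulsubmx (lev F x))^T).

Lemma mulPz p (y : 'M[C]_(p, n)) : y *m Pz = lsubmx y.
Proof. by rewrite -{1}[y]hsubmxK mul_row_col mulmx1 mulmx0 addr0. Qed.

Lemma hbracket_dual (A B : 'rV[C]_s) : hbracket (hvec 0 A 0) (hvec 0 0 B) = hvec (A *m B^T) 0 0.
Proof.
have p1 (a : 'rV[C]_1) (b c : 'rV[C]_s) : hpart1 (hvec a b c) = b.
  by rewrite /hpart1 /hvec row_mxKr row_mxKl.
have p2 (a : 'rV[C]_1) (b c : 'rV[C]_s) : hpartm1 (hvec a b c) = c.
  by rewrite /hpartm1 /hvec !row_mxKr.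
by rewrite /hbracket !p1 !p2 mul0mx subr0.
Qed.

Lemma block_pairing (M : 'M[C]_s) (u y : 'rV[C]_n) :
  u *m block_mx M 0 0 0 *m y^T = lsubmx u *m (lsubmx y *m M^T)^T.
Proof.
rewrite trmx_mul trmxK -{1}(hsubmxK u) -{1}(hsubmxK y) mul_row_block !mulmx0 !addr0.
by rewrite tr_row_mx mul_row_col mul0mx addr0 mulmxA.
Qed.

(** Dualizing by the Levi matrix turns the Levi form into the standard pairing. *)
Lemma coord_isF x : leaf_pt F x -> isF (graph_CR F) x (coord_section x).
Proof.
move=> lp; have u := leaf_levzz lp.
have k2 X : X *m Dv = 0 <-> oplus (graph_CR F) (bar (graph_CR F)) x X := iff_sym (leaf_contact lp X).
split=> /=.
- split=> // a; exists (a *m Ev); by rewrite -mulmxA EvDv mulmx1.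
- split=> [X HX|b].
    have [h1 h2] := (leaf_CR lp X).1 HX.
    rewrite mulmxA mulPz; split=> [X0|/(leaf_K2 lp)[]//].
    by apply/(leaf_K2 lp).
  exists (row_mx b 0 *m Ez); split; last by rewrite mulmxA -(mulmxA _ Ez) EzDz mulmx1 mulPz row_mxKl.
  by apply/(leaf_CR lp); rewrite -!mulmxA EzDzb EzDv !mulmx0.
- split=> [X HX|b].
    have [h1 h2] := (leaf_barCR lp X).1 HX.
    rewrite !mulmxA mulPz; split=> [X0|/(leaf_barK2 lp)[_ _ ->]]; last by rewrite mul0mx.
    apply/(leaf_barK2 lp); split=> //; have ut : (ulsubmx (lev F x))^T \in unitmx by rewrite unitmx_tr.
    by rewrite -(mulmxK ut (lsubmx _)) X0 mul0mx.
  exists (row_mx (b *m invmx (ulsubmx (lev F x))^T) 0 *m Ezb); split.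
    by apply/(leaf_barCR lp); rewrite -!mulmxA EzbDz EzbDv !mulmx0.
  have zE (y : 'rV[C]_n) (M : 'M[C]_s) : y *m Ezb *m (Dzb *m Pz *m M) = lsubmx y *m M.
    by rewrite !mulmxA -(mulmxA y) EzbDzb mulmx1 mulPz.
  by rewrite zE row_mxKl mulmxKV// unitmx_tr.
- refine ((isF_bracketE (lp_smooth lp) (f := coord_section x) k2).2 _) => X Y HX HY /=.
  rewrite EvDv mulmx1 hbracket_dual !mulmxA !mulPz.
  refine (congr1 (fun a => hvec a 0 0) (etrans _ (block_pairing (ulsubmx (lev F x)) _ _))).
  by refine (congr1 (fun M => _ *m M *m _) (leaf_lev lp)).
Qed.

Lemma coord_leaf_section : leaf_section (graph_CR F) quo 0 coord_section.
Proof.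
split.
- by move=> i j; exact: csm_cst.
- by move=> i j; exact: csm_cst.
- move=> i j; apply: csm_mulmx => [a b|a b]; first exact: csm_cst.
  apply: csm_ext (csm_lev (WF 0).1 (lshift m b) (lshift m a)).
  by apply: filterE => x; rewrite [RHS]mxE [RHS]mxE [RHS]mxE.
- by apply: on_fibre; apply: filterS (near_leaf_pt WF gF) => q h /h; exact: coord_isF.
Qed.

Lemma same_symbol_graph (nu : choice_rule R d s) : normalization_condition nu ->
  same_modified_symbol m nu 0 (graph_CR F) quo (graph_CR F0) quo0.
Proof. by move=> nnu; exact: same_symbol_leafwise nnu leafwise_graph coord_leaf_section. Qed.
End leafwise_graph.
End assembly.

(** * The model *)

Section model.
Variables (R : realType) (s m : nat).
Local Notation C := R[i].
Local Notation d := (chart_dim s m).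
Local Notation n := (s + m)%N.
Local Notation ii := (iC R).
Local Notation Ez := (Ez R s m).
Local Notation Ezb := (Ezb R s m).
Local Notation Ev := (Ev R s m).
Local Notation Dz := (Dz R s m).
Local Notation Dzb := (Dzb R s m).
Local Notation Dv := (Dv R s m).
Local Notation vI := (vI s m).
Local Notation w := (@coord_wt s m).
Implicit Types (x y : 'rV[R]_d).

Definition zc (c : 'I_s) x : C := zco x 0 c.

Lemma zcE c : zc c = (fun y : 'rV[R]_d => y 0 (reI (lshift m c)) +i* y 0 (imI (lshift m c))).
Proof. by apply/funext => y; rewrite /zc !mxE reI_z imI_z. Qed.

Lemma csm_zc c x : csm x (zc c).
Proof. by rewrite zcE; split=> /=; exact: smooth_near_coord. Qed.

Lemma dfun_zcb c x (X : 'rV[C]_d) : dfun (fun y => (zc c y)^*) x X = (X *m Dzb) 0 (lshift m c).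
Proof. by rewrite zcE dfun_coord_conj mulDzb. Qed.

Lemma dfun_zc c x (X : 'rV[C]_d) : dfun (zc c) x X = (X *m Dz) 0 (lshift m c).
Proof.
rewrite -{1}[X]conjvK (_ : zc c = fun y => ((zc c y)^*)^*); last first.
  by apply/funext => y; rewrite conjcK.
rewrite dfun_conj; last exact: cdiff_conj (csm_diff (csm_zc c x)).
by rewrite dfun_zcb conjv_Dzb mxE conjcK.
Qed.

Lemma zetaco_z (h : R) y i : w i != 0%N -> zetaco (h *: (delta_mx 0 i : 'rV[R]_d) + y) = zetaco y.
Proof.
move=> wi; have d0 (al : 'I_(m + m)) : (rshift (s + s) (lshift 1 al) == i) = false.
  by apply: contra_neqF wi => /eqP <-; rewrite /coord_wt split_r split_l.
by apply/rowP => al; rewrite !mxE !d0 !andbF !mulr0 !add0r.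
Qed.

Lemma dfun_zeta (g : 'rV[C]_m -> C) a x :
  dfun (fun y => g (zetaco y)) x (row (lshift m a) Ez) = 0 /\
  dfun (fun y => g (zetaco y)) x (row (lshift m a) Ezb) = 0.
Proof.
have c0 i : w i != 0%N -> cpd i (fun y => g (zetaco y)) x = 0.
  by move=> wi; rewrite /cpd; congr (_ +i* _); apply: pd_invariant => h y; rewrite zetaco_z.
have cr : cpd (reI (lshift m a)) (fun y => g (zetaco y)) x = 0 by apply: c0; rewrite w_reI wA_z.
have ci : cpd (imI (lshift m a)) (fun y => g (zetaco y)) x = 0 by apply: c0; rewrite w_imI wA_z.
split; [refine (etrans (dfun_rowEz _ _ _) _)|refine (etrans (dfun_rowEzb _ _ _) _)];
  by rewrite cr ci !mulr0 ?subr0 ?addr0 mulr0.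
Qed.

Definition Mzeta : 'M[R]_(d, m + m) := col_mx 0 (col_mx 1%:M 0).

Lemma mulMzeta x : x *m Mzeta = lsubmx (rsubmx x).
Proof.
rewrite -{1}[x]hsubmxK mul_row_col mulmx0 add0r.
by rewrite -{1}[rsubmx x]hsubmxK mul_row_col mulmx0 addr0 mulmx1.
Qed.

Lemma csm_analytic (A : 'rV[C]_m -> 'M[C]_s) c e : analytic_mx A ->
  csm (0 : 'rV[R]_d) (fun x => A (zetaco x) c e).
Proof.
move=> /(_ c e)[[f1 e1] [f2 e2]].
have [s1 _] := expansion_smooth_weight e1; have [s2 _] := expansion_smooth_weight e2.
split.
  have := @smooth_near_comp_lin _ _ _ Mzeta 0 _; rewrite mul0mx => /(_ _ s1).
  by apply: smooth_near_ext; apply: filterE => x; rewrite mulMzeta.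
have := @smooth_near_comp_lin _ _ _ Mzeta 0 _; rewrite mul0mx => /(_ _ s2).
by apply: smooth_near_ext; apply: filterE => x; rewrite mulMzeta.
Qed.

Lemma cplx0 k : cplx (0 : 'rV[R]_(k + k)) = 0.
Proof. by apply/rowP => j; rewrite !mxE. Qed.

Lemma zetaco0 : zetaco (0 : 'rV[R]_d) = 0.
Proof. by rewrite /zetaco -[RHS]cplx0; congr cplx; apply/rowP => j; rewrite !mxE. Qed.

Variables (H S : 'rV[C]_m -> 'M[C]_s).

Definition term (c e : 'I_s) x : C :=
  zc c x * H (zetaco x) c e * (zc e x)^* + (zc c x)^* * S (zetaco x) c e * (zc e x)^*.

Lemma modelE x : model H S x = reC (\sum_c \sum_e term c e x).
Proof.
have mE (u v : 'rV[C]_s) (M : 'M[C]_s) : (u *m M *m v^T) 0 0 = \sum_c \sum_e u 0 c * M c e * v 0 e.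
  rewrite mxE exchange_big/=; apply: eq_bigr => e _.
  by rewrite mxE mulr_suml; apply: eq_bigr => c _; rewrite [v^T _ _]mxE.
rewrite /model !mE -raddfD/= -big_split/=; congr reC; apply: eq_bigr => c _.
rewrite -big_split/=; apply: eq_bigr => e _.
by rewrite /term /zc [conjv _ _ _]mxE [conjv _ 0 c]mxE.
Qed.

Lemma model_v_invariant : v_invariant (model H S).
Proof.
move=> h y; have d0 (a : 'I_(s + s)) : (lshift (m + m + 1) a == vI) = false.
  by rewrite /vI eq_shift.
have zE : zco (h *: (delta_mx 0 vI : 'rV[R]_d) + y) = zco y.
  by apply/rowP => c; rewrite !mxE !d0 !andbF !mulr0 !add0r.
by rewrite /model zE zetaco_z ?w_vI.
Qed.

(** The dilation fixes zeta, and P is quadratic in z and its conjugate. *)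
Lemma model_homogeneous : homogeneous w 0 2 (model H S).
Proof.
apply: filterE => y t _; rewrite expr0 mul1r.
have zE : zco (scale w t y) = t%:C *: zco y.
  apply/rowP => c; rewrite [LHS](_ : _ = zc c (scale w t y)) // [RHS]mxE -/(zc c y) zcE.
  rewrite [scale w t y 0 (reI _)]mxE [scale w t y 0 (imI _)]mxE w_reI w_imI wA_z !expr1.
  by apply/eqP; rewrite eq_complex /= !mul0r subr0 addr0 !eqxx.
have zeE : zetaco (scale w t y) = zetaco y.
  apply/rowP => c; rewrite !mxE /coord_wt !split_r !split_l !expr0 !mul1r.
  by [].
have ce (u : 'rV[C]_s) : conjv (t%:C *: u) = t%:C *: conjv u.
  by apply/rowP => j; rewrite !mxE rmorphM /= oppr0.
have q2 (u v : 'rV[C]_s) (M : 'M[C]_s) (r : C) :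
    ((r *: u) *m M *m (r *: v)^T) 0 0 = r ^+ 2 * (u *m M *m v^T) 0 0.
  by rewrite linearZ/= -scalemxAl -scalemxAl -scalemxAr scalerA [LHS]mxE.
have reM (r : R) (z : C) : reC (r%:C * z) = r * reC z by case: z => u v /=; rewrite mul0r subr0.
by rewrite /model zE zeE ce !q2 -rmorphXn !reM -mulrDr.
Qed.

Hypothesis aH : analytic_mx H.
Hypothesis aS : analytic_mx S.

Lemma csm_term c e : csm 0 (term c e).
Proof.
by apply: csm_add; (apply: csm_mul; [apply: csm_mul|]); try exact: csm_analytic;
  try exact: csm_conj (csm_zc _ _); exact: csm_zc.
Qed.

Lemma model_smooth : smooth_near 0 (model H S).
Proof.
have [h _] : csm 0 (fun x => \sum_c \sum_e term c e x).
  by apply: csm_sum => c; apply: csm_sum => e; exact: csm_term.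
by apply: smooth_near_ext h; apply: filterE => x; rewrite modelE.
Qed.

Lemma model_W N : W w N 2 (model H S).
Proof. by apply: W_homogeneous; [exact: model_smooth|exact: model_homogeneous]. Qed.

Lemma dfun_triple (f g h : 'rV[R]_d -> C) x X : cdiff f x -> cdiff g x -> cdiff h x -> dfun g x X = 0 ->
  dfun (fun y => f y * g y * h y) x X = g x * (dfun f x X * h x + f x * dfun h x X).
Proof.
move=> df dg dh g0; rewrite dfunM//; last exact: cdiffM.
rewrite dfunM// g0; move: (f x) (g x) (h x) (dfun f x X) (dfun h x X) => a b c e k.
by ring.
Qed.

Lemma term_conj c e x : (term c e x)^* =
  (zc c x)^* * (H (zetaco x) c e)^* * zc e x + zc c x * (S (zetaco x) c e)^* * zc e x.
Proof. by rewrite /term rmorphD !rmorphM/= !conjcK. Qed.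

(** Twice the derivative along z_a of the real part of [term]. *)
Definition grad_term (a c e : 'I_s) x : C :=
  (c == a)%:R * (H (zetaco x) c e * (zc e x)^*) + (e == a)%:R * ((H (zetaco x) c e)^* * (zc c x)^*)
  + (S (zetaco x) c e)^* * ((c == a)%:R * zc e x + (e == a)%:R * zc c x).

Lemma near_cdiff : \forall x \near (0 : 'rV[R]_d), forall c e,
  cdiff (fun x => H (zetaco x) c e) x /\ cdiff (fun x => S (zetaco x) c e) x.
Proof.
have h : forall ce : 'I_s * 'I_s, \forall x \near (0 : 'rV[R]_d),
    cdiff (fun x => H (zetaco x) ce.1 ce.2) x /\ cdiff (fun x => S (zetaco x) ce.1 ce.2) x.
  move=> [c e] /=; apply: filterS2 (csm_near (csm_analytic c e aH)) (csm_near (csm_analytic c e aS)).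
  by move=> x /csm_diff a /csm_diff b.
have h' := filter_forall (nbhs_filter (0 : 'rV[R]_d)) h.
by apply: filterS h' => x hx c e; exact: (hx (c, e)).
Qed.

Lemma rowEzDz a c : (row (lshift m a) Ez *m Dz) 0 (lshift m c) = (c == a)%:R.
Proof. by rewrite -row_mul EzDz !mxE eq_shift eq_sym. Qed.
Lemma rowEzDzb a c : (row (lshift m a) Ez *m Dzb) 0 (lshift m c) = 0.
Proof. by rewrite -row_mul EzDzb !mxE. Qed.
Lemma rowEzbDz a c : (row (lshift m a) Ezb *m Dz) 0 (lshift m c) = 0.
Proof. by rewrite -row_mul EzbDz !mxE. Qed.
Lemma rowEzbDzb a c : (row (lshift m a) Ezb *m Dzb) 0 (lshift m c) = (c == a)%:R.
Proof. by rewrite -row_mul EzbDzb !mxE eq_shift eq_sym. Qed.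

Lemma reC_half (z : C) : (reC z)%:C = 2^-1 * (z + z^*).
Proof.
rewrite (_ : z + z^* = 2%:R * (reC z)%:C); first by rewrite mulKf// pnatr_eq0.
case: z => u v; apply/eqP; rewrite eq_complex /= !(mul0r, mul1r, addr0, subr0) subrr.
by rewrite mulr0 mulrDl mul1r !eqxx.
Qed.

Lemma dfun_model a : \forall x \near (0 : 'rV[R]_d),
  dfun (fun y => (model H S y)%:C) x (row (lshift m a) Ez) = 2^-1 * \sum_c \sum_e grad_term a c e x.
Proof.
apply: filterS near_cdiff => x cx.
rewrite (_ : (fun y => _) = (fun y => 2^-1 * \sum_c \sum_e (term c e y + (term c e y)^*))); last first.
  apply/funext => y; rewrite modelE reC_half; congr (_ * _).
  rewrite rmorph_sum -big_split; apply: eq_bigr => c _.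
  by rewrite rmorph_sum -big_split.
have dz c : cdiff (zc c) x := csm_diff (csm_zc c x).
have dzb c : cdiff (fun y => (zc c y)^*) x := cdiff_conj (dz c).
have dH c e := (cx c e).1; have dS c e := (cx c e).2.
have dHb c e := cdiff_conj (dH c e); have dSb c e := cdiff_conj (dS c e).
have dt c e : cdiff (term c e) x.
  by apply: cdiffD; (apply: cdiffM; [apply: cdiffM|]); (exact: dH || exact: dS || exact: dzb || exact: dz).
have dtt c e : cdiff (fun y => term c e y + (term c e y)^*) x.
  by apply: cdiffD => //; exact: cdiff_conj.
have ds c : cdiff (fun y => \sum_e (term c e y + (term c e y)^*)) x.
  exact: (cpd_sum vI _ (dtt c)).2.
rewrite dfunM ?dfun_cst ?mulr0 ?addr0; [|exact: cdiff_cst|exact: (cpd_sum vI _ ds).2].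
congr (_ * _); rewrite (dfun_sum _ _ ds); apply: eq_bigr => c _.
rewrite (dfun_sum _ _ (dtt c)); apply: eq_bigr => e _.
have [hH _] := dfun_zeta (fun z => H z c e) a x.
have [hS _] := dfun_zeta (fun z => S z c e) a x.
have [hHb _] := dfun_zeta (fun z => (H z c e)^*) a x.
have [hSb _] := dfun_zeta (fun z => (S z c e)^*) a x.
rewrite dfunD//; last exact: cdiff_conj.
rewrite (_ : (fun y => (term c e y)^*) = (fun y => (zc c y)^* * (H (zetaco y) c e)^* * zc e y + zc c y * (S (zetaco y) c e)^* * zc e y)); last first.
  by apply/funext => y; exact: term_conj.
rewrite /term !dfunD; try by (apply: cdiffM; [apply: cdiffM|]); (exact: dH || exact: dS || exact: dzb || exact: dz || exact: dHb || exact: dSb).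
rewrite (dfun_triple (dz c) (dH c e) (dzb e) hH) (dfun_triple (dzb c) (dS c e) (dzb e) hS).
rewrite (dfun_triple (dzb c) (dHb c e) (dz e) hHb) (dfun_triple (dz c) (dSb c e) (dz e) hSb).
rewrite !dfun_zc !dfun_zcb !rowEzDz !rowEzDzb /grad_term.
by ring.
Qed.

(** The derivative of the S-part along z is linear in z with coefficients in
    zeta, so it is killed by derivatives along conj z. *)
Lemma dfun_grad_term a b : \forall x \near (0 : 'rV[R]_d),
  dfun (fun y => 2^-1 * \sum_c \sum_e grad_term a c e y) x (row (lshift m b) Ezb) =
  2^-1 * (H (zetaco x) a b + (H (zetaco x) b a)^*).
Proof.
apply: filterS near_cdiff => x cx.
have dz c : cdiff (zc c) x := csm_diff (csm_zc c x).
have dzb c : cdiff (fun y => (zc c y)^*) x := cdiff_conj (dz c).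
have dH c e := (cx c e).1; have dS c e := (cx c e).2.
have dHb c e := cdiff_conj (dH c e); have dSb c e := cdiff_conj (dS c e).
have dc (k : C) : cdiff (fun _ : 'rV[R]_d => k) x by exact: cdiff_cst.
have d1 c e (k : C) : cdiff (fun y => k * (H (zetaco y) c e * (zc e y)^*)) x.
  by apply: cdiffM => //; apply: cdiffM; [exact: dH|exact: dzb].
have d2 c e (k : C) : cdiff (fun y => k * ((H (zetaco y) c e)^* * (zc c y)^*)) x.
  by apply: cdiffM => //; apply: cdiffM; [exact: dHb|exact: dzb].
have d3 c e (k l : C) : cdiff (fun y => k * zc e y + l * zc c y) x.
  by apply: cdiffD; apply: cdiffM.
have d4 c e (k l : C) : cdiff (fun y => (S (zetaco y) c e)^* * (k * zc e y + l * zc c y)) x.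
  by apply: cdiffM => //; exact: dSb.
have dg c e : cdiff (grad_term a c e) x by apply: cdiffD => //; apply: cdiffD.
have ds c : cdiff (fun y => \sum_e grad_term a c e y) x := (cpd_sum vI _ (dg c)).2.
rewrite dfunM ?dfun_cst ?mulr0 ?addr0; [|exact: cdiff_cst|exact: (cpd_sum vI _ ds).2].
congr (_ * _); rewrite (dfun_sum _ _ ds).
transitivity (\sum_c \sum_e ((c == a)%:R * ((e == b)%:R * H (zetaco x) c e)
    + (e == a)%:R * ((c == b)%:R * (H (zetaco x) c e)^*))).
  apply: eq_bigr => c _; rewrite (dfun_sum _ _ (dg c)); apply: eq_bigr => e _.
  have [_ hH] := dfun_zeta (fun z => H z c e) b x.
  have [_ hHb] := dfun_zeta (fun z => (H z c e)^*) b x.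
  have [_ hSb] := dfun_zeta (fun z => (S z c e)^*) b x.
  rewrite /grad_term dfunD//; last by apply: cdiffD.
  rewrite dfunD// [X in X + _ + _]dfunM//; last by apply: cdiffM; [exact: dH|exact: dzb].
  rewrite [X in _ + X + _]dfunM//; last by apply: cdiffM; [exact: dHb|exact: dzb].
  rewrite [X in _ + X]dfunM//; last exact: dSb.
  rewrite [dfun (fun y => _ * _ + _ * _) _ _]dfunD; try exact: cdiffM.
  rewrite [dfun (fun y => H (zetaco y) c e * _) _ _]dfunM; [|exact: dH|exact: dzb].
  rewrite [dfun (fun y => (H (zetaco y) c e)^* * _) _ _]dfunM; [|exact: dHb|exact: dzb].
  rewrite [dfun (fun y => (c == a)%:R * zc e y) _ _]dfunM//.
  rewrite [dfun (fun y => (e == a)%:R * zc c y) _ _]dfunM//.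
  rewrite !dfun_cst hH hHb hSb !dfun_zc !dfun_zcb !rowEzbDz !rowEzbDzb.
  by ring.
rewrite (eq_bigr (fun c => (c == a)%:R * H (zetaco x) c b + (c == b)%:R * (H (zetaco x) c a)^*)).
  by rewrite big_split/= !sum_delta_mul'.
move=> c _; rewrite big_split/= -mulr_sumr !sum_delta_mul'.
by [].
Qed.

Hypothesis hermH : \forall e \near (0 : 'rV[R]_(m + m)),
  map_mx (@conjc R) (H (cplx e))^T = H (cplx e).

Lemma herm0 a b : (H 0 b a)^* = H 0 a b.
Proof.
have := nbhs_singleton hermH; rewrite cplx0 => /matrixP/(_ a b).
by rewrite !mxE.
Qed.

Lemma dmu_model a b : dfun (fun y => mu (model H S) y 0 (lshift m a)) 0 (row (lshift m b) Ezb)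
  = ii^-1 * H 0 a b.
Proof.
rewrite (@dfun_near _ _ _ (fun y => ii^-1 * (2^-1 * \sum_c \sum_e grad_term a c e y))); last first.
  apply: filterS (dfun_model a) => x E.
  by rewrite (invariant_muE model_v_invariant) E.
have sg : csm 0 (fun y => 2^-1 * \sum_c \sum_e grad_term a c e y).
  apply: csm_ext (csm_dfun (csm_real model_smooth) (fun j => csm_cst 0 (row (lshift m a) Ez 0 j))).
  exact: dfun_model.
rewrite dfunM ?dfun_cst ?mulr0 ?addr0; [|exact: cdiff_cst|exact: csm_diff sg].
congr (_ * _); apply: (etrans (nbhs_singleton (dfun_grad_term a b))); rewrite zetaco0.
apply: (etrans (congr1 (fun z => 2^-1 * (H 0 a b + z)) (herm0 a b))).
by move: (H 0 a b) => z; field.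
Qed.

(** The mixed derivatives of P along z and conj z at the origin are H(0), and
    the two terms of the Levi matrix carry the factors i and -1/i. *)
Lemma model_levzz : ulsubmx (lev (model H S) 0) = (2%:R * ii) *: H 0.
Proof.
apply/matrixP => a b; rewrite ulE [RHS]mxE (invariant_levE model_v_invariant) dmu_model.
have -> : dfun (fun z => (mu (model H S) z 0 (lshift m b))^*) 0 (row (lshift m a) Ez) = (ii^-1)^* * H 0 a b.
  rewrite (_ : row (lshift m a) Ez = conjv (row (lshift m a) Ezb)); last by rewrite /conjv map_row conj_Ezb.
  rewrite dfun_conj; last by exact: csm_diff (csm_mu model_smooth 0 (lshift m b)).
  by rewrite dmu_model rmorphM /= herm0.
have ii0 : ii != 0.
  by apply/eqP => E; have := ii2 R; rewrite E mulr0 => /esym/eqP; rewrite oppr_eq0 oner_eq0.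
have iV : ii^-1 = - ii by apply: (mulfI ii0); rewrite mulrN ii2 opprK divff.
have kE : conjc (ii^-1) = ii by rewrite iV -conj_ii conjcK.
apply: (etrans (congr1 (fun k => k * H 0 a b - ii^-1 * H 0 a b) kE)).
by rewrite iV; move: (H 0 a b) ii => z i; ring.
Qed.

Lemma model_unit : H 0 \in unitmx -> ulsubmx (lev (model H S) 0) \in unitmx.
Proof.
move=> uH; rewrite model_levzz unitmxZ// unitfE mulf_neq0 ?pnatr_eq0//.
by apply/eqP => E; have := ii2 R; rewrite E mulr0 => /esym/eqP; rewrite oppr_eq0 oner_eq0.
Qed.
End model.

Theorem proposition5p1 (R : realType) (s m : nat)
  (H S : 'rV[R[i]]_m -> 'M[R[i]]_s) (Q : 'rV[R]_(chart_dim s m) -> R)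
  (H_analytic : analytic_mx H) (S_analytic : analytic_mx S)
  (H_hermitian : \forall e \near (0 : 'rV[R]_(m + m)),
     map_mx (@conjc R) (H (cplx e))^T = H (cplx e))
  (S_symmetric : \forall e \near (0 : 'rV[R]_(m + m)),
     (S (cplx e))^T = S (cplx e))
  (H_nondegenerate : H 0 \in unitmx)
  (Q_terms : exists2 c, expansion Q c & forall a, c a != 0 -> (2 < term_wt a)%N)
  (M_nondegenerate : uniformly_2nondegenerate
     (graph_CR (fun x => model H S x + Q x)) m 0) :
  uniformly_2nondegenerate (graph_CR (model H S)) m 0 /\
  forall (nu : choice_rule R (chart_dim s m) s)
         (quo quo' : 'rV[R]_(chart_dim s m) -> 'rV[R]_(s + s + 1)),
    normalization_condition nu ->
    local_quotient (graph_CR (fun x => model H S x + Q x)) 0 quo ->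
    local_quotient (graph_CR (model H S)) 0 quo' ->
    same_modified_symbol m nu 0
      (graph_CR (fun x => model H S x + Q x)) quo
      (graph_CR (model H S)) quo'.
Proof.
set F := fun x => model H S x + Q x; set F0 := model H S.
have WF0 N : W (@coord_wt s m) N 2 F0 by exact: model_W.
have WQ0 N : W (@coord_wt s m) N 3 Q.
  by have [c cQ cw] := Q_terms; apply: W_expansion cQ _ => a /cw.
have WF N : W (@coord_wt s m) N 2 F by apply: W_add => //; exact: (W_le _ (WQ0 N)).
have WQ N : W (@coord_wt s m) N 3 (fun x => F x - F0 x).
  by apply: W_ext (WQ0 N); apply: filterE => x; rewrite /F addrC addKr.
have u0 : ulsubmx (lev F0 0) \in unitmx by exact: model_unit.
have iF0 : v_invariant F0 := @model_v_invariant R s m H S.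
have hF0 : homogeneous (@coord_wt s m) 0 2 F0 := @model_homogeneous R s m H S.
have [m0 nd] := M_nondegenerate.
have gF : \forall y \near (0 : 'rV[R]_(chart_dim s m)), good F y.
  have uF := near_ul_unit WF (uF0 WF WF0 WQ u0).
  apply: filterS2 (filterI uF (smooth_near_near (WF 0).1)) nd => y [uy sy] [dy _].
  by split=> //; exact: dim_schur sy uy dy.
have inj := (nbhs_singleton nd).2.
split; first exact: model_nondegenerate WF WF0 WQ u0 iF0 hF0 gF m0 inj.
move=> nu quo quo' nnu lq lq'.
exact: (same_symbol_graph WF WF0 WQ u0 iF0 hF0 gF lq lq' nnu).
Qed.
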